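(* Let $p\geq 2$ and let $X_N=I_p(f_N)$, $N\geq 1$, with $f_N\in H^{\odot p}$ for each $N\geq 1$, be such that $X_N\xrightarrow[N\to\infty]{(d)}N(0,\sigma^2)$ with $\sigma^2>0$. Let $\mathbb Y_N=(Y_{1,N},\ldots,Y_{d,N})$, $N\geq 1$, be a $d$-dimensional random sequence such that for all $j=1,\ldots,d$, $$Y_{j,N}=\sum_{k=1}^\infty I_k(g_{k,N}^{(j)}),\qquad g_{k,N}^{(j)}\in H^{\odot k}\ \text{ for all } N,k\geq 1.$$ Suppose that: 1. there exists $\mathbb Y\in L^2(\Omega)$ (an $\mathbb R^d$-valued random vector) such that $\mathbb Y_N\to_{N\to\infty}\mathbb Y$ in $L^2(\Omega)$; 2. for every $j=1,\ldots,d$, $\mathbf E[X_NY_{j,N}]\to_{N\to\infty}\rho_j$; 3. for every $j=1,\ldots,d$, $\displaystyle\sup_{N\geq 1}\sum_{k=M+1}^\infty k!\,\|g_{k,N}^{(j)}\|^2_{H^{\otimes k}}\to_{M\to\infty}0$. Then $(X_N,\mathbb Y_N)\xrightarrow[N\to\infty]{(d)}(Z,\mathbb Y)$, where $Z\sim N(0,\sigma^2)$ and the characteristic function of $(Z,\mathbb Y)$ is given, for every $u\in\mathbb R$, $v\in\mathbb R^d$, with $\rho=(\rho_1,\ldots,\rho_d)$, by $$\varphi_{(Z,\mathbb Y)}(u,v)=\mathbf E\left[e^{i\langle v,\mathbb Y\rangle}\right]e^{-\frac{\sigma^2u^2}{2}-u\langle\rho,v\rangle}.$$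
   Context: $H$ is a real separable Hilbert space, $H^{\odot n}$ is the symmetric $n$-th tensor power of $H$ (symmetric elements of $H^{\otimes n}$), $(W(h),h\in H)$ is an isonormal Gaussian process on a probability space $(\Omega,\mathcal A,P)$, and $I_n$ is the multiple Wiener–Itô integral of order $n$ with respect to $W$, normalized so that $\mathbf E[I_n(f)I_m(g)]=n!\langle f,g\rangle_{H^{\otimes n}}$ if $n=m$ and $0$ otherwise, for symmetric $f,g$. $\langle\cdot,\cdot\rangle$ without subscript is the Euclidean scalar product on $\mathbb R^d$. $\xrightarrow{(d)}$ denotes convergence in distribution. *)

(* Defs.v *)
From HB Require Import structures.
From mathcomp Require Import all_boot all_order all_algebra all_fingroup.
From mathcomp Require Import all_classical all_reals all_analysis.
From mathcomp.real_closed Require Import complex.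

Set Implicit Arguments.
Unset Strict Implicit.
Unset Printing Implicit Defensive.

Import Order.TTheory GRing.Theory Num.Theory.
Import numFieldNormedType.Exports.

Local Open Scope classical_set_scope.
Local Open Scope ring_scope.
Local Open Scope complex_scope.

HB.mixin Record CompleteNormedModule_isHilbert (R : realType) (H : Type)
    of CompleteNormedModule R H := {
  inner : H -> H -> R ;
  innerC : forall x y, inner x y = inner y x ;
  inner_linearl : forall y, scalar (inner ^~ y) ;
  inner_norm : forall x, inner x x = `|x| ^+ 2
}.

#[short(type="hilbertType")]
HB.structure Definition Hilbert (R : realType) :=
  {H of CompleteNormedModule R H & CompleteNormedModule_isHilbert R H}.

Definition separable (T : topologicalType) : Prop :=
  exists2 D : set T, countable D & dense D.

(* The Hilbert tensor power of order n is determined by these fields up to a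
   unique isometry compatible with the elementary tensors. Statements quantify
   over an arbitrary realization. The operators tensor_perm s are determined by
   their values on elementary tensors, whose span is dense. *)
Record tensor_power (R : realType) (H : hilbertType R) (n : nat) := {
  tensor_space :> hilbertType R ;
  tensor : ('I_n -> H) -> tensor_space ;
  tensor_perm : 'S_n -> tensor_space -> tensor_space ;
  tensor_multilinear : forall (h : 'I_n -> H) (i : 'I_n),
    linear (fun x : H => tensor (dfwith h i x)) ;
  inner_tensor : forall g h : 'I_n -> H,
    inner (tensor g) (tensor h) = \prod_(i < n) inner (g i) (h i) ;
  tensor_dense : dense [set t : tensor_space |
    exists m (c : 'I_m -> R) (h : 'I_m -> 'I_n -> H),
      t = \sum_(i < m) c i *: tensor (h i)] ;
  tensor_perm_linear : forall s : 'S_n, linear (tensor_perm s) ;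
  tensor_perm_continuous : forall s : 'S_n, continuous (tensor_perm s) ;
  tensor_permE : forall (s : 'S_n) (h : 'I_n -> H),
    tensor_perm s (tensor h) = tensor (h \o s)
}.

Section tensors.
Context (R : realType) (H : hilbertType R) (n : nat) (T : tensor_power H n).

Definition symmetric_tensor : set T :=
  [set t | forall s : 'S_n, tensor_perm s t = t].

Definition tensor_exp (h : H) : T := tensor T (fun=> h).

End tensors.
Arguments symmetric_tensor {R H n} T.

(* Monic (probabilists') Hermite polynomials: He_0 = 1, He_1 = X,
   He_2 = X^2 - 1, ... *)
Fixpoint hermite (R : realType) (n : nat) : {poly R} :=
  if n is m.+1 then 'X * hermite R m - deriv (hermite R m) else 1.

Section gaussian.
Context (R : realType) (d : measure_display) (Omega : measurableType d).
Variable P : probability Omega R.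

Definition has_law (X : Omega -> R) (mu : set R -> \bar R) : Prop :=
  forall A : set R, measurable A -> P (X @^-1` A) = mu A.

(* The degenerate case is separate because the library's [normal_prob 0 0] is
   the uniform law on [0, 1]. *)
Definition centered_gaussian (X : Omega -> R) : Prop :=
  (X = cst 0 %[ae P]) \/ exists2 s : R, 0 < s & has_law X (normal_prob 0 s).

Definition isonormal (H : hilbertType R) (W : H -> {RV P >-> R}) : Prop :=
  (forall n (c : 'I_n -> R) (h : 'I_n -> H),
    centered_gaussian (fun w => \sum_(i < n) c i * W (h i) w)) /\
  (forall g h : H, ('E_P[fun w => (W g w * W h w)%R] = (inner g h)%:E)%E).

(* I_n is the linear isometry (up to the factor n!) from symmetric tensors to
   L^2(Omega) with I_n (h^{(x) n}) = He_n (W h) for every unit vector h. The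
   symmetric tensors h^{(x) n}, |h| = 1, span a dense subspace, so these
   conditions determine I_n f almost surely; values of I n off the symmetric
   tensors are irrelevant. *)
Definition multiple_integral (H : hilbertType R)
    (T : forall n, tensor_power H n) (W : H -> {RV P >-> R})
    (I : forall n, T n -> {RV P >-> R}) : Prop :=
  [/\ forall n (a : R) (f g : T n),
        f \in symmetric_tensor (T n) -> g \in symmetric_tensor (T n) ->
        (I n (a *: f + g) : Omega -> R)
          = (fun w => a * I n f w + I n g w) %[ae P],
      forall n (f g : T n),
        f \in symmetric_tensor (T n) -> g \in symmetric_tensor (T n) ->
        ('E_P[fun w => (I n f w * I n g w)%R] = (n`!%:R * inner f g)%:E)%E,
      forall n m (f : T n) (g : T m), n != m ->
        f \in symmetric_tensor (T n) -> g \in symmetric_tensor (T m) ->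
        ('E_P[fun w => (I n f w * I m g w)%R] = 0)%E
    & forall n (h : H), `|h| = 1 ->
        (I n (tensor_exp (T n) h) : Omega -> R)
          = (fun w => (hermite R n).[W h w]) %[ae P]].

End gaussian.

Section vectors.
Context (R : realType) (k : nat).

Definition dotv (u v : 'rV[R]_k) : R := \sum_(j < k) u 0 j * v 0 j.

Definition rvec (Omega : Type) (Y : 'I_k -> Omega -> R) (w : Omega) : 'rV[R]_k :=
  \row_j Y j w.

End vectors.

Section modes_of_convergence.
Context (R : realType) (d : measure_display) (Omega : measurableType d).
Variable P : probability Omega R.

Definition L2_cvg (X : nat -> Omega -> R) (X' : Omega -> R) : Prop :=
  ('E_P[fun w => ((X n w - X' w) ^+ 2)%R])%E @[n --> \oo] --> 0%E.

Definition L2_cvgv k (Y : nat -> Omega -> 'rV[R]_k) (Y' : Omega -> 'rV[R]_k) :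
    Prop :=
  ('E_P[fun w => dotv (Y n w - Y' w)%R (Y n w - Y' w)%R])%E @[n --> \oo] --> 0%E.

Context (d' : measure_display) (Omega' : measurableType d').
Variable P' : probability Omega' R.

(* The limit may live on another probability space. *)
Definition cvg_in_law (T : topologicalType) (V : nat -> Omega -> T)
    (V' : Omega' -> T) : Prop :=
  forall phi : T -> R, continuous phi -> bounded_fun phi ->
    ('E_P[phi \o V n])%E @[n --> \oo] --> ('E_P'[phi \o V'])%E.

Definition same_law (T : topologicalType) (V : Omega -> T) (V' : Omega' -> T) :
    Prop :=
  forall B : set T, <<s [set U | open U] >> B ->
    P (V @^-1` B) = P' (V' @^-1` B).

End modes_of_convergence.

Definition expi (R : realType) (x : R) : R[i] := cos x +i* sin x.

Definition cexpectation (R : realType) (d : measure_display)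
    (Omega : measurableType d) (P : probability Omega R)
    (F : Omega -> R[i]) : R[i] :=
  fine ('E_P[fun w => complex.Re (F w)])%E +i*
  fine ('E_P[fun w => complex.Im (F w)])%E.

(* Characteristic function of an R x R^k-valued random variable. *)
Definition charfun_pair (R : realType) (d : measure_display)
    (Omega : measurableType d) (P : probability Omega R) k
    (Z : Omega -> R) (Y : Omega -> 'rV[R]_k) (u : R) (v : 'rV[R]_k) : R[i] :=
  cexpectation P (fun w => expi (u * Z w + dotv v (Y w))).

(* Main.v *)
(* X_N is asymptotically independent of every fixed square integrable variable,
   so that rho = 0 and the limit law is N(0, sigma^2) times the law of Y, realized
   on R x Omega.

   By polarization, X_N is close in L^2 to F_N = sum_i c_i He_p(W h_i) with unit
   vectors h_i. Hypercontractivity turns convergence in law into convergence of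
   moments, and the bound
     (E (D_g F)^2)^2 <= p (E F^4 - 3 (E F^2)^2)
   then makes the directional derivatives D_g F_N vanish in L^2. Integration by
   parts for E [F_N^a W(g) Q] reduces the degree of Q, which gives
     E [F_N^a Q] -> E [Z^a] E [Q]
   for every polynomial Q in the process W, and then for every Q in L^2(Omega),
   because F_N^a is itself such a polynomial. Bounded continuous functions are
   L^2-limits of polynomials under the normal law, so F_N^a may be replaced by
   psi(F_N).

   Finally phi(X_N, Y_N) is close to a finite sum of terms psi_k(F_N) 1_{Y in A_k},
   where the cells A_k partition a cube and psi_k is phi with its second argument
   frozen at a node of A_k. *)
Require Import Defs.
From HB Require Import structures.
From mathcomp Require Import all_boot all_order all_algebra all_fingroup.
From mathcomp Require Import all_classical all_reals all_analysis.
From mathcomp.real_closed Require Import complex.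
From mathcomp Require Import ring lra measurable_realfun.
From mathcomp.multinomials Require Import (canonicals, coercions) mpoly.

Set Implicit Arguments.
Unset Strict Implicit.
Unset Printing Implicit Defensive.

Import Order.TTheory GRing.Theory Num.Theory.
Import numFieldNormedType.Exports.

Local Open Scope classical_set_scope.
Local Open Scope ring_scope.

(** * Gaussian calculus *)

(** The data on W are one-dimensional: every linear combination is centered normal, and covariances
    are inner products. Joint integration by parts has to be derived from this. The moments of f + s
    g, compared as polynomials in s, give it for powers of a linear form; it reaches all monomials
    because k! times a product of k variables is a signed sum of k-th powers. The same polarization
    makes powers of unit vectors, the tensors on which I is explicit, span a dense part of the
    symmetric tensors. From there on the calculus is algebraic, without chaos expansions, product
    formulas or contractions. The number operator N, the commutator [D, N] = D and positivity of the
    expectation suffice, and the inequality N <= m in degree m stands in for a spectral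
    decomposition. Two points need care with limits. Convergence in law controls no moment by
    itself, so an escape of E F_N^2 must be excluded before hypercontractivity can bound anything.
    And a polynomial close to psi is so only under the normal law; the error is brought back to F_N
    because its square has polynomial growth. *)

Lemma discriminant_le0 (R : realType) (a b c : R) :
  (forall t, 0 <= a + 2 * t * b + t ^+ 2 * c) -> b ^+ 2 <= a * c.
Proof.
move=> h.
have a0 : 0 <= a by have := h 0; rewrite mulr0 mul0r expr2 mul0r mul0r !addr0.
have [c0|c0] := eqVneq c 0.
  rewrite c0 mulr0; have [->|b0] := eqVneq b 0; first by rewrite expr0n.
  have := h (- (a + 1) / (2 * b)); rewrite c0 mulr0 addr0.
  have -> : 2 * (- (a + 1) / (2 * b)) * b = - (a + 1) by field.
  by rewrite opprD addrA subrr add0r oppr_ge0 ler10.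
have := h (- b / c).
have -> : a + 2 * (- b / c) * b + (- b / c) ^+ 2 * c = (a * c - b ^+ 2) / c by field.
have c1 : 0 < c.
  rewrite lt_neqAle eq_sym c0 /= leNgt; apply/negP => cn.
  (* A negative c is refuted at t or -t, whichever makes the linear term nonpositive: t >= 1 and t
     (-c) > a force a negative value. *)
  pose t := (`|b| + a + 1) / (- c) + 1.
  have cp : 0 < - c by rewrite oppr_gt0.
  have t1 : 1 <= t.
    by rewrite /t lerDr mulr_ge0 ?invr_ge0 ?(ltW cp)// !addr_ge0.
  have tc : t * - c = `|b| + a + 1 - c.
    by rewrite /t mulrDl mul1r mulfVK// gt_eqF.
  have [bp|bn] := leP 0 b.
    have := h (- t); rewrite (ger0_norm bp) in tc; nra.
  by have := h t; rewrite (ltr0_norm bn) in tc; nra.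
by rewrite pmulr_lge0 ?invr_gt0// subr_ge0.
Qed.

Lemma sum_cauchy_schwarz (R : realType) (I : finType) (a b : I -> R) :
  (\sum_i a i * b i) ^+ 2 <= (\sum_i a i ^+ 2) * (\sum_i b i ^+ 2).
Proof.
apply: discriminant_le0 => t.
rewrite -mulrA !mulr_sumr -!big_split /=; apply: sumr_ge0 => i _.
have -> : a i ^+ 2 + 2 * (t * (a i * b i)) + t ^+ 2 * b i ^+ 2
  = (a i + t * b i) ^+ 2 by ring.
exact: sqr_ge0.
Qed.

(** Young's inequality with integer powers only. The induction adds
    [(a ^+ k.+1 - b ^+ k.+1) * (a - b) >= 0] to a times the previous case. *)
Lemma young_pow (R : realType) (k : nat) (a b : R) : 0 <= a -> 0 <= b ->
  k.+1%:R * (a ^+ k * b) <= k%:R * a ^+ k.+1 + b ^+ k.+1.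
Proof.
move=> a0 b0; elim: k => [|k IH]; first by rewrite expr0 mul0r expr1 add0r mul1r mul1r.
have h : 0 <= (a ^+ k.+1 - b ^+ k.+1) * (a - b).
  have [ab|/ltW ab] := leP b a.
    by apply: mulr_ge0; rewrite subr_ge0// lerXn2r.
  by apply: mulr_le0; rewrite subr_le0// lerXn2r.
have {IH} := ler_wpM2l a0 IH; move: h.
rewrite -!(natr1 k.+1) -!(natr1 k) !exprS.
set u := a ^+ k; set v := b ^+ k; set c := k%:R.
rewrite -subr_ge0 => h1; rewrite -subr_ge0 => h2; rewrite -subr_ge0.
apply: le_trans (addr_ge0 h1 h2) _; rewrite le_eqVlt; apply/orP; left; apply/eqP; ring.
Qed.

(* Gaussian calculus on polynomials in independent standard normal variables
   x_i, with partial derivatives D_i, evaluation at an outcome, and expectation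
   E; the expectation enters only through positivity and integration by
   parts. *)
Record gaussian_algebra (R : realType) (n : nat) (Om : Type) := {
  ga_sort :> comAlgType R ;
  gvar : 'I_n -> ga_sort ;
  gder : 'I_n -> {linear ga_sort -> ga_sort} ;
  gev : Om -> {rmorphism ga_sort -> R} ;
  gexp : {linear ga_sort -> R^o} ;
  gevZ : forall w c q, gev w (c *: q) = c * gev w q ;
  gderM : forall i p q, gder i (p * q) = gder i p * q + p * gder i q ;
  gder_var : forall i j, gder i (gvar j) = (i == j)%:R ;
  gderC : forall i j q, gder i (gder j q) = gder j (gder i q) ;
  gexp1 : gexp 1 = 1 ;
  gexp_ge0 : forall q, (forall w, 0 <= gev w q) -> 0 <= gexp q ;
  gexp_ibp : forall i q, gexp (gvar i * q) = gexp (gder i q)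
}.

Section gaussian_calculus.
Context (R : realType) (n : nat) (Om : Type) (A : gaussian_algebra R n Om).
Implicit Types (p q u v : A) (i j : 'I_n).

Local Notation x := (@gvar _ _ _ A).
Local Notation D := (@gder _ _ _ A).
Local Notation E := (@gexp _ _ _ A).
Local Notation ev := (@gev _ _ _ A).

Lemma gexpE_le p q : (forall w, ev w p <= ev w q) -> E p <= E q.
Proof.
move=> h; rewrite -subr_ge0 -[_ - _](raddfB E); apply: gexp_ge0 => w.
by rewrite rmorphB subr_ge0.
Qed.

Lemma gexpZ c q : E (c *: q) = c * E q.
Proof. exact: linearZ. Qed.

Lemma gexpMn q k : E (q *+ k) = E q *+ k.
Proof. exact: raddfMn. Qed.

Lemma gexp_sum (J : finType) (F : J -> A) : E (\sum_i F i) = \sum_i E (F i).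
Proof. exact: raddf_sum. Qed.

Lemma gexp_natl k q : E (k%:R * q) = k%:R * E q.
Proof. by rewrite !mulr_natl gexpMn. Qed.

Lemma gder_nat i k : D i k%:R = 0.
Proof.
rewrite -scaler_nat linearZ /=.
have -> : D i 1 = 0; last by rewrite scaler0.
by apply: (addIr (D i 1)); rewrite add0r -{3}[1]mulr1 gderM mulr1 mul1r.
Qed.

Lemma gexp_sq q : 0 <= E (q ^+ 2).
Proof. by apply: gexp_ge0 => w; rewrite rmorphXn sqr_ge0. Qed.

Lemma gexp_cauchy_schwarz p q : E (p * q) ^+ 2 <= E (p ^+ 2) * E (q ^+ 2).
Proof.
apply: discriminant_le0 => t.
have -> : E (p ^+ 2) + 2 * t * E (p * q) + t ^+ 2 * E (q ^+ 2)
  = E ((p + t *: q) ^+ 2).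
  rewrite sqrrD exprZn -scalerAr 2!raddfD /= gexpMn !gexpZ.
  by ring.
exact: gexp_sq.
Qed.

Lemma gder1 i : D i 1 = 0.
Proof. exact: (gder_nat i 1). Qed.

Lemma gderX i q k : D i (q ^+ k) = k%:R * q ^+ k.-1 * D i q.
Proof.
elim: k => [|k IH]; first by rewrite expr0 gder1 !mul0r.
rewrite exprS gderM IH /=; case: k IH => [|k] _ /=.
  by rewrite expr0 mul0r mul0r mulr0 addr0 mulr1 !mul1r.
by rewrite [q ^+ k.+1]exprS -[k.+2]addn1 natrD; ring.
Qed.

(** The carre du champ and the number operator, that is, minus the Ornstein-Uhlenbeck generator;
    [gexp_num] links them. *)
Definition ggamma p q : A := \sum_i D i p * D i q.
Definition gnum q : A := \sum_i (x i * D i q - D i (D i q)).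

Lemma gexp_num p q : E (p * gnum q) = E (ggamma p q).
Proof.
rewrite /gnum /ggamma mulr_sumr !raddf_sum; apply: eq_bigr => i _.
rewrite mulrBr mulrCA raddfB /= gexp_ibp gderM raddfD /=.
by rewrite addrK.
Qed.

Lemma ggammaC p q : ggamma p q = ggamma q p.
Proof. by apply: eq_bigr => i _; rewrite mulrC. Qed.

Lemma gexp_gamma_ge0 q : 0 <= E (ggamma q q).
Proof.
rewrite /ggamma raddf_sum; apply: sumr_ge0 => i _.
by rewrite -expr2 gexp_sq.
Qed.

Lemma gexp_numC p q : E (p * gnum q) = E (gnum p * q).
Proof. by rewrite gexp_num ggammaC -gexp_num mulrC. Qed.

(** The commutator [D, N] = D: a derivative lowers an eigenvalue of N by one. *)
Lemma gder_num j q : D j (gnum q) = gnum (D j q) + D j q.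
Proof.
rewrite /gnum raddf_sum; under eq_bigr do
  rewrite raddfB /= gderM gder_var (gderC j) (gderC j _ (D _ q)) (gderC j) addrAC.
under eq_bigr do rewrite -addrA addrC.
rewrite big_split /= [X in _ + X](bigD1 j) //= eqxx mul1r.
rewrite [X in _ + (_ + X)]big1 ?addr0; last first.
  by move=> i ij; rewrite eq_sym (negbTE ij) mul0r.
by congr (_ + _); apply: eq_bigr => i _; rewrite addrC.
Qed.

Lemma gnum_linear : linear gnum.
Proof.
move=> c p q; rewrite /gnum scaler_sumr -big_split; apply: eq_bigr => i _ /=.
rewrite !linearP mulrDr scalerBr scalerAr.
by rewrite /= scalerN addrACA.
Qed.
HB.instance Definition _ := GRing.isLinear.Build R A A _ gnum gnum_linear.

(** The abstract algebra has no monomials, so the degree is the number of derivatives needed to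
    reach constants. Inductions below follow this clause. *)
Fixpoint degree_le (m : nat) q : Prop :=
  if m is k.+1 then forall i, degree_le k (D i q) else forall i, D i q = 0.

Lemma degree_le0 m : degree_le m 0.
Proof. by elim: m => [|m IH] i /=; rewrite linear0. Qed.

Lemma degree_leP m c p q : degree_le m p -> degree_le m q -> degree_le m (c *: p + q).
Proof.
elim: m p q => [|m IH] p q hp hq i; rewrite linearP.
  by rewrite hp hq scaler0 addr0.
exact: IH.
Qed.

Lemma degree_leW m k q : (m <= k)%N -> degree_le m q -> degree_le k q.
Proof.
elim: k m q => [|k IH] [|m] q //= mk hq i.
- by rewrite hq; exact: degree_le0.
- by apply: (IH m) => //; exact: hq.
Qed.

Lemma degree_leD m p q : degree_le m p -> degree_le m q -> degree_le m (p + q).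
Proof. by move=> hp hq; rewrite -[p]scale1r; exact: degree_leP. Qed.

Lemma degree_leM a b p q : degree_le a p -> degree_le b q -> degree_le (a + b) (p * q).
Proof.
move: p q; have [m] := ubnP (a + b); elim: m a b => // m IH a b abm p q hp hq.
case: a b abm hp hq => [|a] [|b] abm hp hq; rewrite ?addn0 ?addnS => i; rewrite gderM.
- by rewrite hp hq mul0r mulr0 addr0.
- by rewrite hp mul0r add0r; apply: (IH 0 b).
- by rewrite hq mulr0 addr0 -[a]addn0; apply: IH => //; rewrite ?addn0 in abm *.
- apply: (@degree_leD (a.+1 + b)); last by apply: IH => //; rewrite addnS in abm.
  by rewrite addSnnS; apply: IH => //; rewrite addSn in abm.
Qed.

(** Expresses N <= m in degree m. By the commutator and induction on the derivatives, E (N q)^2 <= m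
    E Gamma(q, q); Cauchy-Schwarz applied to E q N q = E Gamma(q, q) does the rest. *)
Lemma reverse_poincare m q : degree_le m q -> E (ggamma q q) <= m%:R * E (q ^+ 2).
Proof.
elim: m q => [|m IH] q hq.
  by rewrite /ggamma big1 ?mul0r ?linear0// => i _; rewrite hq mul0r.
have h1 : E (gnum q ^+ 2) <= m.+1%:R * E (ggamma q q).
  rewrite expr2 gexp_num /ggamma raddf_sum mulrS mulrDl mul1r.
  under eq_bigr do rewrite gder_num mulrDl raddfD /=.
  rewrite raddf_sum big_split /= addrC lerD2l mulr_sumr.
  apply: ler_sum => i _; rewrite mulrC gexp_num -expr2.
  exact/IH/hq.
have h2 := gexp_cauchy_schwarz q (gnum q); rewrite gexp_num in h2.
have h3 := gexp_sq q; have := gexp_gamma_ge0 q; rewrite le_eqVlt => /predU1P[<-|h4].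
  by rewrite mulr_ge0.
rewrite -(ler_pM2r h4) -expr2; apply: (le_trans h2).
by rewrite mulrAC mulrC ler_wpM2r.
Qed.

(** The k-th Wiener chaos. The eigenvalue equation alone would not bound the degree, as [gexp] is
    not assumed definite; the descent to genuine constants does. *)
Fixpoint chaotic (k : nat) q : Prop :=
  if k is l.+1 then gnum q = k%:R * q /\ forall i, chaotic l (D i q)
  else exists c, q = c%:A.

Lemma chaotic_num k q : chaotic k q -> gnum q = k%:R * q.
Proof.
case: k => [[c ->]|k []//]; rewrite mul0r /gnum big1// => i _.
by rewrite linearZ /= gder1 scaler0 mulr0 linear0 subr0.
Qed.

Lemma chaotic_degree k q : chaotic k q -> degree_le k q.
Proof.
elim: k q => [|k IH] q; first by move=> [c ->] i; rewrite linearZ /= gder1 scaler0.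
by move=> [_ h] i; apply: IH; exact: h.
Qed.

Lemma chaotic0 k : chaotic k 0.
Proof.
elim: k => [|k IH]; first by exists 0; rewrite scale0r.
by split=> [|i]; rewrite ?linear0 ?mulr0.
Qed.

Lemma chaoticP k c p q : chaotic k p -> chaotic k q -> chaotic k (c *: p + q).
Proof.
elim: k p q => [|k IH] p q.
  by move=> [a ->] [b ->]; exists (c * a + b); rewrite scalerDl scalerA.
move=> [hp hp'] [hq hq']; split=> [|i]; last by rewrite linearP; apply: IH; [exact: hp'|exact: hq'].
by rewrite linearP /= hp hq mulrDr scalerAr.
Qed.

Lemma chaotic_sum k (I : Type) (s : seq I) (c : I -> R) (F : I -> A) :
  (forall a, chaotic k (F a)) -> chaotic k (\sum_(a <- s) c a *: F a).
Proof.
move=> h; elim: s => [|a s IH]; rewrite ?big_nil ?big_cons; first exact: chaotic0.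
exact: chaoticP.
Qed.

Definition linear_form (a : 'I_n -> R) : A := \sum_i a i *: x i.

Lemma gder_linear_form i a : D i (linear_form a) = (a i)%:A.
Proof.
rewrite /linear_form raddf_sum (bigD1 i) //= linearZ /= gder_var eqxx big1 ?addr0//.
by move=> j ji; rewrite linearZ /= gder_var eq_sym (negbTE ji) scaler0.
Qed.

Definition gdir (a : 'I_n -> R) q : A := \sum_i a i *: D i q.

Lemma gdir_linear a : linear (gdir a).
Proof.
move=> c p q; rewrite /gdir scaler_sumr -big_split; apply: eq_bigr => i _ /=.
by rewrite linearP scalerDr !scalerA mulrC.
Qed.
HB.instance Definition _ a := GRing.isLinear.Build R A A _ (gdir a) (gdir_linear a).

Lemma gdirM a p q : gdir a (p * q) = gdir a p * q + p * gdir a q.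
Proof.
rewrite /gdir mulr_suml mulr_sumr -big_split; apply: eq_bigr => i _ /=.
by rewrite gderM scalerDr scalerAl scalerAr.
Qed.

Lemma gdirX a q k : gdir a (q ^+ k) = k%:R * q ^+ k.-1 * gdir a q.
Proof.
rewrite /gdir mulr_sumr; apply: eq_bigr => i _.
by rewrite gderX scalerAr.
Qed.

Lemma gexp_linear_form a q : E (linear_form a * q) = E (gdir a q).
Proof.
rewrite /linear_form /gdir mulr_suml !raddf_sum; apply: eq_bigr => i _ /=.
by rewrite -scalerAl !linearZ /= gexp_ibp.
Qed.

Lemma gdir_linear_form a b : gdir a (linear_form b) = (\sum_i a i * b i)%:A.
Proof.
rewrite /gdir scaler_suml; apply: eq_bigr => i _.
by rewrite gder_linear_form scalerA.
Qed.

Lemma chaotic_gder k q i : chaotic k.+1 q -> chaotic k (D i q).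
Proof. by move=> [_ h]; exact: h. Qed.

Lemma chaotic_gdir k q a : chaotic k.+1 q -> chaotic k (gdir a q).
Proof. by move=> h; apply: chaotic_sum => i; exact: chaotic_gder. Qed.

(** N is symmetric for E, and the eigenvalues differ. *)
Lemma chaotic_orthogonal k l p q : k != l -> chaotic k p -> chaotic l q -> E (p * q) = 0.
Proof.
move=> kl /chaotic_num hp /chaotic_num hq; have := gexp_numC p q.
rewrite hp hq mulrCA -mulrA !gexp_natl => /eqP.
rewrite -subr_eq0 -mulrBl mulf_eq0 subr_eq0 eqr_nat eq_sym (negbTE kl) /=.
by move/eqP.
Qed.

(* Cauchy-Schwarz for the form B q r := E (q (2p - N) r), which reverse_poincare
   makes nonnegative in degree at most 2p, applied to F^2 - E F^2 and h^2 - 1. *)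
Lemma gdir_sq_chaotic (p : nat) (F : A) (a : 'I_n -> R) : (1 < p)%N -> chaotic p F -> \sum_i a i ^+ 2 = 1 ->
  E (gdir a F ^+ 2) ^+ 2 <= p%:R * (E (F ^+ 4) - 3 * E (F ^+ 2) ^+ 2).
Proof.
move=> p1 hF a1; pose s := E (F ^+ 2); pose h := linear_form a.
have [k pk] : exists k, p = k.+2 by exists p.-2; rewrite -subn2 subn2; case: p p1 {hF} => [|[]].
pose u : A := F ^+ 2 - s%:A; pose v : A := h ^+ 2 - 1.
have Dh : gdir a h = 1.
  rewrite gdir_linear_form; under eq_bigr do rewrite -expr2.
  by rewrite a1 scale1r.
have Eh1 : E (h ^+ 2) = 1 by rewrite expr2 gexp_linear_form Dh gexp1.
(* Testing against h^2 - 1 amounts to differentiating twice along a; this is how the directional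
   derivative enters. *)
have Eh q : E (h ^+ 2 * q) = E q + E (gdir a (gdir a q)).
  by rewrite expr2 -mulrA gexp_linear_form gdirM Dh mul1r raddfD /= gexp_linear_form.
have Ev : E v = 0 by rewrite raddfB /= Eh1 gexp1 subrr.
have hv : degree_le 2 v.
  have hh : degree_le 1 h by move=> i j; rewrite gder_linear_form linearZ /= gder1 scaler0.
  rewrite /v addrC -scaleN1r; apply: degree_leP.
    by apply: (@degree_leW 0) => // i; rewrite gder1.
  exact: (degree_leM hh hh).
have Nv : gnum v = 2 * v.
  rewrite raddfB /= (_ : gnum 1 = 0) ?subr0; last first.
    by rewrite /gnum big1// => i _; rewrite gder1 mulr0 linear0 subrr.
  have Dh2 i : D i (h ^+ 2) = (2 * a i) *: h.
    by rewrite gderX gder_linear_form expr1 -scalerAr mulr1 -scalerA scaler_nat mulr_natl scalerMnr.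
  have -> : gnum (h ^+ 2) = \sum_i ((2 * (a i *: x i)) * h - (2 * a i ^+ 2)%:A).
    apply: eq_bigr => i _; rewrite Dh2 linearZ /= gder_linear_form scalerA -[2 * a i * a i]mulrA -expr2.
    by congr (_ - _); rewrite -scalerAr [2 * (a i *: x i)]mulr_natl -[(a i *: x i) *+ 2]scaler_nat scalerA -scalerAl.
  rewrite sumrB -mulr_suml -mulr_sumr -/(linear_form a) -scaler_suml -mulr_sumr a1 mulr1.
  by rewrite scaler_nat /v mulrBr mulr1 -mulrA expr2.
pose B q r : R := 2 * p%:R * E (q * r) - E (q * gnum r).
have BC q r : B q r = B r q.
  by rewrite /B mulrC (mulrC q) (gexp_numC q r) (mulrC (gnum q)) mulrC.
have BP t q r r' : B q (t *: r + r') = t * B q r + B q r'.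
  have E2 (y z : A) : E (q * (t *: y + z)) = t * E (q * y) + E (q * z).
    by rewrite mulrDr -scalerAr raddfD /= gexpZ.
  by rewrite /B linearP !E2; ring.
have Bcs q r : degree_le (p + p) q -> degree_le (p + p) r -> B q r ^+ 2 <= B q q * B r r.
  move=> hq hr; apply: discriminant_le0 => t.
  have -> : B q q + 2 * t * B q r + t ^+ 2 * B r r = B (t *: r + q) (t *: r + q).
    by rewrite BP (BC (t *: r + q) r) (BC (t *: r + q) q) !BP (BC r q); ring.
  have hd : degree_le (p + p) (t *: r + q) by exact: degree_leP.
  rewrite /B gexp_num -expr2 subr_ge0 mulr2n mulrDl mul1r -natrD.
  exact: (reverse_poincare hd).
have hF2 : degree_le (p + p) (F ^+ 2).
  by apply: degree_leM; exact: chaotic_degree.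
have hu : degree_le (p + p) u.
  rewrite /u addrC -scaleNr; apply: degree_leP => //.
  by apply: (@degree_leW 0) => // i; rewrite gder1.
have hv' : degree_le (p + p) v by apply: (@degree_leW 2) hv; rewrite pk addnS addSn.
have hFnum := chaotic_num hF.
(* Integration by parts in E F^3 N F, with N F = p F. *)
have EG : p%:R * E (F ^+ 4) = 3 * E (F ^+ 2 * ggamma F F).
  have -> : p%:R * E (F ^+ 4) = E (F ^+ 3 * gnum F).
    by rewrite hFnum mulrCA -exprSr gexp_natl.
  rewrite gexp_num (_ : ggamma _ _ = 3 * (F ^+ 2 * ggamma F F)) ?gexp_natl//.
  rewrite /ggamma !mulr_sumr; apply: eq_bigr => i _.
  by rewrite gderX /= -!mulrA.
have EGu : E (ggamma u u) = 4 * E (F ^+ 2 * ggamma F F).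
  rewrite (_ : ggamma _ _ = 4 * (F ^+ 2 * ggamma F F)) ?gexp_natl//.
  rewrite /ggamma !mulr_sumr; apply: eq_bigr => i _.
  rewrite /u raddfB /= linearZ /= gder1 scaler0 subr0 gderX /=; ring.
have Eu2 : E (u ^+ 2) = E (F ^+ 4) - s ^+ 2.
  rewrite /u sqrrB -exprM exprZn expr1n -scalerAr mulr1 raddfD raddfB /=.
  by rewrite gexpMn !gexpZ gexp1 -/s; ring.
(* E of the second derivative of F^2 is 2 E (D F)^2 + 2 E F D D F. The last term vanishes, since D D
   F lies in the chaos p - 2. *)
have Euv : E (u * v) = 2 * E (gdir a F ^+ 2).
  rewrite /u mulrBl -scalerAl mul1r raddfB /= gexpZ Ev mulr0 subr0 /v mulrBr mulr1.
  rewrite mulrC raddfB /= Eh addrC addKr.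
  rewrite gdirX /= expr1 gdirM gdirM.
  rewrite (_ : gdir a 2%:R = 0) ?mul0r ?add0r; last first.
    by rewrite /gdir big1// => i _; rewrite gder_nat scaler0.
  rewrite raddfD /= -!mulrA -expr2 !gexp_natl.
  rewrite (@chaotic_orthogonal p k F) ?mulr0 ?addr0 //.
    by rewrite pk eq_sym ltn_eqF.
  by apply: chaotic_gdir; apply: chaotic_gdir; rewrite -pk.
have Ev2 : E (v ^+ 2) = 2.
  have -> : v ^+ 2 = h ^+ 2 * (h ^+ 2) - h ^+ 2 - v by rewrite /v; ring.
  rewrite 2!raddfB /= Ev Eh Eh1 subr0 gdirX /= expr1 Dh mulr1 mulr_natl raddfMn /= Dh gexpMn gexp1.
  by ring.
(* The fourth cumulant: 2p (E F^4 - s^2) minus (4p / 3) E F^4. *)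
have B1 : B u u = 2 * p%:R / 3 * (E (F ^+ 4) - 3 * s ^+ 2).
  rewrite /B gexp_num EGu -expr2 Eu2.
  have -> : E (F ^+ 2 * ggamma F F) = p%:R * E (F ^+ 4) / 3 by rewrite EG; field.
  by field.
have B2 : B u v = (2 * p%:R - 2) * (2 * E (gdir a F ^+ 2)).
  by rewrite /B Nv mulrCA gexp_natl Euv; ring.
have B3 : B v v = (2 * p%:R - 2) * 2.
  by rewrite /B Nv mulrCA -expr2 gexp_natl Ev2; ring.
have := Bcs _ _ hu hv'; rewrite B1 B2 B3 -/s.
have p2 : 2 <= p%:R :> R by rewrite ler_nat.
set Q := E (gdir a F ^+ 2); set K := _ - _ * s ^+ 2; set P := p%:R.
have -> : ((2 * P - 2) * (2 * Q)) ^+ 2 = (2 * P - 2) * (8 * ((P - 1) * Q ^+ 2)) by ring.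
have -> : 2 * P / 3 * K * ((2 * P - 2) * 2) = (2 * P - 2) * (4 / 3 * (P * K)) by field.
(* Division by 2p - 2 leaves 6 (p - 1) Q^2 <= p K, and 6 (p - 1) >= 1. *)
rewrite ler_pM2l; last by rewrite /P; lra.
have := sqr_ge0 Q; rewrite -/P in p2; nra.
Qed.

(* Differentiation turns one element of the chaos q.+1 into a family of elements
   of the chaos q, so the induction on q has to be run on families. *)
Lemma hypercontractivity_family (k q : nat) (I : finType) (v : I -> A) :
  (forall a, chaotic q (v a)) ->
  E ((\sum_a v a ^+ 2) ^+ k.+1) <= (2 * k%:R + 1) ^+ (q * k.+1) * E (\sum_a v a ^+ 2) ^+ k.+1.
Proof.
elim: q I v => [|q IH] I v hv.
  have [c hc] : exists c, \sum_a v a ^+ 2 = c%:A.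
    have /choice[c hc] := hv; exists (\sum_a c a ^+ 2); rewrite scaler_suml.
    by apply: eq_bigr => a _; rewrite hc exprZn expr1n.
  rewrite hc mul0n expr0 mul1r exprZn expr1n !gexpZ gexp1 !mulr1.
  exact: lexx.
pose S : A := \sum_a v a ^+ 2.
pose v' (ai : I * 'I_n) : A := D ai.2 (v ai.1).
pose S' : A := \sum_ai v' ai ^+ 2.
have S'E : S' = \sum_a ggamma (v a) (v a).
  by rewrite /ggamma pair_bigA /=; apply: eq_bigr => -[a i] _; rewrite expr2.
pose w i : A := \sum_a v a * D i (v a).
have DS i : D i S = 2 * w i.
  rewrite raddf_sum mulr_sumr; apply: eq_bigr => a _.
  by rewrite /= gderX expr1 mulrA.
have ES : q.+1%:R * E S = E S'.
  rewrite S'E !gexp_sum mulr_sumr; apply: eq_bigr => a _.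
  by rewrite -gexp_num (chaotic_num (hv a)) mulrCA gexp_natl expr2.
(* Each factor (q + 1) v_a is N v_a. Integration by parts differentiates either the remaining v_a,
   which gives S', or S^k, which gives the squares of w. *)
have ESk : q.+1%:R * E (S ^+ k.+1) =
    E (S ^+ k * S') + 2 * k%:R * E (S ^+ k.-1 * \sum_i w i ^+ 2).
  have -> : q.+1%:R * E (S ^+ k.+1) = \sum_a E (v a * S ^+ k * gnum (v a)).
    rewrite -gexp_sum -gexp_natl; congr (E _).
    rewrite exprS mulr_suml mulr_sumr; apply: eq_bigr => a _.
    by rewrite (chaotic_num (hv a)); ring.
  under eq_bigr do rewrite gexp_num.
  rewrite -gexp_sum -natrM -gexp_natl -raddfD /=; congr (E _).
  rewrite S'E mulr_sumr [X in _ = _ + X]mulrA mulr_sumr.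
  have -> : \sum_a ggamma (v a * S ^+ k) (v a) =
     \sum_a S ^+ k * ggamma (v a) (v a) +
     \sum_a \sum_i (v a * D i (S ^+ k)) * D i (v a).
    rewrite -big_split; apply: eq_bigr => a _ /=.
    rewrite /ggamma mulr_sumr -big_split; apply: eq_bigr => i _ /=.
    by rewrite gderM mulrDl; rewrite -mulrA mulrCA.
  congr (_ + _); rewrite exchange_big; apply: eq_bigr => i _ /=.
  rewrite gderX DS natrM.
  transitivity (k%:R * S ^+ k.-1 * (2 * w i) * w i); last by ring.
  by rewrite {3}/w mulr_sumr; apply: eq_bigr => a _; rewrite /w; ring.
have hw o i : ev o (w i) ^+ 2 <= ev o S * ev o (\sum_a D i (v a) ^+ 2).
  rewrite !rmorph_sum /=; under eq_bigr do rewrite rmorphM.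
  under [in leRHS]eq_bigr do rewrite rmorphXn.
  under [X in _ <= _ * X]eq_bigr do rewrite rmorphXn.
  exact: sum_cauchy_schwarz.
have S0 o : 0 <= ev o S.
  by rewrite rmorph_sum sumr_ge0// => a _; rewrite rmorphXn sqr_ge0.
have S'0 o : 0 <= ev o S'.
  by rewrite rmorph_sum sumr_ge0// => a _; rewrite rmorphXn sqr_ge0.
(* Cauchy-Schwarz over the family gives w_i^2 <= S times the sum of (D_i v_a)^2, hence S S' after
   summing over i. For k = 0 the factor k makes the default [k.-1] harmless. *)
have hC : k%:R * E (S ^+ k.-1 * \sum_i w i ^+ 2) <= k%:R * E (S ^+ k * S').
  case: k {IH ESk} => [|k] //=; first by rewrite !mul0r.
  rewrite ler_wpM2l//; apply: gexpE_le => o.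
  rewrite !rmorphM /= exprSr rmorphM -mulrA /= ler_wpM2l//.
    by rewrite rmorphXn exprn_ge0.
  have -> : S' = \sum_i \sum_a D i (v a) ^+ 2.
    rewrite S'E exchange_big; apply: eq_bigr => i _ /=.
    by apply: eq_bigr => a _; rewrite expr2.
  rewrite [ev o (\sum_i \sum_a _)]rmorph_sum mulr_sumr [leLHS]rmorph_sum.
  by apply: ler_sum => i _; rewrite /= rmorphXn; exact: hw.
pose K : R := 2 * k%:R + 1.
have K0 : 0 < K by rewrite /K; have := ler0n R k; lra.
(* With this scale Young's inequality produces k E S^(k+1), which the left side absorbs. The power
   of q + 1 in the denominator cancels against E S' = (q + 1) E S when the induction hypothesis is
   applied to the derivatives. *)
pose r : R := K / q.+1%:R.
have r0 : 0 < r by rewrite divr_gt0.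
have step : E (S ^+ k.+1) <= r ^+ k.+1 * E (S' ^+ k.+1).
  have h1 : q.+1%:R * E (S ^+ k.+1) <= K * E (S ^+ k * S').
    by rewrite ESk /K; move: hC; set a := E _; set b := E _; lra.
  have h2 : k.+1%:R * (r * E (S ^+ k * S')) <= k%:R * E (S ^+ k.+1) + r ^+ k.+1 * E (S' ^+ k.+1).
    rewrite -!gexpZ -raddfD; apply: gexpE_le => o.
    rewrite rmorphD !gevZ !rmorphM !rmorphXn /=.
    have := young_pow k (S0 o) (mulr_ge0 (ltW r0) (S'0 o)).
    by rewrite exprMn; set a := ev o S ^+ k; rewrite (mulrCA a).
  have h3 : E (S ^+ k.+1) <= r * E (S ^+ k * S').
    by rewrite /r mulrAC ler_pdivlMr// mulrC.
  move: h2 h3; rewrite -natr1; set a := E _; set b := r * E _; set c := r ^+ _ * _.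
  have := ler0n R k; set t := k%:R; nra.
apply: le_trans step _.
have := IH _ v' (fun ai => @chaotic_gder _ _ ai.2 (hv ai.1)).
rewrite -/S' -ES -/K -/S => hI.
apply: le_trans (ler_wpM2l _ hI) _; first by rewrite exprn_ge0// ltW.
rewrite mulSn exprD /r expr_div_n exprMn.
rewrite le_eqVlt; apply/orP; left; apply/eqP.
have : q.+1%:R ^+ k.+1 != 0 :> R by rewrite expf_neq0.
by set c := _ ^+ k.+1; set e := _ ^+ (q * _); set g := K ^+ _; set t := E S ^+ _; move=> c0; field.
Qed.

Lemma hypercontractivity (k q : nat) (F : A) : chaotic q F ->
  E (F ^+ (2 * k.+1)) <= (2 * k%:R + 1) ^+ (q * k.+1) * E (F ^+ 2) ^+ k.+1.
Proof.
move=> hF; have := @hypercontractivity_family k q 'I_1 (fun=> F) (fun=> hF).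
by rewrite !big_ord1 -exprM.
Qed.
End gaussian_calculus.

(** * Expectations *)

Section expectation.
Context (R : realType) (d : measure_display) (T : measurableType d).
Variable P : probability T R.
Implicit Types (f g : T -> R) (c : R).

Definition intg f := P.-integrable [set: T] (EFin \o f).
Definition Ex f : R := \int[P]_x f x.

Lemma intg_measurable f : intg f -> measurable_fun setT f.
Proof. by move=> /(measurable_int P)/measurable_EFinP. Qed.

Lemma intg_EFin f : intg f -> (\int[P]_x (f x)%:E = (Ex f)%:E)%E.
Proof. by move=> h; rewrite /Ex /Rintegral fineK//; exact: integrable_fin_num. Qed.

Lemma expectationE f : ('E_P[f] = \int[P]_x (f x)%:E)%E.
Proof. by rewrite unlock. Qed.

Lemma expectation_Ex f : intg f -> ('E_P[f] = (Ex f)%:E)%E.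
Proof. by rewrite expectationE; exact: intg_EFin. Qed.

Lemma intg_cst c : intg (fun=> c).
Proof. exact: finite_measure_integrable_cst. Qed.

Lemma intgD f g : intg f -> intg g -> intg (fun x => f x + g x).
Proof. by move=> hf hg; have := integrableD measurableT hf hg. Qed.

Lemma intgZ c f : intg f -> intg (fun x => c * f x).
Proof. by move=> hf; have := integrableZl measurableT c hf. Qed.

Lemma intgB f g : intg f -> intg g -> intg (fun x => f x - g x).
Proof. by move=> hf hg; have := integrableB measurableT hf hg. Qed.

Lemma intg_sum (I : Type) (s : seq I) (F : I -> T -> R) :
  (forall i, intg (F i)) -> intg (fun x => \sum_(i <- s) F i x).
Proof.
move=> h; elim: s => [|i s IH].
  by under eq_fun do rewrite big_nil; exact: intg_cst.
by under eq_fun do rewrite big_cons; exact: intgD.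
Qed.

Lemma le_intg g f : measurable_fun setT f -> intg g ->
  (forall x, `|f x| <= `|g x|) -> intg f.
Proof.
move=> mf hg h; apply: le_integrable hg => //; first exact/measurable_EFinP.
by move=> x _ /=; rewrite lee_fin.
Qed.

Lemma intg_norm f : intg f -> intg (fun x => `|f x|).
Proof.
move=> hf; apply: (le_intg _ hf); last by move=> x; rewrite normr_id.
by apply: measurableT_comp => //; exact: intg_measurable.
Qed.

Lemma intg_bounded f c : measurable_fun setT f -> (forall x, `|f x| <= c) -> intg f.
Proof.
move=> mf h; apply: (le_intg mf (intg_cst c)) => x.
exact: le_trans (h x) (ler_norm _).
Qed.

Lemma Ex_cst c : Ex (fun=> c) = c.
Proof. by rewrite /Ex Rintegral_cst//= probability_setT mulr1. Qed.

Lemma ExD f g : intg f -> intg g -> Ex (fun x => f x + g x) = Ex f + Ex g.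
Proof. exact: RintegralD. Qed.

Lemma ExB f g : intg f -> intg g -> Ex (fun x => f x - g x) = Ex f - Ex g.
Proof. exact: RintegralB. Qed.

Lemma ExZ c f : intg f -> Ex (fun x => c * f x) = c * Ex f.
Proof. exact: RintegralZl. Qed.

Lemma Ex_sum (I : Type) (s : seq I) (F : I -> T -> R) :
  (forall i, intg (F i)) -> Ex (fun x => \sum_(i <- s) F i x) = \sum_(i <- s) Ex (F i).
Proof.
move=> h; elim: s => [|i s IH].
  by rewrite big_nil; under eq_fun do rewrite big_nil; exact: Ex_cst.
rewrite big_cons -IH -ExD//; last exact: intg_sum.
by congr Ex; apply/funext => x; rewrite big_cons.
Qed.

Lemma Ex_ge0 f : (forall x, 0 <= f x) -> 0 <= Ex f.
Proof. by move=> h; exact: Rintegral_ge0. Qed.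

Lemma Ex_le f g : intg f -> intg g -> (forall x, f x <= g x) -> Ex f <= Ex g.
Proof. by move=> hf hg h; exact: le_Rintegral. Qed.

Lemma Ex_norm f : intg f -> `|Ex f| <= Ex (fun x => `|f x|).
Proof. exact: le_normr_Rintegral. Qed.

Lemma Ex_ae f g : measurable_fun setT f -> measurable_fun setT g ->
  f = g %[ae P] -> Ex f = Ex g.
Proof.
move=> mf mg fg; rewrite /Ex /Rintegral; congr fine.
apply: ae_eq_integral => //; [exact/measurable_EFinP|exact/measurable_EFinP|].
by apply: filterS fg => x h /h /= ->.
Qed.

Definition L2 f := measurable_fun setT f /\ intg (fun x => f x ^+ 2).

Lemma L2_prod f g : L2 f -> L2 g -> intg (fun x => f x * g x).
Proof.
move=> [mf hf] [mg hg]; apply: (@le_intg (fun x => f x ^+ 2 + g x ^+ 2)).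
- exact: measurable_funM.
- exact: intgD.
- move=> x; rewrite normrM [leRHS]ger0_norm ?addr_ge0 ?sqr_ge0// -(real_normK (num_real (f x))) -(real_normK (num_real (g x))).
  by have := sqr_ge0 (`|f x| - `|g x|); have := sqr_ge0 (`|f x| + `|g x|); nra.
Qed.

Lemma L2_cst c : L2 (fun=> c).
Proof. by split; [exact: measurable_cst|exact: intg_cst]. Qed.

Lemma L2_intg f : L2 f -> intg f.
Proof.
move=> hf; have := L2_prod hf (L2_cst 1).
by under eq_fun do rewrite mulr1.
Qed.

Lemma L2D f g : L2 f -> L2 g -> L2 (fun x => f x + g x).
Proof.
move=> hf hg; have hfg := L2_prod hf hg; case: hf hg => [mf hf] [mg hg].
split; first exact: measurable_funD.
under eq_fun do rewrite sqrrD -mulr_natl; apply: intgD => //; apply: intgD => //.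
exact: intgZ.
Qed.

Lemma L2Z c f : L2 f -> L2 (fun x => c * f x).
Proof.
move=> [mf hf]; split; first by apply: measurable_funM => //; exact: measurable_cst.
by under eq_fun do rewrite exprMn; exact: intgZ.
Qed.

Lemma L2B f g : L2 f -> L2 g -> L2 (fun x => f x - g x).
Proof.
move=> hf hg; have := L2D hf (L2Z (-1) hg).
by under eq_fun do rewrite mulN1r.
Qed.

Lemma le_L2 g f : measurable_fun setT f -> L2 g -> (forall x, `|f x| <= `|g x|) -> L2 f.
Proof.
move=> mf [mg hg] h; split=> //; apply: (le_intg _ hg).
  exact: measurable_funX.
by move=> x; rewrite !normrX lerXn2r ?nnegrE// normr_ge0.
Qed.

Lemma L2_bounded f c : measurable_fun setT f -> (forall x, `|f x| <= c) -> L2 f.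
Proof.
move=> mf h; apply: (le_L2 mf (L2_cst c)) => x.
exact: le_trans (h x) (ler_norm _).
Qed.

Lemma Ex_cauchy_schwarz f g : L2 f -> L2 g ->
  Ex (fun x => f x * g x) ^+ 2 <= Ex (fun x => f x ^+ 2) * Ex (fun x => g x ^+ 2).
Proof.
move=> hf hg; apply: discriminant_le0 => t.
have hfg := L2_prod hf hg; case: hf hg => [mf hf] [mg hg].
rewrite -mulrA (mulrCA 2) -!ExZ -?ExD//; do ?[exact: intgZ|apply: intgD]; try exact: intgZ.
- apply: Ex_ge0 => x.
  have -> : f x ^+ 2 + t * (2 * (f x * g x)) + t ^+ 2 * g x ^+ 2 = (f x + t * g x) ^+ 2 by ring.
  exact: sqr_ge0.
all: by [exact: hf|apply: intgZ; exact: intgZ].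
Qed.

(** All moments are finite. Unlike L2 this class is stable under products, so every polynomial
    expression in the process has an expectation. *)
Definition tame f := measurable_fun setT f /\ forall k, intg (fun x => f x ^+ k).

Lemma tame_intg f : tame f -> intg f.
Proof. by move=> [_ /(_ 1)]; under eq_fun do rewrite expr1. Qed.

Lemma tame_L2 f : tame f -> L2 f.
Proof. by move=> [mf h]; split. Qed.

Lemma tame_cst c : tame (fun=> c).
Proof. by split=> [|k]; [exact: measurable_cst|exact: intg_cst]. Qed.

Lemma tameX f k : tame f -> tame (fun x => f x ^+ k).
Proof.
move=> [mf h]; split=> [|l]; first exact: measurable_funX.
by under eq_fun do rewrite -exprM.
Qed.

Lemma tameM f g : tame f -> tame g -> tame (fun x => f x * g x).
Proof.
move=> hf hg; split; first by apply: measurable_funM; [case: hf|case: hg].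
move=> k; under eq_fun do rewrite exprMn.
by apply: L2_prod; apply: tame_L2; exact: tameX.
Qed.

Lemma tameZ c f : tame f -> tame (fun x => c * f x).
Proof. by move=> hf; exact: tameM (tame_cst c) hf. Qed.

Lemma tameD f g : tame f -> tame g -> tame (fun x => f x + g x).
Proof.
move=> hf hg; split; first by apply: measurable_funD; [case: hf|case: hg].
move=> k; under eq_fun do rewrite exprDn; apply: intg_sum => i.
under eq_fun do rewrite -mulr_natl; apply: intgZ.
by apply: tame_intg; apply: tameM; exact: tameX.
Qed.

Lemma tame_sum (I : Type) (s : seq I) (F : I -> T -> R) :
  (forall i, tame (F i)) -> tame (fun x => \sum_(i <- s) F i x).
Proof.
move=> h; elim: s => [|i s IH].
  by under eq_fun do rewrite big_nil; exact: tame_cst.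
by under eq_fun do rewrite big_cons; exact: tameD.
Qed.

Lemma tame_prod (I : Type) (s : seq I) (F : I -> T -> R) :
  (forall i, tame (F i)) -> tame (fun x => \prod_(i <- s) F i x).
Proof.
move=> h; elim: s => [|i s IH].
  by under eq_fun do rewrite big_nil; exact: tame_cst.
by under eq_fun do rewrite big_cons; exact: tameM.
Qed.

Lemma tame_horner (q : {poly R}) f : tame f -> tame (fun x => q.[f x]).
Proof.
move=> hf; under eq_fun do rewrite horner_coef.
by apply: tame_sum => i; apply: tameZ; exact: tameX.
Qed.
End expectation.

(** The fundamental theorem of calculus on growing symmetric intervals, then dominated convergence
    with majorant |f|. *)
Lemma integral_derivative_eq0 (R : realType) (f F : R -> R) :
  continuous f -> (@lebesgue_measure R).-integrable setT (EFin \o f) ->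
  (forall x : R, is_derive x 1 F (f x)) ->
  F n%:R @[n --> \oo] --> (0 : R) -> F (- n%:R) @[n --> \oo] --> (0 : R) ->
  (\int[@lebesgue_measure R]_x (f x)%:E = 0)%E.
Proof.
move=> cf intf dF F1 F2.
(* [n.+1] keeps the interval nondegenerate, as [continuous_FTC2] requires. *)
pose I n : set (measurableTypeR R) := `[- (n.+1%:R : R), n.+1%:R]%classic.
have mI n : measurable (I n) by exact: measurable_itv.
have mf : measurable_fun [set: measurableTypeR R] f by exact: continuous_measurable_fun.
pose g n : measurableTypeR R -> \bar R := (EFin \o f) \_ (I n).
have cF : continuous F by move=> x; apply: differentiable_continuous; apply/derivable1_diffP; have [] := dF x.
have hI n : (\int[@lebesgue_measure R]_x g n x = (F n.+1%:R - F (- n.+1%:R))%:E)%E.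
  rewrite -integral_mkcond (@continuous_FTC2 _ f F)//.
  - by rewrite -subr_gt0 opprK addr_gt0.
  - exact: continuous_subspaceT.
  - split.
    + by move=> x _; have [] := dF x.
    + by apply: cvg_at_right_filter; exact: cF.
    + by apply: cvg_at_left_filter; exact: cF.
  - by move=> x _; rewrite derive1E; have [_ ->] := dF x.
have mfE : measurable_fun [set: measurableTypeR R] (EFin \o f) by exact/measurable_EFinP.
have h : (\int[@lebesgue_measure R]_x g n x)%E @[n --> \oo] --> (\int[@lebesgue_measure R]_x (f x)%:E)%E.
  have [|||||//] := @dominated_convergence _ (measurableTypeR R) _ (@lebesgue_measure R) setT measurableT
     g (EFin \o f) (abse \o (EFin \o f)).
  - move=> n; have [hm _] := @measurable_restrictT _ _ (measurableTypeR R) _ (I n) (EFin \o f) (mI n).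
    apply: hm; exact: (@measurable_funS _ _ (measurableTypeR R) _ setT _ _ measurableT _ mfE).
  - exact: mfE.
  - apply: aeW => x _; apply: cvg_near_cst.
    near=> n; rewrite /g patchE mem_set// /I /= in_itv /= -ler_norml.
    apply: (@le_trans _ _ n%:R); last by rewrite ler_nat.
    by near: n; exact: nbhs_infty_ger.
  - by have := integrable_abse intf.
  - apply: aeW => x n _; rewrite /g patchE; case: ifP => //= _.
    by rewrite lee_fin normr0.
have h0 : (\int[@lebesgue_measure R]_x g n x)%E @[n --> \oo] --> (0%:E : \bar R).
  under eq_fun do rewrite hI.
  apply: cvg_EFin; first exact: nearW.
  rewrite -(subr0 0); apply: cvgB.
    by rewrite (cvg_shiftS (fun n => F n%:R)).
  by rewrite (cvg_shiftS (fun n => F (- n%:R))).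
exact: (cvg_unique _ h h0).
Unshelve. all: by end_near. Qed.

(** * The centered normal law *)

Section density.
Context (R : realType) (d : measure_display) (T : measurableType d).
Variables (nu : {finite_measure set T -> \bar R}).
Variables (mu : {sigma_finite_measure set T -> \bar R}) (h : T -> R).
Hypothesis h0 : forall x, 0 <= h x.
Hypothesis mh : measurable_fun setT h.
Hypothesis nuE : forall A, measurable A -> nu A = (\int[mu]_(x in A) (h x)%:E)%E.

Let dominates : nu `<< mu.
Proof.
apply/null_content_dominatesP => A mA muA0; rewrite nuE//.
by apply: null_set_integral => //; apply/measurable_funTS/measurable_EFinP.
Qed.

Let density_ae :
  ae_eq mu setT (Radon_Nikodym_SigmaFinite.f nu mu) (EFin \o h).
Proof.
apply: integral_ae_eq => //.
- exact: Radon_Nikodym_SigmaFinite.f_integrable.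
- exact/measurable_EFinP.
- move=> A _ mA; rewrite -Radon_Nikodym_SigmaFinite.f_integral//.
  exact: nuE.
Qed.

(** The nonnegative case comes first because, applied to |f|, it transfers the integrability that
    the signed case assumes. *)
Lemma ge0_integral_density (f : T -> R) : measurable_fun setT f ->
  (forall x, 0 <= f x) ->
  (\int[nu]_x (f x)%:E = \int[mu]_x (f x * h x)%:E)%E.
Proof.
move=> mf f0.
rewrite -(@Radon_Nikodym_SigmaFinite.change_of_variables _ _ _ _ mu)//; last first.
  exact/measurable_EFinP.
apply: ae_eq_integral => //.
- apply: emeasurable_funM; first exact/measurable_EFinP.
  by apply: measurable_int (Radon_Nikodym_SigmaFinite.f_integrable _).
- by apply/measurable_EFinP; exact: measurable_funM.
- apply: filterS density_ae => x hx xT.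
  by rewrite hx.
Qed.

Lemma integrable_density (f : T -> R) : measurable_fun setT f ->
  nu.-integrable setT (EFin \o f) <-> mu.-integrable setT (fun x => (f x * h x)%:E).
Proof.
move=> mf.
have E : (\int[nu]_x `|(f x)%:E| = \int[mu]_x `|(f x * h x)%:E|)%E.
  rewrite (@ge0_integral_density (fun x => `|f x|))//; last exact: measurableT_comp.
  by apply: eq_integral => x _; rewrite /= normrM (ger0_norm (h0 x)).
split=> /integrableP[_ hf]; apply/integrableP; split.
- by apply/measurable_EFinP; exact: measurable_funM.
- by rewrite -E.
- exact/measurable_EFinP.
- by rewrite E.
Qed.

Lemma integral_density (f : T -> R) : measurable_fun setT f ->
  nu.-integrable setT (EFin \o f) ->
  (\int[nu]_x (f x)%:E = \int[mu]_x (f x * h x)%:E)%E.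
Proof.
move=> mf hf.
rewrite -(@Radon_Nikodym_change_of_variables _ _ _ nu mu dominates)//.
apply: ae_eq_integral => //.
- apply: emeasurable_funM; first exact/measurable_EFinP.
  by apply: (measurable_int mu); exact: Radon_Nikodym_integrable.
- by apply/measurable_EFinP; exact: measurable_funM.
- have := @ae_eq_Radon_Nikodym_SigmaFinite _ _ _ nu mu dominates setT measurableT.
  by apply: filterS2 density_ae => x h1 h2 xT; rewrite -h2// h1.
Qed.
End density.

Lemma powX_le_expR (R : realType) (k : nat) (x : R) : 0 <= x -> x ^+ k <= k`!%:R * expR x.
Proof.
move=> x0; have := expR_ge1Dxn k.-1 x0.
case: k => [|k] /=; first by move=> _; rewrite expr0 fact0 mul1r -expR0 ler_expR.
rewrite -ler_pdivrMl ?ltr0n ?fact_gt0// => h; apply: le_trans _ h.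
by rewrite mulrC lerDr.
Qed.

Section normal_law.
Context (R : realType) (s : R).
Hypothesis s_gt0 : 0 < s.

Local Notation RR := (measurableTypeR R).
Local Notation gam := (normal_prob 0 s : probability RR R).
Local Notation mu := (@lebesgue_measure R).
Local Notation pdf := (normal_pdf 0 s).

Let s0 : s != 0. Proof. by rewrite gt_eqF. Qed.

Lemma normal_intg (f : RR -> R) : measurable_fun [set: RR] f ->
  intg gam f <-> mu.-integrable setT (fun x => (f x * pdf x)%:E).
Proof.
move=> mf; apply: integrable_density => //.
- exact: normal_pdf_ge0.
- exact: measurable_normal_pdf.
Qed.

Lemma normal_Ex (f : RR -> R) : intg gam f ->
  (Ex gam f)%:E = (\int[mu]_x (f x * pdf x)%:E)%E.
Proof.
move=> hf; rewrite -intg_EFin//; apply: integral_density => //.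
- exact: measurable_normal_pdf.
- exact: intg_measurable hf.
Qed.

(** Multiplied by the normal density, this is a multiple of the normal density with deviation
    [Num.sqrt 2 * s]. It serves as a majorant for all polynomials. *)
Lemma intg_expR_sq : intg gam (fun x => expR (x ^+ 2 / (4 * s ^+ 2))).
Proof.
apply/normal_intg.
  by apply: measurableT_comp => //; apply: measurable_funM => //; exact: measurable_funX.
have ts0 : Num.sqrt 2 * s != 0 by rewrite mulf_neq0// sqrtr_eq0 -ltNge.
have := @integrable_normal_pdf R 0 (Num.sqrt 2 * s).
move=> /(integrableZl measurableT (normal_peak s / normal_peak (Num.sqrt 2 * s))).
apply: eq_integrable => //= x _; rewrite -EFinM; congr EFin.
rewrite !normal_pdfE// /normal_fun !subr0 mulrA mulfVK; last by rewrite gt_eqF// normal_peak_gt0.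
rewrite mulrCA -expRD; congr (_ * expR _).
by rewrite exprMn sqr_sqrtr//; field.
Qed.

Lemma le_intg_expR_sq (f : RR -> R) (c : R) : measurable_fun [set: RR] f ->
  (forall x, `|f x| <= c * expR (x ^+ 2 / (4 * s ^+ 2))) -> intg gam f.
Proof.
move=> mf h; have hg := intgZ c intg_expR_sq.
apply: (le_intg mf hg) => x.
exact: le_trans (h x) (ler_norm _).
Qed.

Lemma normr_exp_le_expR_sq (k : nat) (b : R) : 0 < b ->
  exists c, forall x : R, `|x| ^+ k <= c * expR (b * x ^+ 2).
Proof.
move=> b0; exists (1 + k`!%:R / b ^+ k) => x.
have e1 : 1 <= expR (b * x ^+ 2) by rewrite -expR0 ler_expR mulr_ge0 ?(ltW b0)// sqr_ge0.
have e2 := @powX_le_expR R k (b * x ^+ 2) (mulr_ge0 (ltW b0) (sqr_ge0 _)).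
have bk : 0 < b ^+ k by rewrite exprn_gt0.
have e3 : (x ^+ 2) ^+ k <= k`!%:R / b ^+ k * expR (b * x ^+ 2).
  by rewrite mulrAC ler_pdivlMr// mulrC -exprMn.
have e4 : `|x| ^+ k <= 1 + (x ^+ 2) ^+ k.
  rewrite -(real_normK (num_real x)) -exprM mulnC exprM.
  set y := `|x| ^+ k; have := sqr_ge0 (y - 1); have : 0 <= y by rewrite exprn_ge0.
  nra.
by apply: le_trans e4 _; rewrite mulrDl mul1r lerD.
Qed.

Lemma normal_tame : tame gam (fun x : RR => x).
Proof.
split=> [|k]; first exact: (@measurable_id _ RR).
have [|c hc] := @normr_exp_le_expR_sq k (4 * s ^+ 2)^-1.
  by rewrite invr_gt0 mulr_gt0// exprn_gt0.
apply: (@le_intg_expR_sq _ c); first exact: measurable_funX.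
by move=> x; rewrite normrX mulrC; move: (hc x); rewrite mulrC (mulrC (_^-1)).
Qed.
End normal_law.

Section normal_moments.
Context (R : realType) (s : R).
Hypothesis s_gt0 : 0 < s.
Local Notation RR := (measurableTypeR R).
Local Notation gam := (normal_prob 0 s : probability RR R).

(** The difference of the two integrands, times the density, is the derivative of - s^2 x^k times
    the density, which vanishes at infinity. For k = 0 the default [k.-1] is multiplied by 0. *)
Lemma normal_moment_rec (k : nat) :
  Ex gam (fun x : RR => x ^+ k.+1) = k%:R * s ^+ 2 * Ex gam (fun x : RR => x ^+ k.-1).
Proof.
have s0 : s != 0 by rewrite gt_eqF.
pose a := normal_peak s; pose nf (x : R) := expR (- x ^+ 2 / (s ^+ 2 *+ 2)).
pose f (x : R) : R := (x ^+ k.+1 - k%:R * s ^+ 2 * x ^+ k.-1) * (a * nf x).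
pose F (x : R) : R := - (s ^+ 2 * a) * (x ^+ k * nf x).
have dF (x : R) : is_derive x 1 F (f x).
  have d1 : is_derive x 1 (fun x : R => - x ^+ 2 / (s ^+ 2 *+ 2)) (- (x / s ^+ 2)).
    apply: is_derive_eq; rewrite /GRing.scale /= !mulr1 -[s ^+ 2 *+ 2]mulr_natl.
    by field.
  have d2 : is_derive x 1 nf (- (x / s ^+ 2) * nf x).
    by rewrite mulrC; exact: is_derive1_comp.
  have d3 : is_derive x 1 (fun x : R => x ^+ k) (k%:R * x ^+ k.-1).
    have h := is_deriveX k (is_derive_id x (1 : R)).
    rewrite [X in is_derive _ _ X](_ : _ = (@id R) ^+ k); last by apply/funext => y; rewrite exprfctE.
    by apply: (is_derive_eq h); rewrite /GRing.scale /= mulr1.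
  have d4 := is_deriveZ (- (s ^+ 2 * a)) (is_deriveM d3 d2).
  apply: (is_derive_eq d4).
  rewrite /GRing.scale /= /f (exprS x k).
  move: (x ^+ k) (x ^+ k.-1) (nf x) (k%:R : R) => y z w l; field.
  exact: s0.
have cf : continuous f.
  move=> x; apply: cvgM.
    apply: cvgB; first exact: exprn_continuous.
    by apply: cvgM; [exact: cvg_cst|exact: exprn_continuous].
  have := @continuous_normal_pdf R 0 s s0 x.
  rewrite normal_pdfE// /normal_fun; under eq_fun do rewrite subr0.
  exact.
have fE x : f x = (x ^+ k.+1 - k%:R * s ^+ 2 * x ^+ k.-1) * normal_pdf 0 s x.
  by rewrite normal_pdfE// /normal_fun subr0.
have tX l : intg gam (fun x : RR => x ^+ l) by have [_ ->] := normal_tame s_gt0.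
have if' : intg gam (fun x : RR => x ^+ k.+1 - k%:R * s ^+ 2 * x ^+ k.-1).
  by apply: intgB => //; exact: intgZ.
have [c hc] : exists c, forall x : R, `|x| ^+ k.+1 <= c * expR ((s ^+ 2 *+ 2)^-1 * x ^+ 2).
  by apply: normr_exp_le_expR_sq; rewrite invr_gt0 mulrn_wgt0// exprn_gt0.
have hF (x : R) : 0 < `|x| -> `|F x| <= s ^+ 2 * a * c * `|x|^-1.
  move=> x0; rewrite /F normrM normrN.
  have sa : 0 <= s ^+ 2 * a by apply: mulr_ge0; [exact: sqr_ge0|exact: normal_peak_ge0].
  rewrite (ger0_norm sa) -[leRHS]mulrA ler_wpM2l//.
  rewrite ler_pdivlMr// normrM mulrAC normrX -exprSr (ger0_norm (expR_ge0 _)).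
  by rewrite mulNr expRN ler_pdivrMr ?expR_gt0// [_ ^+ 2 / _]mulrC.
have invn : ((n.+1%:R : R)^-1) @[n --> \oo] --> (0 : R) by exact: cvg_harmonic.
have lim (e : nat -> R) : (forall n, `|e n| = n%:R) -> F (e n) @[n --> \oo] --> (0 : R).
  move=> he; rewrite -(cvg_shiftS (fun n => F (e n))); apply/norm_cvg0P.
  apply: (@squeeze_cvgr _ _ _ _ (fun=> 0) (fun n => s ^+ 2 * a * c * n.+1%:R^-1)).
  - apply: nearW => n; rewrite normr_ge0 /=.
    by have := hF (e n.+1); rewrite he; apply.
  - exact: cvg_cst.
  - by rewrite -(mulr0 (s ^+ 2 * a * c)); apply: cvgM => //; exact: cvg_cst.
apply/eqP; rewrite -subr_eq0 -ExZ// -ExB//; last exact: intgZ.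
have := normal_Ex if'.
have -> : (\int[@lebesgue_measure R]_x ((x ^+ k.+1 - k%:R * s ^+ 2 * x ^+ k.-1) * normal_pdf 0 s x)%:E = 0)%E.
  under eq_integral do rewrite -fE.
  apply: (integral_derivative_eq0 cf _ dF).
  - have [h _] := @normal_intg R s (fun x : RR => x ^+ k.+1 - k%:R * s ^+ 2 * x ^+ k.-1) (intg_measurable if').
    apply: eq_integrable (h if') => // x _ /=.
    by rewrite fE.
  - by apply: lim => n; rewrite ger0_norm.
  - by apply: lim => n; rewrite normrN ger0_norm.
by move=> [] /eqP.
Qed.
End normal_moments.

(** * Transfer of moments along a law *)

Section law_transfer.
Context (R : realType) (d d' : measure_display).
Context (T : measurableType d) (T' : measurableType d').
Variables (P : probability T R) (Q : probability T' R) (X : {RV P >-> T'}).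
Hypothesis XQ : forall A, measurable A -> P (X @^-1` A) = Q A.

Let QE (f : T' -> \bar R) : (\int[Q]_y f y = \int[distribution P X]_y f y)%E.
Proof. by apply: eq_measure_integral => A mA _; apply: esym; exact: XQ. Qed.

Lemma intg_law (f : T' -> R) : measurable_fun setT f -> intg Q f <-> intg P (f \o X).
Proof.
move=> mf; have mfX : measurable_fun setT (f \o X) by exact: measurableT_comp.
have E : (\int[Q]_x `|(f x)%:E| = \int[P]_x `|(f (X x))%:E|)%E.
  rewrite QE ge0_integral_distribution//.
  by apply/measurable_EFinP; exact: measurableT_comp.
split=> /integrableP[_ hf]; apply/integrableP; split.
- exact/measurable_EFinP.
- by rewrite -E.
- exact/measurable_EFinP.
- by rewrite E.
Qed.

Lemma Ex_law (f : T' -> R) : measurable_fun setT f -> intg P (f \o X) ->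
  Ex P (f \o X) = Ex Q f.
Proof.
move=> mf hf; rewrite /Ex /Rintegral QE integral_distribution//.
exact/measurable_EFinP.
Qed.
End law_transfer.

Section gaussian_variables.
Context (R : realType) (d : measure_display) (T : measurableType d).
Variable P : probability T R.

Lemma has_law_moments (X : {RV P >-> R}) (s : R) : 0 < s ->
  has_law P X (normal_prob 0 s) ->
  tame P X /\ forall k, Ex P (fun w => X w ^+ k.+1) = k%:R * s ^+ 2 * Ex P (fun w => X w ^+ k.-1).
Proof.
move=> s0 hX.
have mY : measurable_fun [set: T] (X : T -> measurableTypeR R) := measurable_funPT X.
(* The same variable with values in [measurableTypeR R], the carrier of the normal law. *)
pose Y : {RV P >-> measurableTypeR R}  :=
  @mfun_Sub _ _ T (measurableTypeR R) (X : T -> measurableTypeR R) (mem_set mY).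
have hY A : measurable A -> P (Y @^-1` A) = (normal_prob 0 s : probability (measurableTypeR R) R) A.
  by move=> mA; exact: hX.
have mX k : measurable_fun setT (fun x : measurableTypeR R => x ^+ k : R).
  by apply: measurable_funX; exact: (@measurable_id _ (measurableTypeR R)).
have tY k : intg P (fun w => X w ^+ k).
  have [h _] := intg_law hY (mX k); apply: h.
  by have [_ ->] := normal_tame s0.
split=> [|k]; first by split.
have E l : Ex P (fun w => X w ^+ l) = Ex (normal_prob 0 s : probability (measurableTypeR R) R) (fun x : measurableTypeR R => x ^+ l).
  by apply: (Ex_law hY (mX l)); exact: tY.
by rewrite !E normal_moment_rec.
Qed.

(** Writing the variance as E X^2 covers the degenerate and the nondegenerate case by one
    recursion. *)
Lemma centered_gaussian_moments (X : T -> R) : measurable_fun setT X ->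
  centered_gaussian P X -> tame P X /\
  forall k, Ex P (fun w => X w ^+ k.+1) =
    k%:R * Ex P (fun w => X w ^+ 2) * Ex P (fun w => X w ^+ k.-1).
Proof.
move=> mX hX.
suff [tX [v hv]] : tame P X /\ exists v, forall k,
    Ex P (fun w => X w ^+ k.+1) = k%:R * v * Ex P (fun w => X w ^+ k.-1).
  (* The recursion at k = 1 identifies v with E X^2. *)
  split=> // k; rewrite hv; congr (_ * _ * _); rewrite hv mul1r.
  by rewrite -[LHS]mulr1 -(Ex_cst P 1); congr (_ * Ex P _); apply/funext => w; rewrite expr0.
have [X0|[s s0 hs]] := hX; last first.
  have [tX hm] := @has_law_moments (mfun_Sub (mem_set mX)) s s0 hs.
  by split; [exact: tX|exists (s ^+ 2)].
have aeX k : (fun w => X w ^+ k) = (fun=> 0 ^+ k) %[ae P].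
  by apply: filterS X0 => w /= h t; rewrite h.
have mXk k : measurable_fun setT (fun w => X w ^+ k) by exact: measurable_funX.
have mc c : measurable_fun setT (fun _ : T => c : R) by exact: measurable_cst.
split; last first.
  exists 0 => k; rewrite mulr0 mul0r (Ex_ae (mXk _) (mc _) (aeX _)).
  by rewrite Ex_cst expr0n.
split=> // k; have /integrableP[_ hi] := intg_cst P (0 ^+ k : R).
apply/integrableP; split; first exact/measurable_EFinP.
rewrite (ae_eq_integral (fun _ : T => `|(0 ^+ k)%:E|%E))//.
- by apply: measurableT_comp => //; exact/measurable_EFinP.
- by apply: filterS (aeX k) => w /= h t; rewrite h.
Qed.
End gaussian_variables.

(* Ryser's formula for the permanent, by inclusion-exclusion over the column
   subsets [set j | e j]. *)
Lemma ryser_permanent (A : comNzRingType) (n : nat) (a : 'I_n -> 'I_n -> A) :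
  \sum_(e : {ffun 'I_n -> bool})
     (\prod_j (if e j then 1 else - 1)) * \prod_i \sum_j (if e j then a i j else 0)
  = \sum_(s : 'S_n) \prod_i a i (s i).
Proof.
transitivity (\sum_(f : {ffun 'I_n -> 'I_n})
   (\prod_i a i (f i)) * \prod_j \sum_(b : bool)
     ((if b then 1 else -1) * \prod_(i | f i == j) (if b then 1 else 0)) : A).
  under eq_bigr do rewrite bigA_distr_bigA mulr_sumr.
  rewrite exchange_big; apply: eq_bigr => f _.
  rewrite bigA_distr_bigA mulr_sumr; apply: eq_bigr => e _ /=.
  rewrite big_split /= mulrCA; congr (_ * _).
  have -> : \prod_i (if e (f i) then a i (f i) else 0) =
            (\prod_i a i (f i)) * \prod_i (if e (f i) then 1 else 0).
    by rewrite -big_split; apply: eq_bigr => i _ /=; case: (e (f i)); rewrite ?mulr1 ?mulr0.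
  congr (_ * _); rewrite (partition_big f xpredT) //=; apply: eq_bigr => j _.
  by apply: eq_bigr => i /eqP ->.
(* The signed sum over the bit of column j is 1 if f hits j and 1 - 1 = 0 otherwise, so only
   surjective f survive. *)
have E (f : {ffun 'I_n -> 'I_n}) j : \sum_(b : bool)
     ((if b then 1 else -1) * \prod_(i | f i == j) (if b then 1 else 0)) =
     ([exists i, f i == j])%:R :> A.
  rewrite big_bool /= mul1r [X in X + _]big1 ?mulr1//.
  case: existsP => [[i fij]|h].
    by rewrite (bigD1 i) //= mul0r mulr0 addr0.
  rewrite big_pred0; first by rewrite mulr1 subrr.
  by move=> i; apply/negbTE/negP => fij; apply: h; exists i.
transitivity (\sum_(f : {ffun 'I_n -> 'I_n})
    (\prod_i a i (f i)) * \prod_j ([exists i, f i == j])%:R).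
  by apply: eq_bigr => f _; congr (_ * _); apply: eq_bigr => j _; exact: E.
rewrite (bigID (fun f : {ffun 'I_n -> 'I_n} => injectiveb f)) /= [X in _ + X]big1 ?addr0; last first.
  move=> f finj; have [j hj] : exists j, ~~ [exists i, f i == j].
    apply/existsP; apply: contraR finj => /existsPn h.
    suff /card_uniqP : #|codom f| = size (codom f) by [].
    rewrite size_codom; apply: eq_card => j; rewrite [RHS]inE.
    by have := h j; rewrite negbK => /existsP[i /eqP <-]; exact: codom_f.
  by rewrite [X in _ * X](bigD1 j)//= (negbTE hj) mul0r mulr0.
rewrite (reindex (@pval _)) /=; last first.
  pose in_Sn := insubd (1%g : 'S_n).
  by exists in_Sn => /= f Uf; first apply: val_inj; apply: insubdK.
apply: eq_big => [s|s _]; first by have := valP s.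
rewrite pvalE [X in _ * X]big1 ?mulr1// => j _.
case: existsP => // h; case: h; exists ((s^-1)%g j).
by rewrite permKV.
Qed.

(** * Isonormal processes *)

Lemma poly_horner_inj (R : numDomainType) (p q : {poly R}) :
  (forall s, p.[s] = q.[s]) -> p = q.
Proof.
move=> h; apply/eqP; rewrite -subr_eq0; apply/negPn/negP => pq0.
pose rs := [seq (i%:R : R) | i <- iota 0 (size (p - q))].
have := max_poly_roots pq0 (_ : all (root (p - q)) rs) (_ : uniq rs).
rewrite size_map size_iota ltnn => /(_ _ _)/negP[] //.
- by apply/allP => x _; rewrite rootE !hornerE h subrr.
- by rewrite map_inj_uniq ?iota_uniq// => i j /eqP; rewrite eqr_nat => /eqP.
Qed.

Section gaussian_pair.
Context (R : realType) (d : measure_display) (T : measurableType d).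
Variable P : probability T R.

Let E (f g : T -> R) m : {poly R} :=
  \poly_(j < m.+1) ('C(m, j)%:R * Ex P (fun w => f w ^+ (m - j) * g w ^+ j)).

Let E_horner f g m s : tame P f -> tame P g ->
  (E f g m).[s] = Ex P (fun w => (f w + s * g w) ^+ m).
Proof.
move=> tf tg; have tfg i j : intg P (fun w => f w ^+ i * g w ^+ j).
  by apply: tame_intg; apply: tameM; exact: tameX.
transitivity (Ex P (fun w => \sum_(j < m.+1) ('C(m, j)%:R * s ^+ j) * (f w ^+ (m - j) * g w ^+ j))).
  rewrite horner_poly Ex_sum; last by move=> j; exact: intgZ.
  by apply: eq_bigr => j _; rewrite ExZ// mulrAC.
congr Ex; apply/funext => w; rewrite exprDn; apply: eq_bigr => j _.
by rewrite exprMn -mulr_natl; ring.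
Qed.

(* Read off the coefficient of s in the moments of f + s g. *)
Lemma gaussian_pair_ibp (f g : T -> R) (a b c : R) : tame P f -> tame P g ->
  (forall s k, Ex P (fun w => (f w + s * g w) ^+ k.+1) =
     k%:R * (a + 2 * b * s + c * s ^+ 2) * Ex P (fun w => (f w + s * g w) ^+ k.-1)) ->
  forall k, Ex P (fun w => f w ^+ k * g w) = k%:R * b * Ex P (fun w => f w ^+ k.-1).
Proof.
move=> tf tg h.
have hE k : E f g k.+1 = k%:R *: ((a%:P + (2 * b) *: 'X + c *: 'X^2) * E f g k.-1).
  by apply: poly_horner_inj => s; rewrite !hornerE !E_horner// h !mulrA.
have c0 k : (E f g k)`_0 = Ex P (fun w => f w ^+ k).
  rewrite coef_poly /= bin0 mul1r subn0; congr Ex; apply/funext => w.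
  by rewrite expr0 mulr1.
have c1 k : (E f g k)`_1 = k%:R * Ex P (fun w => f w ^+ k.-1 * g w).
  rewrite coef_poly; case: k => [|k]; first by rewrite mul0r.
  by rewrite ltnS /= bin1 subn1 /=; congr (_ * Ex _ _); apply/funext => w; rewrite expr1.
have F0 k : Ex P (fun w => f w ^+ k.+1) = k%:R * a * Ex P (fun w => f w ^+ k.-1).
  by have := h 0 k; rewrite mulr0 expr0n mulr0 !addr0; under eq_fun do rewrite mul0r addr0;
     move=> ->; congr (_ * Ex _ _); apply/funext => w; rewrite mul0r addr0.
(* The coefficient of s in [hE]. Strong induction rewrites the term in k - 2, and [F0] turns it into
   the moment of order k - 1. *)
have G k : k.+1%:R * Ex P (fun w => f w ^+ k * g w) =
    k%:R * (a * (k.-1%:R * Ex P (fun w => f w ^+ k.-2 * g w)) + 2 * b * Ex P (fun w => f w ^+ k.-1)).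
  rewrite -[LHS]c1 hE coefZ coefM !big_ord_recr big_ord0 /= add0r c0 c1.
  rewrite !coefD !coefZ !coefC !coefX !coefXn /=.
  by rewrite !(mulr0, addr0, add0r, mulr1).
elim/ltn_ind => k IH.
have k0 : k.+1%:R != 0 :> R by rewrite pnatr_eq0.
apply: (mulfI k0); rewrite G.
case: k IH {k0} => [|[|k]] IH; rewrite ?mul0r//=.
- by rewrite mulr0.
- by ring.
- by rewrite IH//= F0 -(natr1 k.+2) -(natr1 k.+1); ring.
Qed.
End gaussian_pair.

Section hilbert_inner.
Context (R : realType) (H : hilbertType R).
Implicit Types (x y z : H) (c : R).

Lemma innerDl x y z : inner (x + y) z = inner x z + inner y z.
Proof. by have := @inner_linearl R H z 1 x y; rewrite scale1r mul1r. Qed.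

Lemma inner0l y : inner (0 : H) y = 0.
Proof. by have := innerDl 0 0 y; rewrite addr0 => /eqP; rewrite -subr_eq0 opprD addrA subrr sub0r oppr_eq0 => /eqP. Qed.

Lemma innerZl c x y : inner (c *: x) y = c * inner x y.
Proof. by have := @inner_linearl R H y c x 0; rewrite !addr0 inner0l addr0. Qed.

Lemma innerZr c x y : inner x (c *: y) = c * inner x y.
Proof. by rewrite innerC innerZl innerC. Qed.

Lemma innerNl x y : inner (- x) y = - inner x y.
Proof. by rewrite -scaleN1r innerZl mulN1r. Qed.

Lemma innerBl x y z : inner (x - y) z = inner x z - inner y z.
Proof. by rewrite innerDl innerNl. Qed.

Lemma innerBr x y z : inner x (y - z) = inner x y - inner x z.
Proof. by rewrite innerC innerBl !(innerC x). Qed.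

Lemma inner_suml (I : Type) (s : seq I) (F : I -> H) y :
  inner (\sum_(i <- s) F i) y = \sum_(i <- s) inner (F i) y.
Proof.
elim: s => [|i s IH]; first by rewrite !big_nil inner0l.
by rewrite !big_cons innerDl IH.
Qed.

Lemma inner_sumr (I : Type) (s : seq I) (F : I -> H) y :
  inner y (\sum_(i <- s) F i) = \sum_(i <- s) inner y (F i).
Proof. by rewrite innerC inner_suml; apply: eq_bigr => i _; rewrite innerC. Qed.

Definition orthonormal n (e : 'I_n -> H) := forall i j, inner (e i) (e j) = (i == j)%:R.

Lemma orthonormal_coordinates n (e : 'I_n -> H) (c c' : 'I_n -> R) : orthonormal e ->
  inner (\sum_i c i *: e i) (\sum_i c' i *: e i) = \sum_i c i * c' i.
Proof.
move=> oe; rewrite inner_suml; apply: eq_bigr => i _.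
rewrite innerZl inner_sumr (bigD1 i) //= innerZr oe eqxx mulr1 big1 ?addr0// => j ji.
by rewrite innerZr oe eq_sym (negbTE ji) mulr0.
Qed.

(** Vectors with zero residual add nothing to e, so s may be linearly dependent and n is left
    free. *)
Lemma gram_schmidt (s : seq H) : exists n (e : 'I_n -> H), orthonormal e /\
  forall h, h \in s -> exists c : 'I_n -> R, h = \sum_i c i *: e i.
Proof.
elim: s => [|h s [n [e [oe he]]]].
  by exists 0%N, (fun=> 0); split=> // i; case: i.
pose r := h - \sum_i inner h (e i) *: e i.
have re i : inner r (e i) = 0.
  rewrite innerBl inner_suml (bigD1 i) //= innerZl oe eqxx mulr1 big1 ?addr0 ?subrr// => j ji.
  by rewrite innerZl oe (negbTE ji) mulr0.
have hr : h = r + \sum_i inner h (e i) *: e i by rewrite subrK.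
have [r0|r0] := eqVneq r 0.
  exists n, e; split=> // g; rewrite inE => /predU1P[->|/he//].
  by exists (fun i => inner h (e i)); rewrite {1}hr r0 add0r.
have nr : `|r| != 0 by rewrite normr_eq0.
pose e' (i : 'I_n.+1) := if unlift ord0 i is Some j then e j else `|r|^-1 *: r.
have e'0 : e' ord0 = `|r|^-1 *: r by rewrite /e' unlift_none.
have e'S j : e' (lift ord0 j) = e j by rewrite /e' liftK.
exists n.+1, e'; split.
  move=> i j; case: (unliftP ord0 i) => [i'|] ->; case: (unliftP ord0 j) => [j'|] ->; rewrite ?e'0 ?e'S.
  - by rewrite oe (inj_eq (@lift_inj _ ord0)).
  - by rewrite innerZr innerC re mulr0.
  - by rewrite innerZl re mulr0.
  - rewrite innerZl innerZr inner_norm eqxx /=.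
    by field.
have sumE (c : 'I_n.+1 -> R) : \sum_i c i *: e' i =
    c ord0 *: (`|r|^-1 *: r) + \sum_i c (lift ord0 i) *: e i.
  by rewrite big_ord_recl e'0; congr (_ + _); apply: eq_bigr => i _; rewrite e'S.
move=> g; rewrite inE => /predU1P[->|/he[c ->]].
  exists (fun i => if unlift ord0 i is Some j then inner h (e j) else `|r|).
  rewrite sumE unlift_none scalerA divff// scale1r {1}hr; congr (_ + _).
  by apply: eq_bigr => i _; rewrite liftK.
exists (fun i => if unlift ord0 i is Some j then c j else 0).
rewrite sumE unlift_none scale0r add0r.
by apply: eq_bigr => i _; rewrite liftK.
Qed.
End hilbert_inner.

Lemma L2_eq0 (R : realType) (d : measure_display) (T : measurableType d)
    (P : probability T R) (f : T -> R) :
  L2 P f -> Ex P (fun w => f w ^+ 2) = 0 -> f = (fun=> 0) %[ae P].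
Proof.
move=> [mf hf] f0.
have := intg_EFin hf; rewrite f0 => h.
have : (\int[P]_x `|(f x ^+ 2)%:E| = 0)%E.
  by rewrite -[RHS]h; apply: eq_integral => x _; rewrite gee0_abs// lee_fin sqr_ge0.
move/ae_eq_integral_abs; rewrite -/(EFin \o (fun x => f x ^+ 2)).
move=> /(_ measurableT (measurable_int _ hf)).
apply: filterS => x /= /(_ I) [] /eqP.
by rewrite expf_eq0 /= => /eqP.
Qed.

Section isonormal_process.
Context (R : realType) (d : measure_display) (T : measurableType d).
Variable P : probability T R.
Context (H : hilbertType R) (W : H -> {RV P >-> R}).
Hypothesis W_iso : isonormal W.

Lemma isonormal_gaussian h : centered_gaussian P (W h).
Proof.
have [/(_ 1%N (fun=> 1) (fun=> h)) + _] := W_iso.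
by under eq_fun do rewrite big_ord1 mul1r.
Qed.

Lemma isonormal_tame h : tame P (W h).
Proof. by have [] := centered_gaussian_moments (measurable_funPT (W h)) (isonormal_gaussian h). Qed.

Lemma isonormal_cov g h : Ex P (fun w => W g w * W h w) = inner g h.
Proof.
have [_ /(_ g h)] := W_iso; rewrite expectation_Ex; first by case.
by apply: L2_prod; apply: tame_L2; exact: isonormal_tame.
Qed.

(** [isonormal] does not postulate linearity of W. It holds almost surely because the covariance
    makes the second moment of the difference vanish. *)
Lemma isonormal_lincomb n (c : 'I_n -> R) (h : 'I_n -> H) :
  (fun w => \sum_i c i * W (h i) w) = (W (\sum_i c i *: h i) : T -> R) %[ae P].
Proof.
set x := \sum_i _; pose S w := \sum_i c i * W (h i) w.
have tS : tame P S by apply: tame_sum => i; apply: tameZ; exact: isonormal_tame.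
have tx := isonormal_tame x.
have ES y : Ex P (fun w => S w * W y w) = inner x y.
  rewrite /S inner_suml; under eq_fun do rewrite mulr_suml.
  rewrite Ex_sum; last by move=> i; apply: tame_intg; apply: tameM => //;
    [apply: tameZ|]; exact: isonormal_tame.
  apply: eq_bigr => i _; rewrite innerZl -isonormal_cov -ExZ.
    by congr Ex; apply/funext => w; rewrite mulrA.
  by apply: tame_intg; apply: tameM; exact: isonormal_tame.
have ESS : Ex P (fun w => S w * S w) = inner x x.
  rewrite {2}/x inner_sumr; transitivity (\sum_i c i * Ex P (fun w => S w * W (h i) w)).
    rewrite {2}/S; under eq_fun do rewrite mulr_sumr.
    rewrite Ex_sum; last by move=> i; apply: tame_intg; apply: tameM => //;
      apply: tameZ; exact: isonormal_tame.
    apply: eq_bigr => i _; rewrite -ExZ; first by congr Ex; apply/funext => w; ring.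
    by apply: tame_intg; apply: tameM => //; exact: isonormal_tame.
  by apply: eq_bigr => i _; rewrite ES innerZr.
have t2 : L2 P (fun w => S w - W x w) by apply: L2B; exact: tame_L2.
suff /(L2_eq0 t2) : Ex P (fun w => (S w - W x w) ^+ 2) = 0.
  by apply: filterS => w /= h1 h2; apply/eqP; rewrite -subr_eq0 (h1 h2).
have -> : (fun w => (S w - W x w) ^+ 2) =
    (fun w => S w * S w - 2 * (S w * W x w) + W x w * W x w).
  by apply/funext => w; ring.
have i1 : intg P (fun w => S w * S w) by apply: L2_prod; exact: tame_L2.
have i2 : intg P (fun w => S w * W x w) by apply: L2_prod; exact: tame_L2.
have i3 : intg P (fun w => W x w * W x w) by apply: L2_prod; exact: tame_L2.
rewrite ExD//; last by apply: intgB => //; exact: intgZ.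
rewrite ExB//; last exact: intgZ.
by rewrite ExZ// ESS ES isonormal_cov; ring.
Qed.

Section orthonormal_family.
Context (n : nat) (e : 'I_n -> H).
Hypothesis oe : orthonormal e.

Local Notation A := (mpoly.mpoly n R).
Local Notation X i := (mpoly.mpolyX R (mpoly.mnm1 i)).

Definition wick_ev (w : T) : A -> R := mpoly.meval (fun i => W (e i) w).
Definition wick_exp (q : A) : R^o := Ex P (wick_ev ^~ q).

Lemma wick_ev_tame q : tame P (wick_ev ^~ q).
Proof.
rewrite /wick_ev; under eq_fun do rewrite mpoly.mevalE.
apply: tame_sum => m; apply: tameZ; apply: tame_prod => i.
by apply: tameX; exact: isonormal_tame.
Qed.

Lemma wick_exp_linear : linear wick_exp.
Proof.
move=> c p q; rewrite /wick_exp /wick_ev.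
have := @ExD _ _ _ P _ _ (intgZ c (tame_intg (wick_ev_tame p))) (tame_intg (wick_ev_tame q)).
rewrite ExZ; last exact/tame_intg/wick_ev_tame.
move=> <-; congr Ex; apply/funext => w.
by rewrite /wick_ev mpoly.mevalD mpoly.mevalZ.
Qed.
HB.instance Definition _ := GRing.isLinear.Build R A R^o _ wick_exp wick_exp_linear.

Let L (t : 'I_n -> R) : A := \sum_i t i *: X i.

Let ev_L w t : wick_ev w (L t) = \sum_i t i * W (e i) w.
Proof.
rewrite /wick_ev /L raddf_sum; apply: eq_bigr => i _.
by rewrite /= mpoly.mevalZ mpoly.mevalXU.
Qed.

Let moments_L t k : wick_exp (L t ^+ k.+1) = k%:R * (\sum_i t i ^+ 2) * wick_exp (L t ^+ k.-1).
Proof.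
have E l : wick_exp (L t ^+ l) = Ex P (fun w => (\sum_i t i * W (e i) w) ^+ l).
  rewrite /wick_exp; congr Ex; apply/funext => w.
  by rewrite -ev_L /wick_ev rmorphXn.
rewrite !E.
have mS : measurable_fun setT (fun w => \sum_i t i * W (e i) w).
  by under eq_fun do rewrite -ev_L; have [] := wick_ev_tame (L t).
have [_ ->] := centered_gaussian_moments mS (W_iso.1 _ _ _).
congr (_ * _ * _).
have -> : \sum_i t i ^+ 2 = inner (\sum_i t i *: e i) (\sum_i t i *: e i).
  by rewrite orthonormal_coordinates//; apply: eq_bigr => i _; rewrite expr2.
rewrite -isonormal_cov; apply: Ex_ae.
- exact: measurable_funX.
- by apply: measurable_funM; exact: measurable_funPT.
- have := isonormal_lincomb t e; apply: filterS => w /= h Tw.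
  by rewrite expr2 h.
Qed.

(** The pair (L t, x_i) has variances [\sum_j t j ^+ 2] and 1 and covariance [t i];
    [gaussian_pair_ibp] then applies to powers of L t. *)
Let ibp_power i t k : wick_exp (X i * L t ^+ k) = wick_exp (mpoly.mderiv i (L t ^+ k)).
Proof.
have dL : mpoly.mderiv i (L t) = (t i)%:A.
  rewrite /L raddf_sum (bigD1 i) //= linearZ /= mpoly.mderivX mpoly.mnm1E eqxx scale1r big1 ?addr0.
    rewrite (_ : mpoly.mnm_sub _ _ = mpoly.mnm0) ?mpoly.mpolyX0//.
    by apply/mpoly.mnmP => j; rewrite mpoly.mnmBE subnn mpoly.mnm0E.
  move=> j ji; rewrite linearZ /= mpoly.mderivX mpoly.mnm1E.
  by rewrite (negbTE ji) scale0r scaler0.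
have dLk : mpoly.mderiv i (L t ^+ k) = (k%:R * t i) *: L t ^+ k.-1.
  elim: k => [|k IH]; first by rewrite expr0 mul0r scale0r -mpoly.mpolyC1 mpoly.mderivC.
  rewrite exprS mpoly.mderivM IH dL /= -scalerAl mul1r -scalerAr.
  case: k {IH} => [|k] /=; first by rewrite mul0r scale0r mul1r addr0.
  by rewrite -exprS -scalerDl -(natr1 k.+1) mulrDl mul1r addrC.
rewrite dLk linearZ /=.
transitivity (Ex P (fun w => wick_ev w (L t) ^+ k * wick_ev w (X i))).
  rewrite /wick_exp; congr Ex; apply/funext => w.
  by rewrite /wick_ev rmorphM rmorphXn mulrC.
rewrite (@gaussian_pair_ibp _ _ _ P _ _ (\sum_j t j ^+ 2) (t i) 1).
- rewrite /GRing.scale /= /wick_exp; congr (_ * Ex _ _); apply/funext => w.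
  by rewrite /wick_ev rmorphXn.
- exact: wick_ev_tame.
- exact: wick_ev_tame.
move=> s l; pose t' j := t j + s * (j == i)%:R.
have Lt' : L t' = L t + s *: X i.
  rewrite /L /t'; under eq_bigr do rewrite scalerDl.
  rewrite big_split /=; congr (_ + _).
  rewrite (bigD1 i) //= eqxx mulr1 big1 ?addr0// => j ji.
  by rewrite (negbTE ji) mulr0 scale0r.
have E m : Ex P (fun w => (wick_ev w (L t) + s * wick_ev w (X i)) ^+ m) = wick_exp (L t' ^+ m).
  rewrite /wick_exp Lt'; congr Ex; apply/funext => w.
  by rewrite /wick_ev rmorphXn /= mpoly.mevalD mpoly.mevalZ.
rewrite !E moments_L; congr (_ * _ * _).
rewrite /t' (bigD1 i) //= [in RHS](bigD1 i) //= eqxx mulr1.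
have -> : \sum_(j < n | j != i) (t j + s * (j == i)%:R) ^+ 2 = \sum_(j < n | j != i) t j ^+ 2.
  by apply: eq_bigr => j /negbTE ->; rewrite mulr0 addr0.
by ring.
Qed.

(** The failure of integration by parts, as a linear functional: it suffices to kill it on a
    spanning set. *)
Let defect i (q : A) : R^o := wick_exp (X i * q) - wick_exp (mpoly.mderiv i q).

Let defect_linear i : linear (defect i).
Proof.
move=> c p q; rewrite /defect mulrDr -scalerAr !linearP /=.
by rewrite scalerDr addrACA.
Qed.
HB.instance Definition _ i := GRing.isLinear.Build R A R^o _ (defect i) (defect_linear i).

(** With equal rows, [ryser_permanent] writes k! times the product as a signed sum of k-th powers of
    linear forms, on which [ibp_power] applies. *)
Let defect_monomial i (s : seq 'I_n) : defect i (\prod_(j <- s) X j) = 0.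
Proof.
set k := size s; pose c (r : 'I_k) := tnth (in_tuple s) r.
have -> : \prod_(j <- s) X j = \prod_(r < k) X (c r) by rewrite big_tnth.
have := ryser_permanent (fun _ r : 'I_k => X (c r) : A).
have -> : \sum_(s0 : 'S_k) \prod_r X (c (s0 r)) = (\prod_(r < k) X (c r)) *+ k`! :> A.
  rewrite -card_Sn -sumr_const; apply: eq_big => // s0 _.
  by rewrite [RHS](reindex_inj (@perm_inj _ s0)).
move=> /(congr1 (defect i)).
rewrite raddf_sum big1 => [/esym/eqP|f _]; last first.
  have [z ->] : exists z : R, \prod_j (if f j then 1 else -1) = z%:A :> A.
    exists (\prod_j (if f j then 1 else -1)); rewrite -[RHS]/((_)%:A).
    have -> : (\prod_j (if f j then 1 else -1))%:A = in_alg A (\prod_j (if f j then 1 else -1)) by [].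
    by rewrite rmorph_prod; apply: eq_bigr => j _; case: (f j); rewrite ?rmorphN rmorph1.
  rewrite /= -scalerAl mul1r linearZ /= prodr_const /= card_ord.
  rewrite (_ : \sum_j _ = L (fun l => \sum_(j | c j == l) (if f j then 1 else 0))).
    by rewrite /defect ibp_power subrr scaler0.
  rewrite /L (partition_big c xpredT)//=; apply: eq_bigr => l _.
  rewrite scaler_suml; apply: eq_bigr => j /eqP <-.
  by case: (f j); rewrite ?scale1r ?scale0r.
by rewrite raddfMn mulrn_eq0 -leqn0 leqNgt fact_gt0 /= => /eqP.
Qed.

Lemma wick_ibp i (q : A) : wick_exp (X i * q) = wick_exp (mpoly.mderiv i q).
Proof.
apply/eqP; rewrite -subr_eq0 -[_ - _]/(defect i q); apply/eqP.
elim/mpoly.mpolyind: q => [|c m p _ _ IH]; first exact: linear0.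
rewrite linearP /= IH addr0.
suff [s ->] : exists s : seq 'I_n, mpoly.mpolyX R m = \prod_(j <- s) X j.
  by rewrite defect_monomial scaler0.
rewrite mpoly.mpolyXE_id; elim: (index_enum _) => [|j r [s hs]].
  by exists [::]; rewrite !big_nil.
exists (nseq (m j) j ++ s); rewrite big_cons big_cat hs /=; congr (_ * _).
by rewrite big_nseq -GRing.iter_mulr_1.
Qed.
End orthonormal_family.
End isonormal_process.

(** * Hermite chaoses *)

Section hermite_chaos.
Context (R : realType).

Lemma deriv_hermite n : deriv (hermite R n.+1) = n.+1%:R *: hermite R n.
Proof.
elim: n => [|n IH]; first by rewrite /= mulr1 -polyC1 derivC subr0 derivX scale1r.
rewrite [hermite R n.+2]/(('X * hermite R n.+1 - deriv (hermite R n.+1))) derivB derivM derivX mul1r.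
rewrite IH derivZ -scalerAr -addrA -scalerBr -[_ - deriv _]/(hermite R n.+1).
by rewrite -[X in X + _]scale1r -scalerDl nat1r.
Qed.

Context (n : nat) (Om : Type) (A : gaussian_algebra R n Om).

Lemma gev_horner_alg (w : Om) (l : A) (q : {poly R}) :
  gev A w (horner_alg l q) = q.[gev A w l].
Proof.
elim/poly_ind: q => [|q c IH]; first by rewrite !rmorph0 horner0.
rewrite rmorphD rmorphM /= horner_algX horner_algC rmorphD rmorphM /= IH.
by rewrite gevZ rmorph1 mulr1 !hornerE.
Qed.

Lemma gder_horner_alg (i : 'I_n) (l : A) (q : {poly R}) :
  gder A i (horner_alg l q) = horner_alg l (deriv q) * gder A i l.
Proof.
elim/poly_ind: q => [|q c IH]; first by rewrite deriv0 !rmorph0 mul0r linear0.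
rewrite derivD derivM derivX derivC mulr1 addr0 !rmorphD !rmorphM /= horner_algX horner_algC.
rewrite raddfD /= gderM IH linearZ /= gder1 scaler0 addr0.
by ring.
Qed.

Lemma gnum_horner_alg (a : 'I_n -> R) (q : {poly R}) : \sum_i a i ^+ 2 = 1 ->
  let l := linear_form A a in
  gnum (horner_alg l q) = horner_alg l ('X * deriv q - deriv (deriv q)).
Proof.
move=> a1 l; rewrite /gnum.
transitivity (\sum_i ((a i *: gvar A i) * horner_alg l (deriv q)
   - (a i ^+ 2)%:A * horner_alg l (deriv (deriv q)))).
  apply: eq_bigr => i _; rewrite gder_horner_alg gderM gder_horner_alg gder_linear_form.
  by rewrite linearZ /= gder1 scaler0 mulr0 addr0 -!scalerAr -!scalerAl !mulr1 !mul1r scalerA expr2.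
rewrite sumrB -!mulr_suml -scaler_suml a1 scale1r mul1r.
by rewrite rmorphB rmorphM /= horner_algX.
Qed.

(** The Hermite equation X He_k' - He_k'' = k He_k gives the eigenvalue, and He_k' = k He_(k-1) the
    descent. *)
Lemma chaotic_hermite (a : 'I_n -> R) k : \sum_i a i ^+ 2 = 1 ->
  chaotic k (horner_alg (linear_form A a) (hermite R k)).
Proof.
move=> a1; elim: k => [|k IH]; first by exists 1; rewrite /= rmorph1 scale1r.
split=> [|i].
  rewrite gnum_horner_alg// deriv_hermite derivZ -scalerAr -scalerBr linearZ /=.
  by rewrite scaler_nat mulr_natl.
rewrite gder_horner_alg gder_linear_form deriv_hermite linearZ /= -scalerAr mulr1 -scalerAl mul1r scalerA.
rewrite -[X in chaotic k X]addr0; apply: chaoticP; [exact: IH|exact: chaotic0].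
Qed.
End hermite_chaos.

Section chaos_of_isonormal.
Context (R : realType) (d : measure_display) (T : measurableType d).
Variable P : probability T R.
Context (H : hilbertType R) (W : H -> {RV P >-> R}).
Hypothesis W_iso : isonormal W.

Section wick_algebra.
Context (n : nat) (e : 'I_n -> H).
Hypothesis oe : orthonormal e.

Definition wick_algebra : gaussian_algebra R n T.
Proof.
apply: (@Build_gaussian_algebra R n T (mpoly.mpoly n R)
  (fun i => mpoly.mpolyX R (mpoly.mnm1 i)) (fun i => mpoly.mderiv i)
  (fun w => mpoly.meval (fun i => W (e i) w)) (wick_exp W e)).
- by move=> w c q; rewrite /= mpoly.mevalZ.
- by move=> i p q; rewrite /= mpoly.mderivM.
- move=> i j; rewrite /= mpoly.mderivX mpoly.mnm1E eq_sym.
  have [->|ij] := eqVneq i j; last by rewrite scale0r.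
  rewrite scale1r (_ : mpoly.mnm_sub _ _ = mpoly.mnm0) ?mpoly.mpolyX0//.
  by apply/mpoly.mnmP => k; rewrite mpoly.mnmBE subnn mpoly.mnm0E.
- by move=> i j q; rewrite /= mpoly.mderiv_comm.
- rewrite /= /wick_exp /wick_ev; under eq_fun do rewrite mpoly.meval1.
  exact: Ex_cst.
- by move=> q hq; apply: Ex_ge0.
- by move=> i q; exact: wick_ibp.
Defined.

Lemma wick_algebra_exp (q : wick_algebra) : gexp wick_algebra q = Ex P (fun w => gev wick_algebra w q).
Proof. by []. Qed.

Lemma wick_algebra_tame (q : wick_algebra) : tame P (fun w => gev wick_algebra w q).
Proof. exact: wick_ev_tame. Qed.

Lemma wick_algebra_form (c : 'I_n -> R) :
  (fun w => gev wick_algebra w (linear_form wick_algebra c)) = (W (\sum_i c i *: e i) : T -> R) %[ae P].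
Proof.
apply: filterS (isonormal_lincomb W_iso c e) => w /= h Tw; rewrite -(h Tw).
rewrite /linear_form raddf_sum; apply: eq_bigr => i _ /=.
by rewrite mpoly.mevalZ mpoly.mevalXU.
Qed.
End wick_algebra.

(** Leibniz rule along h for a product of values of W: each factor g in turn is removed and leaves
    its covariance with h as coefficient. *)
Fixpoint wick_sum (h : H) (s : seq H) : seq (R * seq H) :=
  if s is g :: t then (inner h g, t) :: [seq (ct.1, g :: ct.2) | ct <- wick_sum h t] else [::].

Lemma size_wick_sum h s : all (fun ct => size ct.2 < size s)%N (wick_sum h s).
Proof.
elim: s => //= g t IH; rewrite ltnS leqnn /=.
by rewrite all_map; apply: sub_all IH => ct /=.
Qed.

Definition Wprod (s : seq H) (w : T) : R := \prod_(g <- s) W g w.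

Definition hermite_sum p m (c : 'I_m -> R) (h : 'I_m -> H) (w : T) : R :=
  \sum_i c i * (hermite R p).[W (h i) w].

Lemma Wprod_tame s : tame P (Wprod s).
Proof. by apply: tame_prod => g; exact: isonormal_tame. Qed.

Lemma hermite_sum_tame p m (c : 'I_m -> R) (h : 'I_m -> H) : tame P (hermite_sum p c h).
Proof. by apply: tame_sum => i; apply: tameZ; apply: tame_horner; exact: isonormal_tame. Qed.

Let tame_meas f : tame P f -> measurable_fun setT f. Proof. by case. Qed.

(** Transports the abstract calculus to the process. The finitely many vectors at hand are expanded
    in an orthonormal family, whose polynomials form a [gaussian_algebra]. The family stays inside
    the proof; of the derivative DF only its size and its place in the integration by parts are
    exported. *)
Lemma hermite_sum_calculus p m (c : 'I_m -> R) (h : 'I_m -> H) (g : H) (s : seq H) :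
  (forall i, `|h i| = 1) -> `|g| = 1 -> let F := hermite_sum p c h in
  (forall k, Ex P (fun w => F w ^+ (2 * k.+1)) <=
    (2 * k%:R + 1) ^+ (p * k.+1) * Ex P (fun w => F w ^+ 2) ^+ k.+1) /\
  ((1 < p)%N -> exists DF, [/\ tame P DF,
    Ex P (fun w => DF w ^+ 2) ^+ 2 <= p%:R *
      (Ex P (fun w => F w ^+ 4) - 3 * Ex P (fun w => F w ^+ 2) ^+ 2) &
    forall a, Ex P (fun w => F w ^+ a * Wprod (g :: s) w) =
     \sum_(ct <- wick_sum g s) ct.1 * Ex P (fun w => F w ^+ a * Wprod ct.2 w)
     + a%:R * Ex P (fun w => F w ^+ a.-1 * DF w * Wprod s w)]).
Proof.
move=> h1 g1 F.
have [n [e [oe he]]] := gram_schmidt (g :: s ++ codom h).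
pose A := wick_algebra oe.
pose co (x : H) (i : 'I_n) := inner x (e i).
have coE x : x \in g :: s ++ codom h -> x = \sum_i co x i *: e i.
  move=> /he[b xb]; rewrite {1}xb; apply: eq_bigr => i _; congr (_ *: _).
  rewrite /co xb inner_suml (bigD1 i) //= innerZl oe eqxx mulr1 big1 ?addr0// => j ji.
  by rewrite innerZl oe (negbTE ji) mulr0.
have co_inner x y : x \in g :: s ++ codom h -> y \in g :: s ++ codom h ->
    \sum_i co x i * co y i = inner x y.
  by move=> /coE hx /coE hy; rewrite {2}hx {2}hy orthonormal_coordinates.
have co1 x : x \in g :: s ++ codom h -> `|x| = 1 -> \sum_i co x i ^+ 2 = 1.
  move=> hx x1; under eq_bigr do rewrite expr2.
  by rewrite co_inner// inner_norm x1 expr1n.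
pose l x : A := linear_form A (co x).
(* One null set serves all the vectors, because the list is finite. *)
have lW : \forall w \ae P, forall x, x \in g :: s ++ codom h -> gev A w (l x) = W x w.
  move: (g :: s ++ codom h) coE {he co_inner co1} => r coE.
  elim: r coE => [|x r IH] coE; first exact: aeW.
  have hx := wick_algebra_form oe (co x).
  have hr : \forall w \ae P, forall x, x \in r -> gev A w (l x) = W x w.
    by apply: IH => y yr; apply: coE; rewrite inE yr orbT.
  apply: filterS2 hx hr => w h2 h3 y; rewrite inE => /predU1P[->|/h3//].
  by rewrite [RHS]/= {2}(coE x) ?mem_head//; exact: h2.
pose Q : A := \sum_i c i *: horner_alg (l (h i)) (hermite R p).
have hin i : h i \in g :: s ++ codom h by rewrite inE mem_cat codom_f !orbT.
have FQ : \forall w \ae P, F w = gev A w Q.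
  apply: filterS lW => w lW; rewrite /Q raddf_sum; apply: eq_bigr => i _ /=.
  by rewrite mpoly.mevalZ -[mpoly.meval _ _]/(gev A w _) gev_horner_alg lW.
have Qc : chaotic p Q.
  by apply: chaotic_sum => i; apply: chaotic_hermite; exact: co1.
pose Wp (t : seq H) : A := \prod_(x <- t) l x.
have WpE : \forall w \ae P, forall t, {subset t <= g :: s} -> Wprod t w = gev A w (Wp t).
  apply: filterS lW => w lW t ts; rewrite /Wp rmorph_prod.
  apply: eq_big_seq => x /ts xs; rewrite -lW//.
  by move: xs; rewrite !inE mem_cat => /orP[->//|->]; rewrite orbT.
have E4 (f : T -> R) (q : A) : measurable_fun setT f ->
    (\forall w \ae P, f w = gev A w q) -> Ex P f = gexp A q.
  move=> mf fq; rewrite wick_algebra_exp; apply: Ex_ae => //.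
    by apply: tame_meas; exact: wick_algebra_tame.
  by apply: filterS fq => w ->.
have mF k : measurable_fun setT (fun w => F w ^+ k).
  by apply: tame_meas; apply: tameX; exact: hermite_sum_tame.
have EF k : Ex P (fun w => F w ^+ k) = gexp A (Q ^+ k).
  by apply: E4 => //; apply: filterS FQ => w ->; rewrite rmorphXn.
split; first by move=> k; rewrite !EF; exact: hypercontractivity.
move=> p1; exists (fun w => gev A w (gdir (co g) Q)).
have gin : g \in g :: s ++ codom h by rewrite mem_head.
split; first exact: wick_algebra_tame.
  rewrite !EF; have -> : Ex P (fun w => gev A w (gdir (co g) Q) ^+ 2) = gexp A (gdir (co g) Q ^+ 2).
    by apply: E4; [apply: tame_meas; apply: tameX; exact: wick_algebra_tame|apply: aeW => w; rewrite rmorphXn].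
  exact: gdir_sq_chaotic (co1 _ gin g1).
move=> a.
have gdir_prod t : {subset t <= s} -> gdir (co g) (Wp t) = \sum_(ct <- wick_sum g t) ct.1 *: Wp ct.2.
  elim: t => [|x t IH] ts.
    rewrite /Wp !big_nil /gdir big1// => i _; by rewrite gder1 scaler0.
  have xin : x \in g :: s ++ codom h by rewrite inE mem_cat ts ?mem_head// orbT.
  rewrite /Wp big_cons gdirM gdir_linear_form co_inner// -scalerAl mul1r /= big_cons big_map /=; congr (_ + _).
  rewrite -/(Wp t) IH; last by move=> y yt; apply: ts; rewrite inE yt orbT.
  by rewrite mulr_sumr; apply: eq_bigr => ct _ /=; rewrite -scalerAr /Wp big_cons.
have sub_wick t : forall ct, ct \in wick_sum g t -> {subset ct.2 <= t}.
  elim: t => // x t IH ct /=; rewrite inE => /predU1P[->|/mapP[ct' /IH h2 ->]] y /=.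
    by move=> yt; rewrite inE yt orbT.
  by rewrite !inE => /predU1P[->|/h2 ->]; rewrite ?eqxx// orbT.
have -> : Ex P (fun w => F w ^+ a * Wprod (g :: s) w) = gexp A (l g * (Q ^+ a * Wp s)).
  apply: E4; first by apply: tame_meas; apply: tameM; [apply: tameX; exact: hermite_sum_tame|exact: Wprod_tame].
  apply: filterS2 FQ WpE => w -> ->// ; rewrite !rmorphM rmorphXn /= /Wp big_cons rmorphM /=.
  by rewrite mulrCA.
(* Integration by parts along g: the product of the W yields [wick_sum], the power of Q yields the
   term in DF. *)
rewrite gexp_linear_form gdirM gdirX gdir_prod// raddfD addrC /=; congr (_ + _).
  rewrite mulr_sumr raddf_sum big_seq [RHS]big_seq; apply: eq_bigr => ct cts.
  rewrite /= -scalerAr linearZ /=; congr (_ * _); apply/esym/E4.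
    by apply: tame_meas; apply: tameM; [apply: tameX; exact: hermite_sum_tame|exact: Wprod_tame].
  apply: filterS2 FQ WpE => w -> ->; first by rewrite rmorphM rmorphXn.
  by move=> y /(sub_wick _ _ cts) ys; rewrite inE ys orbT.
rewrite -[LHS]/(gexp A (a%:R * Q ^+ a.-1 * gdir (co g) Q * Wp s)) -!mulrA gexp_natl.
congr (_ * _); apply/esym/E4.
  apply: tame_meas; apply: tameM; last exact: Wprod_tame.
  by apply: tameM; [apply: tameX; exact: hermite_sum_tame|exact: wick_algebra_tame].
apply: filterS2 FQ WpE => w -> ->; first by rewrite !rmorphM rmorphXn mulrA.
by move=> y ys; rewrite inE ys orbT.
Qed.
End chaos_of_isonormal.

(** * Weak convergence *)

Section clamp.
Context (R : realType).
Implicit Types (K x y : R).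

(** Composed with [clamp], any continuous function becomes bounded and uniformly continuous, hence a
    legitimate test function. *)
Definition clamp K x : R := Num.max (- K) (Num.min K x).

Lemma clamp_norm K x : 0 <= K -> `|clamp K x| <= K.
Proof.
move=> K0; rewrite ler_norml /clamp le_max lexx /= ge_max ge_min lexx /= andbT.
by rewrite (le_trans _ K0)// oppr_le0.
Qed.

Lemma clamp_id K x : `|x| <= K -> clamp K x = x.
Proof.
rewrite ler_norml => /andP[h1 h2]; rewrite /clamp min_r// max_r//.
Qed.

Lemma clamp_lipschitz K x y : `|clamp K x - clamp K y| <= `|x - y|.
Proof.
have h1 := ler_norm (x - y); have h2 := ler_norm (y - x); rewrite distrC in h2.
rewrite ler_norml /clamp /Num.max /Num.min; apply/andP.
case: (ltP K x) => ?; case: (ltP K y) => ?; case: (ltP (- K) K) => ?;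
  case: (ltP (- K) x) => ?; case: (ltP (- K) y) => ?; split; lra.
Qed.

Lemma clamp_continuous K : continuous (clamp K).
Proof.
move=> x; apply: (@continuous_max R R (fun=> - K) (fun y => Num.min K y)).
  exact: cvg_cst.
by apply: (@continuous_min R R (fun=> K) id); [exact: cvg_cst|exact: cvg_id].
Qed.
End clamp.

(** Stronger than uniform continuity on A, since y may lie outside A. Compactness enters as a near
    covering with parameter delta tending to 0 from the right. *)
Lemma heine (R : realType) (V : pseudoMetricType R) (A : set V) (phi : V -> R) :
  continuous phi -> compact A -> forall eps, 0 < eps ->
  exists2 delta, 0 < delta & forall x y, A x -> ball x delta y -> `|phi x - phi y| <= eps.
Proof.
move=> cphi cA eps e0.
have /compact_near_coveringP/(_ R (0^'+) (fun delta x => forall y, ball x delta y -> `|phi x - phi y| <= eps) _) h := cA.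
have [|] := h _.
  move=> x Ax; have /cvgrPdist_lt/(_ (eps / 2)) := cphi x; rewrite divr_gt0// => /(_ isT).
  move=> /nbhs_ballP[r /= r0 hr].
  exists (ball x (r / 2), [set dl : R | 0 < dl < r / 2]) => /=.
    split; first by apply: nbhsx_ballx; rewrite divr_gt0.
    near=> dl; apply/andP; split; first by near: dl; exact: nbhs_right_gt.
    by near: dl; apply: nbhs_right_lt; rewrite divr_gt0.
  move=> [x' dl] /= [hx' /andP[dl0 dlr]] y hy.
  have h1 : `|phi x - phi x'| < eps / 2 by apply: hr; apply: le_ball hx'; rewrite ler_pdivrMr// ler_peMr ?ler1n// ltW.
  have h2 : `|phi x - phi y| < eps / 2.
    apply: hr; rewrite /= (splitr r); apply: ball_triangle hx' _.
    by apply: le_ball hy; exact: ltW.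
  rewrite -(subrKA (phi x)) (splitr eps); apply: le_trans (ler_normD _ _) _.
  by rewrite distrC lerD// ltW.
move=> r /= r0 hr; have r2 : 0 < r / 2 by rewrite divr_gt0.
exists (r / 2) => // x y Ax.
apply: (hr (r / 2)) => //=; rewrite sub0r normrN gtr0_norm//.
by rewrite ltr_pdivrMr// ltr_pMr// ltr1n.
Unshelve. all: by end_near. Qed.

Lemma clamp_uniform (R : realType) (phi : R -> R) K : continuous phi -> 0 < K ->
  forall eps, 0 < eps -> exists2 delta, 0 < delta & forall x y, `|x - y| < delta ->
    `|phi (clamp K x) - phi (clamp K y)| <= eps.
Proof.
move=> cphi K0 eps e0.
have [dl d0 h] := heine cphi (@segment_compact R (- K) K) e0.
exists dl => // x y xy; apply: h.
  by rewrite /= in_itv /= -ler_norml; apply: clamp_norm; exact: ltW.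
by rewrite /ball /=; apply: le_lt_trans (clamp_lipschitz _ _ _) xy.
Qed.

Lemma clamp_bounded (R : realType) (phi : R -> R) K : continuous phi -> 0 < K ->
  exists2 M, 0 < M & forall x, `|phi (clamp K x)| <= M.
Proof.
move=> cphi K0.
have cK : compact (phi @` `[- K, K]%classic).
  by apply: continuous_compact; [exact: continuous_subspaceT|exact: segment_compact].
have [M [_ hM]] := compact_bounded cK.
exists (`|M| + 1); first by rewrite ltr_wpDl.
move=> x; apply: (hM (`|M| + 1)); first by rewrite (le_lt_trans (ler_norm _))// ltrDl.
exists (clamp K x) => //.
by rewrite /= in_itv /= -ler_norml; apply: clamp_norm; exact: ltW.
Qed.

Section bounded_expectation.
Context (R : realType) (d : measure_display) (T : measurableType d).
Variable P : probability T R.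

Lemma Ex_close (f g D : T -> R) (eps c : R) : intg P f -> intg P g -> intg P D ->
  (forall w, `|f w - g w| <= eps + c * D w) -> `|Ex P f - Ex P g| <= eps + c * Ex P D.
Proof.
move=> hf hg hD h; rewrite -ExB//; apply: le_trans (Ex_norm (intgB hf hg)) _.
rewrite -ExZ// -[X in X + _](Ex_cst P) -ExD//; try exact: intgZ; try exact: intg_cst.
apply: Ex_le => //; first exact/intg_norm/intgB.
by apply: intgD; [exact: intg_cst|exact: intgZ].
Qed.

Lemma intg_continuous_bounded (f : T -> R) (phi : R -> R) M : measurable_fun setT f ->
  continuous phi -> (forall x, `|phi x| <= M) -> intg P (phi \o f).
Proof.
move=> mf cphi h; apply: (@intg_bounded _ _ _ P _ M) => [|x]; last exact: h.
by apply: measurableT_comp => //; exact: continuous_measurable_fun.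
Qed.

Lemma clamp_comp_continuous (phi : R -> R) K : continuous phi -> continuous (phi \o clamp K).
Proof. by move=> cphi x; apply: continuous_comp; [exact: clamp_continuous|exact: cphi]. Qed.

End bounded_expectation.

Section weak_convergence.
Context (R : realType) (d : measure_display) (T : measurableType d).
Variable P : probability T R.
Context (d' : measure_display) (T' : measurableType d').
Variables (Q : probability T' R) (Z : T' -> R).
Hypothesis Zt : tame Q Z.

(** The form of convergence in law used from here on: it allows unbounded continuous phi and passes
    from X n to L2-close approximations F n. *)
Definition clamp_cvg (F : nat -> T -> R) := forall K (phi : R -> R), 0 < K -> continuous phi ->
  Ex P (phi \o clamp K \o F n) @[n --> \oo] --> Ex Q (phi \o clamp K \o Z).

Lemma cvg_in_law_clamp (X : nat -> {RV P >-> R}) (F : nat -> T -> R) :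
  cvg_in_law P Q (fun n => X n : T -> R) Z ->
  (forall n, measurable_fun setT (F n)) -> (forall n, L2 P (fun w => X n w - F n w)) ->
  Ex P (fun w => (X n w - F n w) ^+ 2) @[n --> \oo] --> (0 : R) -> clamp_cvg F.
Proof.
move=> hX mF L2XF XF K phi K0 cphi.
pose psi := phi \o clamp K.
have cpsi : continuous psi by exact: clamp_comp_continuous.
have [M M0 hM] := clamp_bounded cphi K0.
have mZ : measurable_fun setT Z by case: Zt.
have iX n : intg P (psi \o X n) by apply: intg_continuous_bounded hM.
have iF n : intg P (psi \o F n) by apply: intg_continuous_bounded hM.
have iZ : intg Q (psi \o Z).
  apply: (@intg_bounded _ _ _ Q _ M) => [|x]; last exact: hM.
  by apply: measurableT_comp => //; exact: continuous_measurable_fun.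
have hX' : Ex P (psi \o X n) @[n --> \oo] --> Ex Q (psi \o Z).
  have := hX psi cpsi; rewrite expectation_Ex//.
  have -> : (fun n => 'E_P[psi \o X n])%E = EFin \o (fun n => Ex P (psi \o X n)).
    by apply/funext => n; rewrite /= expectation_Ex.
  have bpsi : bounded_fun psi.
    by exists M; split; [exact: num_real|move=> x Mx y _; exact: le_trans (hM y) (ltW Mx)].
  by move=> /(_ bpsi) /fine_cvgP[].
apply/cvgrPdist_le => eps e0.
have e3 : 0 < eps / 3 by rewrite divr_gt0.
have [dl dl0 hdl] := clamp_uniform cphi K0 e3.
(* Chebyshev inside the expectation: where |X n - F n| >= dl, the trivial bound 2 M is at most c (X
   n - F n)^2. *)
pose c := 2 * M / dl ^+ 2; have c0 : 0 < c by rewrite divr_gt0 ?mulr_gt0 ?exprn_gt0.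
have /cvgrPdist_le/(_ _ e3) N1 := hX'.
have /cvgrPdist_le/(_ (eps / 3 / c) (divr_gt0 e3 c0)) N2 := XF.
near=> n.
have h1 : `|Ex Q (psi \o Z) - Ex P (psi \o X n)| <= eps / 3 by near: n.
have h2 : `|0 - Ex P (fun w => (X n w - F n w) ^+ 2)| <= eps / 3 / c by near: n.
have h3 : `|Ex P (psi \o X n) - Ex P (psi \o F n)| <= eps / 3 + c * Ex P (fun w => (X n w - F n w) ^+ 2).
  apply: Ex_close => //; first by have [] := L2XF n.
  move=> w; rewrite /psi /=.
  have [xf|fx] := ltP `|X n w - F n w| dl.
    by apply: le_trans (hdl _ _ xf) _; rewrite lerDl mulr_ge0 ?sqr_ge0// ltW.
  apply: (@le_trans _ _ (2 * M)).
    apply: le_trans (ler_normB _ _) _; have := hM (X n w); have := hM (F n w); lra.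
  apply: (@le_trans _ _ (c * (X n w - F n w) ^+ 2)); last by rewrite lerDr ltW.
  rewrite /c mulrAC ler_pdivlMr ?exprn_gt0// ler_wpM2l ?mulr_ge0 ?(ltW M0)//.
  by rewrite -(real_normK (num_real (X n w - _))) lerXn2r// nnegrE// ltW.
move: h2; rewrite sub0r normrN => /(le_trans (ler_norm _)).
rewrite ler_pdivlMr// mulrC => h2.
rewrite -(subrKA (Ex P (psi \o X n))); apply: le_trans (ler_normD _ _) _.
by apply: le_trans (lerD h1 (le_trans h3 (lerD (lexx _) h2))) _; lra.
Unshelve. all: by end_near. Qed.

(* A Paley-Zygmund argument: the fourth moment bound keeps E (F n)^2 from
   escaping above a level at which clamping is visible in the limit. *)
Lemma clamp_cvg_second_moment (F : nat -> T -> R) (C : R) : 0 < C ->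
  (forall n, tame P (F n)) ->
  (forall n, Ex P (fun w => F n w ^+ 4) <= C * Ex P (fun w => F n w ^+ 2) ^+ 2) ->
  clamp_cvg F -> exists B, \forall n \near \oo, Ex P (fun w => F n w ^+ 2) <= B.
Proof.
move=> C0 tF hC hF; pose s2 := Ex Q (fun y => Z y ^+ 2).
have s20 : 0 <= s2 by apply: Ex_ge0 => y; exact: sqr_ge0.
(* At this level the limit satisfies E phi(clamp K Z) <= s2 / K^2 <= 1 / (4 C), so eventually e <= 1
   / (2 C). *)
pose K := Num.sqrt (4 * C * (s2 + 1)).
have K2 : K ^+ 2 = 4 * C * (s2 + 1).
  by rewrite sqr_sqrtr// !mulr_ge0 ?(ltW C0)// addr_ge0.
have K20 : 0 < K ^+ 2 by rewrite K2 !mulr_gt0// ltr_wpDl.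
have K0 : 0 < K.
  by rewrite lt_neqAle sqrtr_ge0 andbT eq_sym; apply: contraTneq K20 => ->; rewrite expr0n ltxx.
pose phi (x : R) := x ^+ 2 / K ^+ 2.
have cphi : continuous phi by move=> x; apply: cvgM; [exact: exprn_continuous|exact: cvg_cst].
have phi_ge0 x : 0 <= phi x by rewrite divr_ge0 ?sqr_ge0.
have phi_le1 x : phi (clamp K x) <= 1.
  rewrite /phi ler_pdivrMr// mul1r -(real_normK (num_real (clamp K x))).
  by rewrite lerXn2r ?nnegrE// ?(ltW K0)// clamp_norm// ltW.
have clampx x : `|clamp K x| <= `|x|.
  have := clamp_lipschitz K x 0; rewrite (@clamp_id _ K 0) ?normr0 ?(ltW K0)//.
  by rewrite !subr0.
have EZ : Ex Q (phi \o clamp K \o Z) <= (4 * C)^-1.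
  apply: (@le_trans _ _ (s2 / K ^+ 2)).
    rewrite mulrC -ExZ; last by have [_ ->] := Zt.
    apply: Ex_le => [||y].
    - apply: (@intg_bounded _ _ _ Q _ 1) => [|y]; last by rewrite ger0_norm ?phi_ge0// phi_le1.
      apply: measurableT_comp; last by case: Zt.
      by apply: continuous_measurable_fun; exact: clamp_comp_continuous.
    - by apply: intgZ; have [_ ->] := Zt.
    - rewrite /= /phi mulrC ler_wpM2l ?invr_ge0 ?(ltW K20)//.
      by rewrite -(real_normK (num_real (clamp _ _))) -(real_normK (num_real (Z y))) lerXn2r ?nnegrE.
  rewrite ler_pdivrMr// K2.
  by rewrite mulrA mulVf ?mul1r ?lerDl// mulf_neq0// gt_eqF.
exists (4 * K ^+ 2).
have /cvgrPdist_le/(_ ((4 * C)^-1)) := hF K phi K0 cphi.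
rewrite invr_gt0 mulr_gt0// => /(_ isT); apply: filterS => n.
set e := Ex P _; rewrite ler_norml => /andP[he _].
have {}he : e <= (2 * C)^-1.
  have -> : (2 * C)^-1 = (4 * C)^-1 + (4 * C)^-1 by field; rewrite gt_eqF.
  by move: he EZ; lra.
set t := Ex P (fun w => F n w ^+ 2).
have t0 : 0 <= t by apply: Ex_ge0 => w; exact: sqr_ge0.
have [->|tn0] := eqVneq t 0; first by rewrite mulr_ge0// ltW.
have tp : 0 < t by rewrite lt_neqAle eq_sym tn0.
(* With this weight the fourth moment costs at most t / 2 and the clamped term at most t / 4,
   leaving t <= K^2 + 3 t / 4. *)
pose a := (C * t)^-1; have a0 : 0 < a by rewrite invr_gt0 mulr_gt0.
have ichi : intg P (phi \o clamp K \o F n).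
  apply: (@intg_bounded _ _ _ P _ 1) => [|y]; last by rewrite ger0_norm ?phi_ge0// phi_le1.
  apply: measurableT_comp; last by case: (tF n).
  by apply: continuous_measurable_fun; exact: clamp_comp_continuous.
(* Pointwise: either x^2 <= K^2, or [phi (clamp K x) = 1] and x^2 <= (a / 2) x^4 + 1 / (2 a). *)
have : t <= K ^+ 2 + (a / 2 * Ex P (fun w => F n w ^+ 4) + C * t / 2 * e).
  have [_ iF] := tF n.
  rewrite /t -(ExZ (a / 2))// -(ExZ (C * Ex _ _ / 2))// -ExD; try exact: intgZ.
  rewrite -[X in X + _](Ex_cst P) -ExD; last by apply: intgD; exact: intgZ.
  all: try exact: intg_cst.
  apply: Ex_le => //; first by apply: intgD; [exact: intg_cst|apply: intgD; exact: intgZ].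
  move=> w; rewrite -/t.
  have -> : C * t / 2 = a^-1 / 2 by rewrite /a invrK.
  rewrite [(_ \o _) w]/=; set x := F n w.
  have [xK|Kx] := leP `|x| K.
    rewrite -(real_normK (num_real x)); apply: (@le_trans _ _ (K ^+ 2)).
      by rewrite lerXn2r ?nnegrE// ltW.
    have a2 : 0 <= a / 2 by rewrite divr_ge0// ltW.
    have b2 : 0 <= a^-1 / 2 by rewrite divr_ge0// invr_ge0 ltW.
    rewrite lerDl; apply: addr_ge0; apply: mulr_ge0 => //.
    exact: exprn_even_ge0.
  have phi1 : phi (clamp K x) = 1.
    rewrite /phi -(real_normK (num_real (clamp K x))).
    suff -> : `|clamp K x| = K by rewrite divff// gt_eqF.
    apply/eqP; rewrite eq_le clamp_norm ?(ltW K0)//= /clamp /Num.max /Num.min.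
    move: Kx; rewrite ltr_normr => /orP[Kx|xK].
      by rewrite Kx; case: ltP => [_|]; [rewrite gtr0_norm|move: K0; lra].
    have xnK : x < - K by rewrite ltrNr.
    have -> : (K < x) = false by apply/negbTE; rewrite -leNgt; move: K0; lra.
    have -> : (- K < x) = false by apply/negbTE; rewrite -leNgt ltW.
    by rewrite normrN gtr0_norm.
  rewrite phi1 mulr1; apply: (@le_trans _ _ (a / 2 * x ^+ 4 + a^-1 / 2)); last by rewrite lerDr ltW.
  have -> : x ^+ 4 = x ^+ 2 * x ^+ 2 by ring.
  rewrite -subr_ge0; have := sqr_ge0 (a * x ^+ 2 - 1).
  have -> : a / 2 * (x ^+ 2 * x ^+ 2) + a^-1 / 2 - x ^+ 2 = (a * x ^+ 2 - 1) ^+ 2 / (2 * a).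
    by field; rewrite gt_eqF.
  by move=> h; rewrite divr_ge0// mulr_ge0// ltW.
have h1 : a / 2 * Ex P (fun w => F n w ^+ 4) <= t / 2.
  apply: le_trans (ler_wpM2l _ (hC n)) _; first by rewrite divr_ge0// ltW.
  rewrite -/t /a le_eqVlt; apply/orP; left; apply/eqP; field.
  by rewrite tn0 gt_eqF.
have h2 : C * t / 2 * e <= t / 4.
  apply: le_trans (ler_wpM2l _ he) _; first by rewrite divr_ge0// mulr_ge0// ltW.
  rewrite le_eqVlt; apply/orP; left; apply/eqP; field.
  by rewrite gt_eqF.
by move: h1 h2; lra.
Qed.

(** Truncation at level K costs O(1 / K^2) times an even moment of higher order, uniformly for large
    n; the truncated function is covered by [clamp_cvg]. *)
Lemma growth_cvg (F : nat -> T -> R) (phi : R -> R) (c : R) (m : nat) :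
  (forall n, tame P (F n)) -> clamp_cvg F ->
  (forall k, exists B, \forall n \near \oo, Ex P (fun w => F n w ^+ (2 * k)) <= B) ->
  continuous phi -> (forall x, `|phi x| <= c * (1 + x ^+ (2 * m))) ->
  Ex P (phi \o F n) @[n --> \oo] --> Ex Q (phi \o Z).
Proof.
move=> tF hF hB cphi hphi.
have even0 k (x : R) : 0 <= x ^+ (2 * k) by rewrite exprM exprn_ge0// sqr_ge0.
have c0 : 0 <= c.
  have h0 : 0 < 1 + 0 ^+ (2 * m) :> R by have := even0 m 0; lra.
  by have := le_trans (normr_ge0 _) (hphi 0); rewrite pmulr_lge0.
(* D x = x^2 (1 + x^(2m)), so 1 + x^(2m) <= D x / K^2 as soon as |x| > K. *)
pose D (x : R) := x ^+ (2 * 1) + x ^+ (2 * m.+1).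
have [B1 hB1] := hB 1%N; have [B2 hB2] := hB m.+1.
pose BZ := Ex Q (D \o Z).
have mphi : measurable_fun setT phi by exact: continuous_measurable_fun.
have gen d0 (T0 : measurableType d0) (P0 : probability T0 R) (G : T0 -> R) K : tame P0 G -> 0 < K ->
    `|Ex P0 (phi \o G) - Ex P0 (phi \o clamp K \o G)| <= 2 * c / K ^+ 2 * Ex P0 (D \o G).
  move=> tG K0; have [mG iG] := tG.
  have [M _ hM] := clamp_bounded cphi K0.
  rewrite -[leRHS]add0r; apply: Ex_close.
  - apply: (@le_intg _ _ _ P0 (fun w => c * (1 + G w ^+ (2 * m)))).
    + exact: measurableT_comp.
    + by apply: intgZ; apply: intgD => //; exact: intg_cst.
    + by move=> w; apply: le_trans (hphi _) (ler_norm _).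
  - apply: (@intg_bounded _ _ _ P0 _ M) => [|w]; last exact: hM.
    apply: measurableT_comp => //; apply: continuous_measurable_fun.
    exact: clamp_comp_continuous.
  - exact: intgD.
  move=> w /=; set x := G w; rewrite add0r.
  have [xK|Kx] := leP `|x| K.
    rewrite clamp_id// subrr normr0 mulr_ge0//.
      by apply: divr_ge0; [exact: mulr_ge0|exact: sqr_ge0].
    by apply: addr_ge0; exact: even0.
  have clx : clamp K x ^+ (2 * m) <= x ^+ (2 * m).
    rewrite !exprM lerXn2r ?nnegrE ?sqr_ge0// -(real_normK (num_real (clamp K x))) -(real_normK (num_real x)).
    rewrite lerXn2r ?nnegrE//; apply: le_trans (clamp_norm _ (ltW K0)) (ltW Kx).
  apply: (@le_trans _ _ (2 * c * (1 + x ^+ (2 * m)))).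
    apply: le_trans (ler_normB _ _) _.
    rewrite (_ : 2 * c * (1 + _) = c * (1 + x ^+ (2 * m)) + c * (1 + x ^+ (2 * m))); last by ring.
    apply: lerD; first exact: hphi.
    by apply: le_trans (hphi _) _; rewrite ler_wpM2l// lerD2l.
  rewrite -[leRHS]mulrA ler_wpM2l ?mulr_ge0//.
  have -> : D x = x ^+ 2 * (1 + x ^+ (2 * m)) by rewrite /D muln1 mulnS exprD; ring.
  rewrite mulrC ler_pdivlMr ?exprn_gt0// mulrC; apply: ler_wpM2r; first exact: addr_ge0.
  by rewrite -(real_normK (num_real x)) lerXn2r ?nnegrE// ltW.
apply/cvgrPdist_le => eps e0.
have e3 : 0 < eps / 3 by rewrite divr_gt0.
(* Solves 2 c b / K^2 <= eps / 3 for all three moment bounds b at once; the final 1 keeps K positive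
   when c = 0. *)
pose K := Num.sqrt (6 * c * (`|BZ| + `|B1| + `|B2| + 1) / eps + 1).
have K2 : K ^+ 2 = 6 * c * (`|BZ| + `|B1| + `|B2| + 1) / eps + 1.
  by rewrite sqr_sqrtr// addr_ge0// divr_ge0 ?(ltW e0)// !mulr_ge0// !addr_ge0.
have K20 : 0 < K ^+ 2.
  by rewrite K2 ltr_wpDl// divr_ge0 ?(ltW e0)// !mulr_ge0// !addr_ge0.
have K0 : 0 < K.
  by rewrite lt_neqAle sqrtr_ge0 andbT eq_sym; apply: contraTneq K20 => ->; rewrite expr0n ltxx.
have small b : b <= `|BZ| + `|B1| + `|B2| -> 2 * c / K ^+ 2 * b <= eps / 3.
  move=> hb; rewrite mulrAC ler_pdivrMr// K2.
  have -> : eps / 3 * (6 * c * (`|BZ| + `|B1| + `|B2| + 1) / eps + 1) =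
     2 * c * (`|BZ| + `|B1| + `|B2| + 1) + eps / 3 by field; rewrite gt_eqF.
  rewrite -[leLHS]addr0; apply: lerD; last exact: ltW.
  by rewrite ler_wpM2l ?mulr_ge0//; lra.
have /cvgrPdist_le/(_ _ e3) hK := hF K phi K0 cphi.
near=> n.
have h1 : `|Ex Q (phi \o clamp K \o Z) - Ex P (phi \o clamp K \o F n)| <= eps / 3 by near: n.
have h2 := gen _ _ Q Z K Zt K0.
have h3 := gen _ _ P (F n) K (tF n) K0.
have b1 : Ex P (fun w => F n w ^+ (2 * 1)) <= B1 by near: n.
have b2 : Ex P (fun w => F n w ^+ (2 * m.+1)) <= B2 by near: n.
have h2' := le_trans h2 (small _ _); have h3' := le_trans h3 (small _ _).
have {h2'}h2' : `|Ex Q (phi \o Z) - Ex Q (phi \o clamp K \o Z)| <= eps / 3.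
  by apply: h2'; rewrite -/BZ; have := ler_norm BZ; have := normr_ge0 B1; have := normr_ge0 B2; lra.
have {h3'}h3' : `|Ex P (phi \o F n) - Ex P (phi \o clamp K \o F n)| <= eps / 3.
  apply: h3'; have [_ iF] := tF n.
  have -> : Ex P (D \o F n) = Ex P (fun w => F n w ^+ (2 * 1)) + Ex P (fun w => F n w ^+ (2 * m.+1)).
    by rewrite -ExD.
  by have := ler_norm B1; have := ler_norm B2; have := normr_ge0 BZ; lra.
move: h1 h2' h3'; rewrite !ler_norml => /andP[? ?] /andP[? ?] /andP[? ?].
by apply/andP; split; lra.
Unshelve. all: by end_near. Qed.
End weak_convergence.

(** * Mixing *)

(** Orthogonal projection onto the closure of S, without completeness of L2: a q whose squared
    distance to G is within eps of the infimum is already almost orthogonal to S. *)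
Lemma almost_projection (R : realType) (d : measure_display) (T : measurableType d)
    (P : probability T R) (S : (T -> R) -> Prop) (G : T -> R) (eps : R) :
  S (fun=> 0) -> (forall q, S q -> L2 P q) ->
  (forall a q r, S q -> S r -> S (fun w => q w + a * r w)) ->
  L2 P G -> 0 < eps ->
  exists2 q, S q & forall v, S v ->
    Ex P (fun w => (G w - q w) * v w) ^+ 2 <= eps * Ex P (fun w => v w ^+ 2).
Proof.
move=> S0 SL2 SD hG e0.
pose E := [set Ex P (fun w => (G w - q w) ^+ 2) | q in S].
have E0 : E !=set0 by exists (Ex P (fun w => (G w - 0) ^+ 2)), (fun=> 0).
have lbE : lbound E 0 by move=> _ [q _ <-]; apply: Ex_ge0 => w; exact: sqr_ge0.
have hE : has_inf E by split => //; exists 0.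
have [_ [q Sq <-] hq] := inf_adherent e0 hE.
(* Moving from q to q + t v lowers the squared distance by at most eps, for every t; the
   discriminant of this quadratic in t is the claim. *)
exists q => // v Sv; rewrite -sqrrN; apply: discriminant_le0 => t.
have Sqv := SD t _ _ Sq Sv.
have h : inf E <= Ex P (fun w => (G w - (q w + t * v w)) ^+ 2).
  by apply: ge_inf; [exists 0|exists (fun w => q w + t * v w)].
have hGq : L2 P (fun w => G w - q w) by apply: L2B => //; exact: SL2.
have hv := SL2 _ Sv; have hGv := L2_prod hGq hv.
have EE : Ex P (fun w => (G w - (q w + t * v w)) ^+ 2) =
    Ex P (fun w => (G w - q w) ^+ 2) - 2 * t * Ex P (fun w => (G w - q w) * v w)
    + t ^+ 2 * Ex P (fun w => v w ^+ 2).
  rewrite -!ExZ//; [|by case: hv].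
  rewrite -ExB; [|by case: hGq|exact: intgZ].
  rewrite -ExD; [|by apply: intgB; [case: hGq|exact: intgZ]|by apply: intgZ; case: hv].
  by congr Ex; apply/funext => w; ring.
by move: h; rewrite EE; lra.
Qed.

Section mixing.
Context (R : realType) (d : measure_display) (T : measurableType d).
Variable P : probability T R.
Context (H : hilbertType R) (W : H -> {RV P >-> R}).
Hypothesis W_iso : isonormal W.
Variables (s : R) (s_gt0 : 0 < s).
Local Notation RR := (measurableTypeR R).
Local Notation gam := (normal_prob 0 s : probability RR R).
Local Notation Z := (fun x : RR => x : R).
Variables (p : nat) (p_gt1 : (1 < p)%N).
Variables (m : nat -> nat) (c : forall n, 'I_(m n) -> R) (h : forall n, 'I_(m n) -> H).
Arguments c : clear implicits.
Arguments h : clear implicits.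
Hypothesis h1 : forall n i, `|h n i| = 1.
Arguments h1 : clear implicits.
Let F n := hermite_sum W p (c n) (h n).
Hypothesis F_cvg : clamp_cvg P gam Z F.

Let tF n : tame P (F n). Proof. exact: hermite_sum_tame. Qed.
Let Zt : tame gam Z. Proof. exact: normal_tame. Qed.

Local Notation zeta a := (Ex gam (fun x : RR => x ^+ a : R)).

Lemma hermite_sum_hyper n k : Ex P (fun w => F n w ^+ (2 * k.+1)) <=
  (2 * k%:R + 1) ^+ (p * k.+1) * Ex P (fun w => F n w ^+ 2) ^+ k.+1.
Proof.
(* [hermite_sum_calculus] asks for a unit vector. If H has none, the sum is empty and F n = 0. *)
have [h0 | m0] := pselect (exists g : H, `|g| = 1).
  by case: h0 => g g1; have [+ _] := @hermite_sum_calculus _ _ _ P H W W_iso p _ (c n) (h n) g [::] (h1 n) g1; exact.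
have F0 : F n = fun=> 0.
  apply/funext => w; rewrite /F /hermite_sum big1// => i _.
  by exfalso; apply: m0; exists (h n i).
by rewrite F0; under eq_fun do rewrite expr0n /=; rewrite Ex_cst expr0n /= Ex_cst expr0n mulr0.
Qed.

(** The comparison of fourth and second moments, with constant 3^(2p), bounds the second moments;
    hypercontractivity then bounds all even ones. *)
Lemma hermite_sum_moments_bounded k :
  exists B, \forall n \near \oo, Ex P (fun w => F n w ^+ (2 * k)) <= B.
Proof.
case: k => [|k].
  by exists 1; apply: nearW => n; under eq_fun do rewrite muln0 expr0; rewrite Ex_cst.
have C0 : 0 < (2 * 1 + 1) ^+ (p * 2) :> R by rewrite exprn_gt0// addr_gt0.
have [B hB] := @clamp_cvg_second_moment _ _ _ P _ _ gam Z Zt F _ C0 tF (fun n => hermite_sum_hyper n 1) F_cvg.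
exists ((2 * k%:R + 1) ^+ (p * k.+1) * B ^+ k.+1).
apply: filterS hB => n hB; apply: le_trans (hermite_sum_hyper n k) _.
rewrite ler_wpM2l ?exprn_ge0 ?addr_ge0 ?mulr_ge0//.
have E0 : 0 <= Ex P (fun w => F n w ^+ 2) by apply: Ex_ge0 => w; exact: sqr_ge0.
by rewrite lerXn2r ?nnegrE// (le_trans E0).
Qed.

Lemma hermite_sum_moments_cvg a : Ex P (fun w => F n w ^+ a) @[n --> \oo] --> zeta a.
Proof.
apply: (@growth_cvg _ _ _ P _ _ gam Z Zt F (fun x => x ^+ a) 1 a) => //.
- exact: hermite_sum_moments_bounded.
- exact: exprn_continuous.
move=> x; rewrite mul1r normrX mulnC exprM -normrX.
rewrite -(real_normK (num_real (x ^+ a))); set y := `|x ^+ a|.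
by have := sqr_ge0 (y - 1); have := normr_ge0 (x ^+ a); rewrite -/y; nra.
Qed.

Lemma zeta_fourth : zeta 4 = 3 * zeta 2 ^+ 2.
Proof.
have z0 : zeta 0 = 1 by under eq_fun do rewrite expr0; exact: Ex_cst.
have := normal_moment_rec s_gt0 1; have := normal_moment_rec s_gt0 3; rewrite /= z0 => -> ->.
by ring.
Qed.

Lemma wick_sum_all (Q : pred H) g t : all Q t -> all (fun ct => all Q ct.2) (wick_sum g t).
Proof.
elim: t => //= x t IH /andP[Qx Qt]; rewrite Qt /= all_map.
by apply: sub_all (IH Qt) => ct /= ->; rewrite Qx.
Qed.

Lemma mixing_Wprod (t : seq H) : all (fun g => `|g| == 1) t -> forall a,
  Ex P (fun w => F n w ^+ a * Wprod W t w) @[n --> \oo] --> zeta a * Ex P (Wprod W t).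
Proof.
have [k] := ubnP (size t); elim: k t => // k IH [|g t] /= tk ht a.
  rewrite (_ : Wprod W [::] = fun=> 1); last by apply/funext => w; rewrite /Wprod big_nil.
  rewrite Ex_cst mulr1; under eq_fun do under eq_fun do rewrite mulr1.
  exact: hermite_sum_moments_cvg.
case/andP: ht => /eqP g1 ht.
have /choice[DF hDF] : forall n, exists DF, [/\ tame P DF,
    Ex P (fun w => DF w ^+ 2) ^+ 2 <= p%:R *
      (Ex P (fun w => F n w ^+ 4) - 3 * Ex P (fun w => F n w ^+ 2) ^+ 2) &
    forall a, Ex P (fun w => F n w ^+ a * Wprod W (g :: t) w) =
     \sum_(ct <- wick_sum g t) ct.1 * Ex P (fun w => F n w ^+ a * Wprod W ct.2 w)
     + a%:R * Ex P (fun w => F n w ^+ a.-1 * DF w * Wprod W t w)].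
  move=> n; have [_] := @hermite_sum_calculus _ _ _ P H W W_iso p _ (c n) (h n) g t (h1 n) g1.
  exact.
(* The integration by parts at a = 0 is Wick's recursion for the limit. *)
have EWp : Ex P (Wprod W (g :: t)) = \sum_(ct <- wick_sum g t) ct.1 * Ex P (Wprod W ct.2).
  have [_ _ /(_ 0%N)] := hDF 0%N; rewrite mul0r addr0.
  have E u : Ex P (fun w => F 0%N w ^+ 0 * Wprod W u w) = Ex P (Wprod W u).
    by congr Ex; apply/funext => w; rewrite expr0 mul1r.
  by rewrite E => ->; apply: eq_bigr => ct _; rewrite E.
(* The bound on DF is p times the fourth cumulant of F n, which tends to that of the normal law,
   namely 0. *)
have DF2 : Ex P (fun w => DF n w ^+ 2) @[n --> \oo] --> (0 : R).
  have lim0 : p%:R * (Ex P (fun w => F n w ^+ 4) - 3 * Ex P (fun w => F n w ^+ 2) ^+ 2) @[n --> \oo] --> (0 : R).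
    have -> : (0 : R) = p%:R * (zeta 4 - 3 * zeta 2 ^+ 2) by rewrite zeta_fourth subrr mulr0.
    apply: cvgM; first exact: cvg_cst.
    apply: cvgB; first exact: hermite_sum_moments_cvg.
    apply: cvgM; first exact: cvg_cst.
    by rewrite expr2; under eq_fun do rewrite expr2; apply: cvgM; exact: hermite_sum_moments_cvg.
  apply/cvgrPdist_le => eps e0.
  have /cvgrPdist_le/(_ (eps ^+ 2)) := lim0; rewrite exprn_gt0// => /(_ isT).
  apply: filterS => n; rewrite !sub0r !normrN => hn.
  have [_ h2 _] := hDF n.
  have D0 : 0 <= Ex P (fun w => DF n w ^+ 2) by apply: Ex_ge0 => w; exact: sqr_ge0.
  rewrite ger0_norm// -(@ler_pXn2r _ 2)// ?nnegrE// ?(ltW e0)//.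
  exact: le_trans h2 (le_trans (ler_norm _) hn).
have tWt : tame P (Wprod W t) by exact: Wprod_tame.
have rest : Ex P (fun w => F n w ^+ a.-1 * DF n w * Wprod W t w) @[n --> \oo] --> (0 : R).
  (* Cauchy-Schwarz isolates DF. The square of the other factor is at most F^(4(a-1)) plus the
     fourth power of the product, hence this index. *)
  have [B hB] := hermite_sum_moments_bounded (a.-1 + a.-1).
  pose C := `|B| + Ex P (fun w => Wprod W t w ^+ 4) + 1.
  have W4 : 0 <= Ex P (fun w => Wprod W t w ^+ 4) by apply: Ex_ge0 => w; exact: exprn_even_ge0.
  have C0 : 0 < C by rewrite ltr_wpDl// addr_ge0.
  apply/cvgrPdist_le => eps e0.
  have /cvgrPdist_le/(_ (eps ^+ 2 / C)) := DF2; rewrite divr_gt0 ?exprn_gt0// => /(_ isT).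
  apply: filterS2 hB => n hB; rewrite !sub0r !normrN.
  have D0 : 0 <= Ex P (fun w => DF n w ^+ 2) by apply: Ex_ge0 => w; exact: sqr_ge0.
  rewrite ger0_norm// ler_pdivlMr// => hD.
  have [tD _ _] := hDF n.
  have tFa : tame P (fun w => F n w ^+ a.-1 * Wprod W t w) by apply: tameM => //; exact: tameX.
  rewrite -(@ler_pXn2r _ 2)// ?nnegrE// ?(ltW e0)// real_normK ?num_real//.
  have -> : Ex P (fun w => F n w ^+ a.-1 * DF n w * Wprod W t w) =
      Ex P (fun w => (F n w ^+ a.-1 * Wprod W t w) * DF n w).
    by congr Ex; apply/funext => w; ring.
  apply: le_trans (Ex_cauchy_schwarz (tame_L2 tFa) (tame_L2 tD)) _.
  apply: le_trans hD; rewrite mulrC ler_wpM2l//.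
  apply: (@le_trans _ _ (Ex P (fun w => F n w ^+ (2 * (a.-1 + a.-1)) + Wprod W t w ^+ 4))).
    apply: Ex_le.
    - by have [_ ->] := tFa.
    - by apply: intgD; [have [_ ->] := tF n|have [_ ->] := tWt].
    move=> w; rewrite exprMn -!exprM.
    have -> : F n w ^+ (2 * (a.-1 + a.-1)) = (F n w ^+ (a.-1 * 2)) ^+ 2.
      by rewrite -exprM; congr (_ ^+ _); rewrite mulnC addnn -muln2.
    have -> : Wprod W t w ^+ 4 = (Wprod W t w ^+ 2) ^+ 2 by rewrite -exprM.
    set x := F n w ^+ _; set y := Wprod W t w ^+ 2.
    by have := sqr_ge0 (x - y); have := sqr_ge0 x; have := sqr_ge0 y; nra.
  rewrite ExD; [|by have [_ ->] := tF n|by have [_ ->] := tWt].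
  by have := ler_norm B; rewrite /C; move: hB; lra.
have -> : (fun n => Ex P (fun w => F n w ^+ a * Wprod W (g :: t) w)) = fun n =>
    \sum_(ct <- wick_sum g t) ct.1 * Ex P (fun w => F n w ^+ a * Wprod W ct.2 w) +
    a%:R * Ex P (fun w => F n w ^+ a.-1 * DF n w * Wprod W t w).
  by apply/funext => n; have [_ _ ->] := hDF n.
have -> : zeta a * Ex P (Wprod W (g :: t)) =
    \sum_(ct <- wick_sum g t) zeta a * (ct.1 * Ex P (Wprod W ct.2)) + 0.
  by rewrite EWp mulr_sumr addr0.
apply: cvgD; last first.
  by rewrite -(mulr0 (a%:R : R)); apply: cvgM => //; exact: cvg_cst.
have hall := wick_sum_all g ht; have hsz := size_wick_sum g t.
elim: (wick_sum g t) hall hsz => [|ct r IHr] /=.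
  move=> _ _; rewrite big_nil (_ : (fun n => _) = fun=> 0); first exact: cvg_cst.
  by apply/funext => n; rewrite big_nil.
case/andP=> ha1 ha2 /andP[hs1 hs2]; rewrite big_cons.
have -> : (fun n => \sum_(ct <- ct :: r) ct.1 * Ex P (fun w => F n w ^+ a * Wprod W ct.2 w)) =
  fun n => ct.1 * Ex P (fun w => F n w ^+ a * Wprod W ct.2 w) +
    \sum_(ct <- r) ct.1 * Ex P (fun w => F n w ^+ a * Wprod W ct.2 w).
  by apply/funext => n; rewrite big_cons.
apply: cvgD; last exact: IHr.
rewrite mulrCA; apply: cvgM; first exact: cvg_cst.
by apply: IH => //; apply: ltn_trans hs1 _; exact: tk.
Qed.

(** Lists of unit vectors, as in [mixing_Wprod]; concatenation of lists gives stability under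
    products. *)
Definition polynomial_variable (q : T -> R) := exists l : seq (R * seq H),
  all (fun bs => all (fun g => `|g| == 1) bs.2) l /\
  q = fun w => \sum_(bs <- l) bs.1 * Wprod W bs.2 w.

Lemma polynomial_variable_cst b : polynomial_variable (fun=> b).
Proof.
exists [:: (b, [::])]; split=> //; apply/funext => w.
by rewrite big_seq1 /Wprod big_nil mulr1.
Qed.

Lemma polynomial_variableD a q r : polynomial_variable q -> polynomial_variable r ->
  polynomial_variable (fun w => q w + a * r w).
Proof.
move=> [l [hl ->]] [k [hk ->]]; exists (l ++ [seq (a * bs.1, bs.2) | bs <- k]).
split; first by rewrite all_cat hl all_map.
apply/funext => w; rewrite big_cat big_map mulr_sumr /=; congr (_ + _).
by apply: eq_bigr => bs _; rewrite mulrA.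
Qed.

Lemma polynomial_variableM q r : polynomial_variable q -> polynomial_variable r ->
  polynomial_variable (fun w => q w * r w).
Proof.
move=> [l [hl ->]] [k [hk ->]].
exists [seq (x.1 * y.1, x.2 ++ y.2) | x <- l, y <- k]; split.
  apply/allP => _ /allpairsP[[x y] [/= xl yk ->]] /=.
  by rewrite all_cat (allP hl _ xl) (allP hk _ yk).
apply/funext => w; rewrite big_allpairs_dep mulr_suml; apply: eq_bigr => x _.
rewrite mulr_sumr; apply: eq_bigr => y _ /=.
by rewrite /Wprod big_cat /=; ring.
Qed.

Lemma polynomial_variableX q a : polynomial_variable q -> polynomial_variable (fun w => q w ^+ a).
Proof.
move=> hq; elim: a => [|a IH].
  by under eq_fun do rewrite expr0; exact: polynomial_variable_cst.
by under eq_fun do rewrite exprS; exact: polynomial_variableM.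
Qed.

Lemma polynomial_variable_sum (J : Type) (r : seq J) (q : J -> T -> R) :
  (forall j, polynomial_variable (q j)) -> polynomial_variable (fun w => \sum_(j <- r) q j w).
Proof.
move=> hq; elim: r => [|j r IH].
  by under eq_fun do rewrite big_nil; exact: polynomial_variable_cst.
under eq_fun do rewrite big_cons -[X in _ + X]mul1r.
exact: polynomial_variableD.
Qed.

Lemma polynomial_variableZ b q : polynomial_variable q -> polynomial_variable (fun w => b * q w).
Proof. by move=> hq; apply: polynomial_variableM => //; exact: polynomial_variable_cst. Qed.

Lemma polynomial_variable_tame q : polynomial_variable q -> tame P q.
Proof.
by move=> [l [_ ->]]; apply: tame_sum => bs; apply: tameZ; exact: Wprod_tame.
Qed.

Lemma polynomial_variable_hermite_sum n : polynomial_variable (F n).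
Proof.
apply: polynomial_variable_sum => i; apply: polynomial_variableZ.
under eq_fun do rewrite horner_coef.
apply: polynomial_variable_sum => j; apply: polynomial_variableZ.
apply: polynomial_variableX; exists [:: (1, [:: h n i])]; split; first by rewrite /= h1 eqxx.
by apply/funext => w; rewrite big_seq1 /Wprod big_seq1 mul1r.
Qed.

Lemma mixing_polynomial q a : polynomial_variable q ->
  Ex P (fun w => F n w ^+ a * q w) @[n --> \oo] --> zeta a * Ex P q.
Proof.
move=> [l [+ ->]]; elim: l => [_|[b t] l IH /= /andP[ht hl]].
  have -> : (fun w => \sum_(bs <- [::]) bs.1 * Wprod W bs.2 w) = fun=> 0.
    by apply/funext => w; rewrite big_nil.
  rewrite Ex_cst mulr0 (_ : (fun n => _) = fun=> 0); first exact: cvg_cst.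
  by apply/funext => n; under eq_fun do rewrite big_nil mulr0; exact: Ex_cst.
have tl : tame P (fun w => \sum_(bs <- l) bs.1 * Wprod W bs.2 w).
  by apply: tame_sum => bs; apply: tameZ; exact: Wprod_tame.
have tt := Wprod_tame W_iso t.
have E (f : T -> R) : tame P f -> Ex P (fun w => f w * \sum_(bs <- (b, t) :: l) bs.1 * Wprod W bs.2 w) =
    b * Ex P (fun w => f w * Wprod W t w) + Ex P (fun w => f w * \sum_(bs <- l) bs.1 * Wprod W bs.2 w).
  move=> tf; rewrite -ExZ; last by apply: tame_intg; exact: tameM.
  rewrite -ExD; [|by apply: intgZ; apply: tame_intg; exact: tameM|by apply: tame_intg; exact: tameM].
  by congr Ex; apply/funext => w; rewrite big_cons /=; ring.
have -> : zeta a * Ex P (fun w => \sum_(bs <- (b, t) :: l) bs.1 * Wprod W bs.2 w) =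
    b * (zeta a * Ex P (Wprod W t)) + zeta a * Ex P (fun w => \sum_(bs <- l) bs.1 * Wprod W bs.2 w).
  have one (f : T -> R) : Ex P (fun w => 1 * f w) = Ex P f.
    by congr Ex; apply/funext => w; rewrite mul1r.
  by have := E (fun=> 1) (tame_cst P 1); rewrite !one => ->; ring.
have -> : (fun n => Ex P (fun w => F n w ^+ a * \sum_(bs <- (b, t) :: l) bs.1 * Wprod W bs.2 w)) =
  fun n => b * Ex P (fun w => F n w ^+ a * Wprod W t w) +
    Ex P (fun w => F n w ^+ a * \sum_(bs <- l) bs.1 * Wprod W bs.2 w).
  by apply/funext => n; apply: E; exact: tameX.
by apply: cvgD; [apply: cvgM; [exact: cvg_cst|exact: mixing_Wprod]|exact: IH].
Qed.

(* Powers of F n are themselves polynomial variables, so only the projection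
   of G on the closure of the polynomial variables matters. *)
Lemma mixing_L2 (G : T -> R) a : L2 P G ->
  Ex P (fun w => F n w ^+ a * G w) @[n --> \oo] --> zeta a * Ex P G.
Proof.
move=> hG; apply/cvgrPdist_le => eps e0.
have [B hB] := hermite_sum_moments_bounded a.
(* Large enough to absorb both E F^(2a) and the squared limit moment, the factors that multiply the
   projection error. *)
pose C := `|B| + zeta a ^+ 2 + 1; have C0 : 0 < C by rewrite ltr_wpDl// addr_ge0// sqr_ge0.
have e3 : 0 < eps / 3 by rewrite divr_gt0.
pose dl := (eps / 3) ^+ 2 / C.
have dl0 : 0 < dl by rewrite divr_gt0// exprn_gt0.
have pL2 q : polynomial_variable q -> L2 P q.
  by move=> /polynomial_variable_tame; exact: tame_L2.
have [q pq hq] := almost_projection (polynomial_variable_cst 0) pL2 polynomial_variableD hG dl0.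
have /cvgrPdist_le/(_ _ e3) := @mixing_polynomial q a pq.
apply: filterS2 hB => n hB.
have hGq : L2 P (fun w => G w - q w) by apply: L2B => //; exact: pL2.
have tFa := tameX a (tF n).
have sq_le (x y : R) : 0 <= y -> x ^+ 2 <= y ^+ 2 -> `|x| <= y.
  by move=> y0 xy; rewrite -(@ler_pXn2r _ 2)// ?nnegrE// real_normK ?num_real.
have k1 : `|Ex P (fun w => F n w ^+ a * G w) - Ex P (fun w => F n w ^+ a * q w)| <= eps / 3.
  have -> : Ex P (fun w => F n w ^+ a * G w) - Ex P (fun w => F n w ^+ a * q w) =
      Ex P (fun w => (G w - q w) * F n w ^+ a).
    rewrite -ExB; [|by apply: L2_prod => //; exact: tame_L2|by apply: L2_prod; [exact: tame_L2|exact: pL2]].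
    by congr Ex; apply/funext => w; ring.
  apply: sq_le; first exact: ltW.
  apply: le_trans (hq _ (@polynomial_variableX _ a (polynomial_variable_hermite_sum n))) _.
  have -> : (fun w => (F n w ^+ a) ^+ 2) = (fun w => F n w ^+ (2 * a)).
    by apply/funext => w; rewrite -exprM mulnC.
  rewrite /dl mulrAC ler_pdivrMr// ler_wpM2l ?sqr_ge0//.
  apply: le_trans hB _; apply: le_trans (ler_norm B) _.
  by rewrite /C -addrA lerDl addr_ge0 ?sqr_ge0.
have k2 : `|zeta a * Ex P G - zeta a * Ex P q| <= eps / 3.
  have -> : zeta a * Ex P G - zeta a * Ex P q = zeta a * Ex P (fun w => (G w - q w) * 1).
    have -> : (fun w => (G w - q w) * 1) = (fun w => G w - q w).
      by apply/funext => w; rewrite mulr1.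
    by rewrite ExB ?mulrBr//; [exact: L2_intg|apply: L2_intg; exact: pL2].
  apply: sq_le; first exact: ltW.
  (* The constant 1 is a polynomial variable, so the near-orthogonality of G - q also controls E G -
     E q. *)
  rewrite exprMn; apply: le_trans (ler_wpM2l (sqr_ge0 _) (hq _ (polynomial_variable_cst 1))) _.
  rewrite expr1n Ex_cst mulr1 mulrC /dl mulrAC ler_pdivrMr// ler_wpM2l ?sqr_ge0//.
  by rewrite /C (addrC `|B|) -addrA lerDl addr_ge0.
set x1 := zeta a * Ex P G in k2 *; set x2 := zeta a * Ex P q in k2 *.
move: k1 k2 => + + k3; rewrite (splitr eps).
move: k3; set x3 := Ex P (fun w => F n w ^+ a * q w); set x4 := Ex P (fun w => F n w ^+ a * G w).
clearbody x1 x2 x3 x4; rewrite -splitr !ler_norml => /andP[? ?] /andP[? ?] /andP[? ?].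
by apply/andP; split; lra.
Qed.
End mixing.

(** * Polynomial approximation *)

(** De Casteljau's recursion: the mean of phi over a binomial variable, conditioned on its first
    trial. No binomial coefficients occur. *)
Fixpoint bernstein (R : realType) (n : nat) (phi : nat -> R) : {poly R} :=
  if n is k.+1 then (1 - 'X) * bernstein k phi + 'X * bernstein k (fun j => phi j.+1)
  else (phi 0%N)%:P.

(** The second moment of the binomial law about a is n t (1 - t) plus the squared bias. A success
    moves the center from a to a - 1, so the induction needs arbitrary a. *)
Lemma bernstein_bound (R : realType) n (phi : nat -> R) (v a e C t : R) : 0 <= t <= 1 ->
  (forall k, (k <= n)%N -> `|phi k - v| <= e + C * (k%:R - a) ^+ 2) ->
  `|(bernstein n phi).[t] - v| <= e + C * (n%:R * t * (1 - t) + (n%:R * t - a) ^+ 2).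
Proof.
move=> /andP[t0 t1]; elim: n phi a => [|n IH] phi a h.
  by rewrite /= hornerC; have := h 0%N (leqnn _); rewrite !mulr0n !mul0r !add0r.
have h1 := IH phi a (fun k kn => h k (leqW kn)).
have h2 : `|(bernstein n (fun j => phi j.+1)).[t] - v| <=
    e + C * (n%:R * t * (1 - t) + (n%:R * t - (a - 1)) ^+ 2).
  apply: IH => k kn; apply: le_trans (h k.+1 kn) _.
  by rewrite -natr1 opprB addrA addrAC.
rewrite /= !hornerE.
set x := (bernstein n phi).[t] in h1 *; set y := (bernstein n _).[t] in h2 *.
have -> : (1 - t) * x + t * y - v = (1 - t) * (x - v) + t * (y - v) by ring.
apply: le_trans (ler_normD _ _) _; rewrite !normrM (ger0_norm t0) ger0_norm ?subr_ge0//.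
apply: le_trans (lerD (ler_wpM2l _ h1) (ler_wpM2l t0 h2)) _; first by rewrite subr_ge0.
by rewrite -natr1 le_eqVlt; apply/orP; left; apply/eqP; ring.
Qed.

(** The bound by M on the polynomial is recorded because it is used where f no longer represents the
    target function. *)
Lemma weierstrass (R : realType) (f : R -> R) (M e : R) : continuous f -> 0 < M ->
  (forall t, `|f t| <= M) -> 0 < e ->
  exists p : {poly R}, forall t, 0 <= t <= 1 -> `|f t - p.[t]| <= e /\ `|p.[t]| <= M.
Proof.
move=> cf M0 fM e0; have e2 : 0 < e / 2 by rewrite divr_gt0.
have [dl dl0 hdl] := heine cf (@segment_compact R 0 1) e2.
pose C0 := 2 * M / dl ^+ 2.
have C00 : 0 < C0 by rewrite divr_gt0 ?mulr_gt0 ?exprn_gt0.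
have [n n0 hn] : exists2 n : nat, (0 < n)%N & C0 <= e / 2 * n%:R.
  exists (Num.truncn (C0 / (e / 2))).+1 => //.
  by rewrite mulrC -ler_pdivrMr//; apply: ltW; exact: truncnS_gt.
have nR : 0 < n%:R :> R by rewrite ltr0n.
exists (bernstein n (fun k => f (k%:R / n%:R))) => t t01; have /andP[t0 t1] := t01.
split; last first.
  (* With v = 0, e = M and C = 0 the estimate says that averages do not exceed M. *)
  have := @bernstein_bound R n (fun k => f (k%:R / n%:R)) 0 0 M 0 t t01.
  by rewrite !subr0 mul0r addr0; apply => k _; rewrite subr0 mul0r addr0.
rewrite distrC.
have h := @bernstein_bound R n (fun k => f (k%:R / n%:R)) (f t) (n%:R * t) (e / 2) (C0 / n%:R ^+ 2) t t01.
apply: le_trans (h _) _.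
  move=> k kn.
  have -> : C0 / n%:R ^+ 2 * (k%:R - n%:R * t) ^+ 2 = C0 * (t - k%:R / n%:R) ^+ 2.
    by field; rewrite gt_eqF.
  have [tk|kt] := ltP `|t - k%:R / n%:R| dl.
    rewrite distrC; apply: (@le_trans _ _ (e / 2)).
      by apply: hdl; rewrite /= ?in_itv //=.
    by rewrite lerDl mulr_ge0 ?sqr_ge0// ltW.
  apply: (@le_trans _ _ (2 * M)).
    by apply: le_trans (ler_normB _ _) _; have := fM t; have := fM (k%:R / n%:R); lra.
  apply: (@le_trans _ _ (C0 * (t - k%:R / n%:R) ^+ 2)); last by rewrite lerDr ltW.
  rewrite /C0 mulrAC ler_pdivlMr ?exprn_gt0// ler_wpM2l ?mulr_ge0 ?(ltW M0)//.
  by rewrite -(real_normK (num_real (t - _))) lerXn2r// nnegrE// ltW.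
rewrite subrr expr0n addr0 [leRHS]splitr lerD2l.
apply: (@le_trans _ _ (C0 / n%:R)).
  have -> : C0 / n%:R ^+ 2 * (n%:R * t * (1 - t)) = C0 / n%:R * (t * (1 - t)).
    by field; rewrite gt_eqF.
  by rewrite ler_piMr ?divr_ge0 ?(ltW C00)//; nra.
by rewrite ler_pdivrMr.
Qed.

(** * Taylor polynomials of sine and cosine *)

Section trigonometric_partial_sums.
Context (R : realType).
Implicit Types (u x : R).

Definition sin_poly n u : {poly R} := \poly_(i < n) sin_coeff u i.
Definition cos_poly n u : {poly R} := \poly_(i < n) cos_coeff u i.

Lemma sin_polyE n u x : (sin_poly n u).[x] = series (sin_coeff (u * x)) n.
Proof.
rewrite horner_poly /series /= big_mkord; apply: eq_bigr => i _.
by rewrite /sin_coeff /= exprMn; ring.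
Qed.

Lemma cos_polyE n u x : (cos_poly n u).[x] = series (cos_coeff (u * x)) n.
Proof.
rewrite horner_poly /series /= big_mkord; apply: eq_bigr => i _.
by rewrite /cos_coeff /= exprMn; ring.
Qed.

Lemma series_exp_le n x : 0 <= x -> series (exp_coeff x) n <= expR x.
Proof.
move=> x0; apply: nondecreasing_cvgn_le; last exact: is_cvg_series_exp_coeff.
apply/nondecreasing_seqP => k; rewrite /series /= big_nat_recr //= lerDl.
exact: exp_coeff_ge0.
Qed.

(** Termwise domination by the exponential series, uniformly in n: the source of the majorants for
    dominated convergence. *)
Lemma trig_coeff_le (b : nat -> R) n x : (forall i, `|b i| <= 1) ->
  `|\sum_(0 <= i < n) b i * x ^+ i / i`!%:R| <= expR `|x|.
Proof.
move=> hb; apply: le_trans (series_exp_le n (normr_ge0 x)).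
apply: le_trans (ler_norm_sum _ _ _) _; apply: ler_sum => i _.
rewrite /exp_coeff /= !normrM normrV ?unitfE ?pnatr_eq0 -?lt0n ?fact_gt0// normr_nat normrX.
by rewrite ler_wpM2r ?invr_ge0// ler_piMl// exprn_ge0.
Qed.

Lemma sin_poly_le n u x : `|(sin_poly n u).[x]| <= expR `|u * x|.
Proof.
rewrite sin_polyE; apply: (@trig_coeff_le (fun i => (odd i)%:R * (-1) ^ i.-1./2)) => i.
rewrite normrM -exprnP normrX normrN1 expr1n mulr1.
by case: (odd i); rewrite ?normr1 ?normr0.
Qed.

Lemma cos_poly_le n u x : `|(cos_poly n u).[x]| <= expR `|u * x|.
Proof.
rewrite cos_polyE; apply: (@trig_coeff_le (fun i => (~~ odd i)%:R * (-1) ^ i./2)) => i.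
rewrite normrM -exprnP normrX normrN1 expr1n mulr1.
by case: (~~ odd i); rewrite ?normr1 ?normr0.
Qed.

Lemma sin_poly_cvg u x : (sin_poly n u).[x] @[n --> \oo] --> sin (u * x).
Proof.
under eq_fun do rewrite sin_polyE.
by rewrite sin.unlock; exact: is_cvg_series_sin_coeff.
Qed.

Lemma cos_poly_cvg u x : (cos_poly n u).[x] @[n --> \oo] --> cos (u * x).
Proof.
under eq_fun do rewrite cos_polyE.
by rewrite cos.unlock; exact: is_cvg_series_cos_coeff.
Qed.
End trigonometric_partial_sums.

Lemma Ex_dominated (R : realType) (d : measure_display) (T : measurableType d)
    (P : probability T R) (f_ : nat -> T -> R) (f g : T -> R) :
  (forall n, measurable_fun setT (f_ n)) -> measurable_fun setT f ->
  (forall x, f_ n x @[n --> \oo] --> f x) -> intg P g ->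
  (forall n x, `|f_ n x| <= g x) -> Ex P (f_ n) @[n --> \oo] --> Ex P f.
Proof.
move=> mf_ mf cf ig fg.
have [|||||i1 _ h] := @dominated_convergence _ T R P setT measurableT
  (fun n => EFin \o f_ n) (EFin \o f) (EFin \o g).
- by move=> n; exact/measurable_EFinP.
- exact/measurable_EFinP.
- by apply: aeW => x _; apply: cvg_EFin; [exact: nearW|exact: cf].
- exact: ig.
- by apply: aeW => x n _; rewrite lee_fin.
have if_ n : intg P (f_ n).
  apply: (le_intg (mf_ n) ig) => x; exact: le_trans (fg n x) (ler_norm _).
have E n : (\int[P]_x (EFin \o f_ n) x)%E = (Ex P (f_ n))%:E by exact: intg_EFin.
move: h; rewrite (intg_EFin i1) (_ : [sequence _]_n = EFin \o (fun n => Ex P (f_ n))).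
  by move=> /fine_cvgP[].
by apply/funext => n; exact: E.
Qed.

Section gaussian_polynomial_approximation.
Context (R : realType) (s : R).
Hypothesis s_gt0 : 0 < s.
Local Notation RR := (measurableTypeR R).
Local Notation gam := (normal_prob 0 s : probability RR R).

(** One factor exp(b x^2) will dominate a polynomial and another exp |u x|; the square of their
    product is exp(x^2 / (4 s^2)), which [intg_expR_sq] integrates. *)
Let b : R := (16 * s ^+ 2)^-1.
Let b0 : 0 < b. Proof. by rewrite invr_gt0 mulr_gt0// exprn_gt0. Qed.

Lemma horner_growth (q : {poly R}) : exists c m, forall x, `|q.[x]| <= c * (1 + x ^+ (2 * m)).
Proof.
exists (\sum_(i < size q) `|q`_i|), (size q) => x.
rewrite horner_coef mulr_suml; apply: le_trans (ler_norm_sum _ _ _) _.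
apply: ler_sum => i _; rewrite normrM ler_wpM2l// normrX.
rewrite exprM -(real_normK (num_real x)).
have [x1|x1] := leP `|x| 1.
  by apply: (@le_trans _ _ 1); [rewrite exprn_ile1|rewrite lerDl exprn_ge0// exprn_ge0].
apply: (@le_trans _ _ ((`|x| ^+ 2) ^+ size q)); last by rewrite lerDr.
rewrite -exprM; apply: ler_weXn2l; first exact: ltW.
by apply: leq_trans (ltnW (ltn_ord i)) _; rewrite leq_pmull.
Qed.

Lemma horner_le_expR_sq (q : {poly R}) : exists2 c, 0 < c & forall x, `|q.[x]| <= c * expR (b * x ^+ 2).
Proof.
have [c [m hc]] := horner_growth q; have [c' hc'] := @normr_exp_le_expR_sq R (2 * m) b b0.
exists (`|c| * (1 + `|c'|) + 1); first by rewrite ltr_wpDl// mulr_ge0// addr_ge0.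
move=> x; apply: le_trans (hc x) _.
have e1 : 1 <= expR (b * x ^+ 2) by rewrite -expR0 ler_expR mulr_ge0 ?(ltW b0)// sqr_ge0.
have xm : x ^+ (2 * m) <= `|c'| * expR (b * x ^+ 2).
  apply: le_trans (ler_norm _) _; rewrite normrX; apply: le_trans (hc' x) _.
  by rewrite ler_wpM2r ?expR_ge0// ler_norm.
have x0 : 0 <= x ^+ (2 * m) by rewrite exprM exprn_ge0// sqr_ge0.
apply: (@le_trans _ _ (`|c| * (1 + x ^+ (2 * m)))).
  by rewrite ler_wpM2r ?addr_ge0// ler_norm.
apply: (@le_trans _ _ (`|c| * ((1 + `|c'|) * expR (b * x ^+ 2)))).
  by rewrite ler_wpM2l//; nra.
by rewrite mulrA ler_wpM2r ?expR_ge0// lerDl.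
Qed.

Lemma expR_norm_le u x : expR `|u * x| <= expR (u ^+ 2 / (4 * b)) * expR (b * x ^+ 2).
Proof.
rewrite -expRD ler_expR normrM -(real_normK (num_real x)) -(real_normK (num_real u)).
rewrite -subr_ge0.
have -> : `|u| ^+ 2 / (4 * b) + b * `|x| ^+ 2 - `|u| * `|x| = b * (`|x| - `|u| / (2 * b)) ^+ 2.
  by field; rewrite gt_eqF.
by rewrite mulr_ge0 ?sqr_ge0// ltW.
Qed.

Lemma intg_expR_sq_sq c : intg gam (fun x : RR => (c * (expR (b * x ^+ 2) * expR (b * x ^+ 2))) ^+ 2).
Proof.
have := intgZ (c ^+ 2) (intg_expR_sq s_gt0); congr intg; apply/funext => x.
rewrite exprMn -expRD -expRM_natl; congr (_ * expR _); rewrite /b; field.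
by rewrite gt_eqF.
Qed.

Definition polynomial_approx (f : RR -> R) := L2 gam f /\
  forall e, 0 < e -> exists q : {poly R}, Ex gam (fun x : RR => (f x - q.[x]) ^+ 2) <= e.

Lemma horner_tame (q : {poly R}) : tame gam (fun x : RR => q.[x]).
Proof. exact: tame_horner (normal_tame s_gt0). Qed.

Lemma Ex_sqD (f g : RR -> R) : L2 gam f -> L2 gam g ->
  Ex gam (fun x : RR => (f x + g x) ^+ 2) <=
  2 * Ex gam (fun x : RR => f x ^+ 2) + 2 * Ex gam (fun x : RR => g x ^+ 2).
Proof.
move=> hf hg; have [_ hfg] := L2D hf hg; have [_ if2] := hf; have [_ ig2] := hg.
rewrite -!ExZ// -ExD; try exact: intgZ.
apply: Ex_le => //; first by apply: intgD; exact: intgZ.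
by move=> x; have := sqr_ge0 (f x - g x); nra.
Qed.

Lemma polynomial_approx_close (f : RR -> R) : L2 gam f ->
  (forall e, 0 < e -> exists2 g, polynomial_approx g & Ex gam (fun x : RR => (f x - g x) ^+ 2) <= e) ->
  polynomial_approx f.
Proof.
move=> hf h; split=> // e e0; have e4 : 0 < e / 4 by rewrite divr_gt0.
have [g [Lg /(_ _ e4)[q hq]] fg] := h _ e4; exists q.
have Lq := tame_L2 (horner_tame q).
have := Ex_sqD (L2B hf Lg) (L2B Lg Lq).
have -> : (fun x : RR => (f x - g x + (g x - q.[x])) ^+ 2) = (fun x : RR => (f x - q.[x]) ^+ 2).
  by apply/funext => x; rewrite addrA subrK.
by move: fg hq; lra.
Qed.

Lemma polynomial_approx_horner (q : {poly R}) : polynomial_approx (fun x : RR => q.[x]).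
Proof.
split; first exact/tame_L2/horner_tame.
move=> e e0; exists q; under eq_fun do rewrite subrr expr0n /=.
by rewrite Ex_cst ltW.
Qed.

Lemma polynomial_approx_dominated (f : RR -> R) (q : nat -> {poly R}) c :
  measurable_fun setT f -> (forall x : RR, (q n).[x] @[n --> \oo] --> f x) ->
  (forall n (x : R), `|(q n).[x]| <= c * (expR (b * x ^+ 2) * expR (b * x ^+ 2))) ->
  polynomial_approx f.
Proof.
move=> mf cf hq.
pose g (x : RR) := c * (expR (b * x ^+ 2) * expR (b * x ^+ 2)).
have fg (x : RR) : `|f x| <= g x.
  by apply: (cvgr_to_le (cvg_norm (cf x))); apply: nearW => n; exact: hq.
have Lf : L2 gam f.
  split=> //; apply: (@le_intg _ _ _ gam (fun x : RR => g x ^+ 2)).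
  - exact: measurable_funX.
  - exact: intg_expR_sq_sq.
  move=> x; rewrite !normrX lerXn2r ?nnegrE//.
  exact: le_trans (fg x) (ler_norm _).
split=> // e e0.
have cE : Ex gam (fun x : RR => (f x - (q n).[x]) ^+ 2) @[n --> \oo] --> Ex gam (fun=> 0 : R).
  apply: (@Ex_dominated R _ RR gam (fun n x => (f x - (q n).[x]) ^+ 2) (fun=> 0) (fun x => 4 * g x ^+ 2)).
  - move=> n; apply: measurable_funX; apply: measurable_funB => //.
    by have [] := horner_tame (q n).
  - exact: measurable_cst.
  - move=> x.
    have -> : (fun n => (f x - (q n).[x]) ^+ 2) = (fun n => (f x - (q n).[x]) * (f x - (q n).[x])).
      by apply/funext => n; rewrite expr2.
    rewrite -[X in _ --> X](mulr0 (0 : R)) -(subrr (f x)).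
    by apply: cvgM; (apply: cvgB; [exact: cvg_cst|exact: cf]).
  - by apply: intgZ; exact: intg_expR_sq_sq.
  - move=> n x; rewrite ger0_norm ?sqr_ge0// -(real_normK (num_real (f x - _))).
    have -> : 4 * g x ^+ 2 = (2 * g x) ^+ 2 by ring.
    have g0 : 0 <= g x := le_trans (normr_ge0 _) (fg x).
    have h2 : `|f x - (q n).[x]| <= 2 * g x.
      by apply: le_trans (ler_normB _ _) _; have := fg x; have := hq n x; rewrite -/(g x); lra.
    by rewrite lerXn2r// nnegrE mulr_ge0.
move: cE; rewrite Ex_cst => /cvgrPdist_le /(_ _ e0)[N _ /(_ N (leqnn _))] /=.
rewrite sub0r normrN => hN; exists (q N); exact: le_trans (ler_norm _) hN.
Qed.

Lemma measurable_sin_mul u : measurable_fun setT (fun x : RR => sin (u * x)).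
Proof.
apply: measurableT_comp; first exact: continuous_measurable_fun (@continuous_sin R).
exact: measurable_funM.
Qed.

Lemma sin_norm_le1 (x : R) : `|sin x| <= 1.
Proof. by rewrite ler_norml sin_geN1 sin_le1. Qed.

Lemma polynomial_approxD (f g : RR -> R) : polynomial_approx f -> polynomial_approx g ->
  polynomial_approx (fun x => f x + g x).
Proof.
move=> [Lf hf] [Lg hg]; split; first exact: L2D.
move=> e e0; have e4 : 0 < e / 4 by rewrite divr_gt0.
have [q hq] := hf _ e4; have [r hr] := hg _ e4; exists (q + r).
have := Ex_sqD (L2B Lf (tame_L2 (horner_tame q))) (L2B Lg (tame_L2 (horner_tame r))).
have -> : (fun x : RR => (f x - q.[x] + (g x - r.[x])) ^+ 2) =
    (fun x : RR => (f x + g x - (q + r).[x]) ^+ 2).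
  by apply/funext => x; rewrite hornerD opprD addrACA.
by move: hq hr; lra.
Qed.

Lemma polynomial_approx_horner_sin (q : {poly R}) u :
  polynomial_approx (fun x : RR => q.[x] * sin (u * x)).
Proof.
have [c c0 hc] := horner_le_expR_sq q.
apply: (@polynomial_approx_dominated _ (fun n => q * sin_poly n u) (c * expR (u ^+ 2 / (4 * b)))).
- by apply: measurable_funM; [case: (horner_tame q)|exact: measurable_sin_mul].
- move=> x; under eq_fun do rewrite hornerM.
  by apply: cvgM; [exact: cvg_cst|exact: sin_poly_cvg].
- move=> n x; rewrite hornerM normrM.
  apply: le_trans (ler_pM (normr_ge0 _) (normr_ge0 _) (hc x)
    (le_trans (sin_poly_le n u x) (expR_norm_le u x))) _.
  by rewrite le_eqVlt; apply/orP; left; apply/eqP; ring.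
Qed.

(** As |sin| <= 1, the factor does not increase the L2 error, which reduces f to a polynomial;
    Taylor sums handle that case. Iterated by Horner's scheme, this reaches all polynomials in sin
    (u x). *)
Lemma polynomial_approx_sin (f : RR -> R) u : polynomial_approx f ->
  polynomial_approx (fun x => f x * sin (u * x)).
Proof.
move=> [[mf if2] hf]; have mfs : measurable_fun setT (fun x : RR => f x * sin (u * x)).
  by apply: measurable_funM => //; exact: measurable_sin_mul.
have le_f (g : RR -> R) (x : R) : `|g x * sin (u * x)| <= `|g x|.
  by rewrite normrM ler_piMr// sin_norm_le1.
apply: polynomial_approx_close.
  exact: (@le_L2 _ _ _ gam f).
move=> e e0; have [q hq] := hf e e0; exists (fun x : RR => q.[x] * sin (u * x)).
  exact: polynomial_approx_horner_sin.
have [mfq if2q] := L2B (conj mf if2) (tame_L2 (horner_tame q)).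
apply: le_trans hq; apply: Ex_le => //.
  apply: (le_intg _ if2q) => [|x].
    by apply: measurable_funX; apply: measurable_funB => //; case: (polynomial_approx_horner_sin q u) => [[]].
  by rewrite !normrX lerXn2r ?nnegrE// -mulrBl (le_f (fun x => f x - q.[x])).
move=> x; rewrite -mulrBl -(real_normK (num_real (f x - _))) -(real_normK (num_real (_ * _))).
by rewrite lerXn2r ?nnegrE// (le_f (fun x => f x - q.[x])).
Qed.

Lemma polynomial_approx_horner_comp_sin (q : {poly R}) u :
  polynomial_approx (fun x : RR => q.[sin (u * x)]).
Proof.
elim/poly_ind: q => [|q c IH].
  by have := polynomial_approx_horner 0; congr polynomial_approx; apply/funext => x; rewrite !horner0.
have := polynomial_approxD (polynomial_approx_sin u IH) (polynomial_approx_horner c%:P).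
by congr polynomial_approx; apply/funext => x; rewrite !hornerE.
Qed.

(** Clamping at sin (1/2) < 1 keeps the argument of [asin] inside ]-1, 1[, where it is
    continuous. *)
Lemma continuous_arcsin_comp (psi : R -> R) u : continuous psi ->
  continuous (fun y => psi (asin (clamp (sin (1 / 2)) y) / u)).
Proof.
move=> cpsi y; have pih := pihalf_ge1 R.
have s1 : sin (1 / 2) < 1 :> R.
  by rewrite -[ltRHS](@sin_pihalf R) ltr_sin ?in_itv/=; try (apply/andP; split); lra.
have s0 : 0 < sin (1 / 2) :> R.
  by rewrite -[ltLHS](@sin0 R) ltr_sin ?in_itv/=; try (apply/andP; split); lra.
apply: (@continuous_comp _ _ _ (fun y => asin (clamp (sin (1 / 2)) y) / u) psi); last exact: cpsi.
apply: (@continuousM R R (fun y => asin (clamp (sin (1 / 2)) y)) (fun=> u^-1)); last exact: cst_continuous.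
apply: (@continuous_comp _ _ _ (clamp (sin (1 / 2))) (@asin R)); first exact: clamp_continuous.
apply: continuous_asin; have := @clamp_norm R (sin (1 / 2)) y (ltW s0).
by rewrite ler_norml => /andP[]; lra.
Qed.

Lemma arcsin_clamp_sin (y : R) : `|y| <= 1 / 2 -> asin (clamp (sin (1 / 2)) (sin y)) = y.
Proof.
have pih := pihalf_ge1 R; rewrite ler_norml => /andP[y0 y1].
rewrite clamp_id ?sinK ?in_itv//=; first by lra.
by rewrite ler_norml -sinN !leNgt !ltr_sin ?in_itv -?leNgt/=; try (apply/andP; split); lra.
Qed.

(* For small u, psi is close to a Bernstein polynomial in (1 + sin (u x)) / 2
   where |u x| <= 1/2, and the rest has small mass. *)
Lemma polynomial_approx_continuous (psi : R -> R) (M : R) : continuous psi -> 0 < M ->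
  (forall x, `|psi x| <= M) -> polynomial_approx psi.
Proof.
move=> cpsi M0 hM; have mpsi : measurable_fun setT (psi : RR -> R) by exact: continuous_measurable_fun.
have Lpsi : L2 gam psi by apply: (@L2_bounded _ _ _ gam _ M).
apply: polynomial_approx_close => // e e0.
pose S := Ex gam (fun x : RR => x ^+ 2).
have S0 : 0 <= S by apply: Ex_ge0 => x; exact: sqr_ge0.
pose A := 16 * M ^+ 2 * S.
have A0 : 0 <= A by rewrite !mulr_ge0// ltW.
(* Where |u x| > 1/2 the squared error is at most 4 M^2 <= 16 M^2 u^2 x^2, of expectation A u^2.
   Since u <= 1, a bound on (A + 1) u suffices. *)
pose u := Num.min 1 (e / 2 / (A + 1)).
have A1 : 0 < A + 1 by rewrite ltr_wpDl.
have u0 : 0 < u by rewrite lt_min ltr01 !divr_gt0.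
have uA : A * u ^+ 2 <= e / 2.
  have u1 : u <= 1 by rewrite ge_min lexx.
  have u2 : u <= e / 2 / (A + 1) by rewrite ge_min lexx orbT.
  move: u2; rewrite ler_pdivlMr// => u2; nra.
pose eta := Num.min 1 (e / 2).
have eta0 : 0 < eta by rewrite lt_min ltr01 divr_gt0.
have etae : eta ^+ 2 <= e / 2.
  have eta1 : eta <= 1 by rewrite ge_min lexx.
  have eta2 : eta <= e / 2 by rewrite ge_min lexx orbT.
  by nra.
(* psi read in the variable t = (1 + sin (u x)) / 2 of [0, 1]; the reading is faithful for |u x| <=
   1/2. *)
pose f (t : R) : R := psi (asin (clamp (sin (1 / 2)) (2 * t - 1)) / u).
have cf : continuous f.
  move=> t; apply: (@continuous_comp R R R (fun t => 2 * t - 1) (fun y => psi (asin (clamp (sin (1 / 2)) y) / u))).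
    apply: (@continuousB R R R (fun t => 2 * t) (fun=> 1)); last exact: cst_continuous.
    by apply: (@continuousM R R (fun=> 2) id); [exact: cst_continuous|exact: cvg_id].
  exact: continuous_arcsin_comp.
have [q hq] := weierstrass cf M0 (fun t => hM _) eta0.
exists (fun x : RR => (q \Po (2^-1 *: 'X + (2^-1)%:P)).[sin (u * x)]).
  exact: polynomial_approx_horner_comp_sin.
have E (x : R) : (q \Po (2^-1 *: 'X + (2^-1)%:P)).[sin (u * x)] = q.[(1 + sin (u * x)) / 2].
  by rewrite horner_comp !hornerE; congr horner; ring.
have ix2 : intg gam (fun x : RR => x ^+ 2) by have [] := tame_L2 (normal_tame s_gt0).
have iR : intg gam (fun x : RR => eta ^+ 2 + 16 * M ^+ 2 * u ^+ 2 * x ^+ 2).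
  by apply: intgD; [exact: intg_cst|exact: intgZ].
apply: (@le_trans _ _ (Ex gam (fun x : RR => eta ^+ 2 + 16 * M ^+ 2 * u ^+ 2 * x ^+ 2))).
  apply: Ex_le => //.
    have [Lq _] := polynomial_approx_horner_comp_sin (q \Po (2^-1 *: 'X + (2^-1)%:P)) u.
    by have [] := L2B Lpsi Lq.
  move=> x; rewrite E.
  have t01 : 0 <= (1 + sin (u * x)) / 2 <= 1.
    by have := sin_geN1 (u * x); have := sin_le1 (u * x); lra.
  have [h1 h2] := hq _ t01.
  have [ux|ux] := leP `|u * x| (1 / 2).
    have fE : f ((1 + sin (u * x)) / 2) = psi x.
      rewrite /f.
      have -> : 2 * ((1 + sin (u * x)) / 2) - 1 = sin (u * x) by field.
      by rewrite arcsin_clamp_sin// mulrC mulKf// gt_eqF.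
    rewrite fE in h1.
    apply: (@le_trans _ _ (eta ^+ 2)).
      by rewrite -(real_normK (num_real (psi x - _))) lerXn2r ?nnegrE// ltW.
    by rewrite lerDl mulr_ge0 ?sqr_ge0// mulr_ge0 ?sqr_ge0// mulr_ge0 ?sqr_ge0.
  apply: (@le_trans _ _ (4 * M ^+ 2)).
    have h3 : `|psi x - q.[(1 + sin (u * x)) / 2]| <= 2 * M.
      by apply: le_trans (ler_normB _ _) _; have := hM x; lra.
    have -> : 4 * M ^+ 2 = (2 * M) ^+ 2 by ring.
    by rewrite -(real_normK (num_real (psi x - _))) lerXn2r ?nnegrE// mulr_ge0// ltW.
  have : (1 / 2) ^+ 2 <= `|u * x| ^+ 2 by rewrite lerXn2r ?nnegrE// ltW.
  rewrite real_normK ?num_real// exprMn => hux.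
  have M2 : 0 <= M ^+ 2 by exact: sqr_ge0.
  have := sqr_ge0 eta; nra.
rewrite ExD; [|exact: intg_cst|exact: intgZ]; rewrite Ex_cst ExZ// -/S.
move: uA etae; rewrite /A; lra.
Qed.
End gaussian_polynomial_approximation.

(** * Characteristic function of the normal law *)

Section gaussian_characteristic_function.
Context (R : realType) (s : R).
Hypothesis s_gt0 : 0 < s.
Local Notation RR := (measurableTypeR R).
Local Notation gam := (normal_prob 0 s : probability RR R).

Lemma normal_odd_moment k : odd k -> Ex gam (fun x : RR => x ^+ k) = 0.
Proof.
have : forall j, Ex gam (fun x : RR => x ^+ j.*2.+1) = 0.
  elim=> [|j IH]; first by rewrite (normal_moment_rec s_gt0 0) !mul0r.
  by rewrite doubleS (normal_moment_rec s_gt0 j.*2.+2) /= IH mulr0.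
by move=> h ok; rewrite -(odd_double_half k) ok add1n.
Qed.

(** Integrating the cosine series term by term gives the exponential series. Successive terms on
    both sides have the ratio - (s^2 u^2 / 2) / (k + 1). *)
Lemma cos_coeff_normal_moment u k :
  cos_coeff' u k * Ex gam (fun x : RR => x ^+ k.*2) = exp_coeff (- (s ^+ 2 * u ^+ 2 / 2)) k.
Proof.
elim: k => [|k IH].
  rewrite /cos_coeff' /exp_coeff /= !expr0 fact0 (_ : (fun=> _) = fun=> 1)//.
  by rewrite Ex_cst; ring.
have k0 : k.+1%:R != 0 :> R by rewrite pnatr_eq0.
have f0 : k`!%:R != 0 :> R by rewrite pnatr_eq0 -lt0n fact_gt0.
have f0' : k.*2`!%:R != 0 :> R by rewrite pnatr_eq0 -lt0n fact_gt0.
have k0' : k.*2.+1%:R != 0 :> R by rewrite pnatr_eq0.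
have -> : exp_coeff (- (s ^+ 2 * u ^+ 2 / 2)) k.+1 =
    exp_coeff (- (s ^+ 2 * u ^+ 2 / 2)) k * (- (s ^+ 2 * u ^+ 2 / 2)) / k.+1%:R.
  rewrite /exp_coeff /= factS natrM exprSr.
  by set a := k.+1%:R in k0 *; clearbody a; field; rewrite f0 k0.
rewrite -IH doubleS (normal_moment_rec s_gt0 k.*2.+1) /=.
rewrite /cos_coeff' -!exprnP doubleS !exprS !factS !natrM.
have -> : k.*2.+2%:R = 2 * k.+1%:R :> R by rewrite -doubleS -mul2n natrM.
set a := k.+1%:R in k0 *; set a' := k.*2.+1%:R in k0' *; clearbody a a'.
by field; rewrite k0 k0' f0'.
Qed.

Lemma Ex_normal_poly n (E : nat -> R) :
  Ex gam (fun x : RR => (\poly_(i < n) E i).[x]) = \sum_(i < n) E i * Ex gam (fun x : RR => x ^+ i).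
Proof.
have iX i : intg gam (fun x : RR => x ^+ i) by exact: tame_intg (tameX _ (normal_tame s_gt0)).
under eq_fun do rewrite horner_poly.
by rewrite Ex_sum; [apply: eq_bigr => i _; rewrite ExZ|move=> i; exact: intgZ].
Qed.

Lemma Ex_normal_cvg (q : nat -> {poly R}) (f : RR -> R) u :
  measurable_fun setT f -> (forall x : R, (q n).[x] @[n --> \oo] --> f x) ->
  (forall n x, `|(q n).[x]| <= expR `|u * x|) ->
  Ex gam (fun x : RR => (q n).[x]) @[n --> \oo] --> Ex gam f.
Proof.
move=> mf cf hq; have s0 : 0 < 4 * s ^+ 2 by rewrite mulr_gt0// exprn_gt0.
pose c := expR (u ^+ 2 * s ^+ 2).
apply: (@Ex_dominated _ _ _ gam _ f (fun x : RR => c * expR (x ^+ 2 / (4 * s ^+ 2)))) => //.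
- by move=> n; case: (horner_tame s_gt0 (q n)).
- by apply: intgZ; exact: intg_expR_sq.
move=> n x; apply: le_trans (hq n x) _; rewrite -expRD ler_expR.
rewrite normrM -(real_normK (num_real x)) -(real_normK (num_real u)) -subr_ge0.
have -> : `|u| ^+ 2 * s ^+ 2 + `|x| ^+ 2 / (4 * s ^+ 2) - `|u| * `|x| =
    (`|u| * s - `|x| / (2 * s)) ^+ 2 by field; rewrite gt_eqF.
exact: sqr_ge0.
Qed.

Lemma Ex_normal_sin u : Ex gam (fun x : RR => sin (u * x)) = 0.
Proof.
have := @Ex_normal_cvg (fun n => sin_poly n u) _ u (measurable_sin_mul u) (@sin_poly_cvg R u) (fun n => @sin_poly_le R n u).
have -> : (fun n => Ex gam (fun x : RR => (sin_poly n u).[x])) = fun=> 0.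
  apply/funext => n; rewrite Ex_normal_poly big1// => i _.
  have [oi|ei] := boolP (odd i); first by rewrite normal_odd_moment// mulr0.
  by rewrite /sin_coeff /= (negbTE ei) !mul0r.
by move=> h; rewrite -(cvg_lim (@Rhausdorff R) h) lim_cst.
Qed.

Lemma Ex_normal_cos u : Ex gam (fun x : RR => cos (u * x)) = expR (- (s ^+ 2 * u ^+ 2 / 2)).
Proof.
have mcos : measurable_fun setT (fun x : RR => cos (u * x)).
  apply: measurableT_comp; first exact: continuous_measurable_fun (@continuous_cos R).
  exact: measurable_funM.
have := @Ex_normal_cvg (fun n => cos_poly n u) _ u mcos (@cos_poly_cvg R u) (fun n => @cos_poly_le R n u).
have E n : Ex gam (fun x : RR => (cos_poly n.*2 u).[x]) = series (exp_coeff (- (s ^+ 2 * u ^+ 2 / 2))) n.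
  rewrite Ex_normal_poly -(big_mkord xpredT (fun i => cos_coeff u i * Ex gam (fun x : RR => x ^+ i))).
  rewrite /series /=; elim: n => [|n IH]; first by rewrite !big_nil.
  rewrite doubleS !big_nat_recr//= IH -cos_coeff_normal_moment cos_coeff'E.
  by rewrite {2}/cos_coeff /= odd_double /= !mul0r addr0.
(* Along even indices the integrated cosine sums are exactly partial sums of the exponential
   series. *)
have c2 : (fun n => n.*2) @ \oo --> \oo.
  move=> A [N _ hN]; exists N => // n /= Nn; apply: hN => /=.
  by apply: leq_trans Nn _; rewrite -addnn leq_addr.
move=> /(cvg_comp _ _ c2) h; rewrite -(cvg_lim (@Rhausdorff R) h) /expR; congr (limn _).
by apply/funext => n; rewrite /= E.
Qed.
End gaussian_characteristic_function.

Lemma Ex_mul_young (R : realType) (d : measure_display) (T : measurableType d)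
    (P : probability T R) (f g : T -> R) dl : L2 P f -> L2 P g -> 0 < dl ->
  `|Ex P (fun x => f x * g x)| <= dl * Ex P (fun x => g x ^+ 2) + dl^-1 * Ex P (fun x => f x ^+ 2).
Proof.
move=> hf hg dl0; have := Ex_cauchy_schwarz hf hg.
have : 0 <= Ex P (fun x => f x ^+ 2) by apply: Ex_ge0 => x; exact: sqr_ge0.
have : 0 <= Ex P (fun x => g x ^+ 2) by apply: Ex_ge0 => x; exact: sqr_ge0.
set A := Ex P (fun x => f x ^+ 2); set B := Ex P (fun x => g x ^+ 2).
set e := Ex P _; clearbody A B e => B0 A0 h.
have C0 : 0 <= dl * B + dl^-1 * A by rewrite addr_ge0// mulr_ge0// ?invr_ge0 ltW.
rewrite -(@ler_pXn2r _ 2) ?nnegrE// real_normK ?num_real//; apply: le_trans h _.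
rewrite -subr_ge0.
have -> : (dl * B + dl^-1 * A) ^+ 2 - A * B = (dl * B - dl^-1 * A / 2) ^+ 2 + 3 / 4 * (dl^-1 * A) ^+ 2 + 2 * (A * B).
  by field; rewrite gt_eqF.
have h1 := mulr_ge0 A0 B0; have h2 := sqr_ge0 (dl * B - dl^-1 * A / 2); have h3 := sqr_ge0 (dl^-1 * A).
by rewrite !addr_ge0// mulr_ge0.
Qed.

(** * Mixing with bounded continuous observables *)

Section bounded_mixing.
Context (R : realType) (d : measure_display) (T : measurableType d).
Variable P : probability T R.
Context (H : hilbertType R) (W : H -> {RV P >-> R}).
Hypothesis W_iso : isonormal W.
Variables (s : R) (s_gt0 : 0 < s).
Local Notation RR := (measurableTypeR R).
Local Notation gam := (normal_prob 0 s : probability RR R).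
Local Notation Z := (fun x : RR => x : R).
Variables (p : nat) (p_gt1 : (1 < p)%N).
Variables (m : nat -> nat) (c : forall n, 'I_(m n) -> R) (h : forall n, 'I_(m n) -> H).
Arguments c : clear implicits.
Arguments h : clear implicits.
Hypothesis h1 : forall n i, `|h n i| = 1.

Let F n := hermite_sum W p (c n) (h n).
Hypothesis F_cvg : clamp_cvg P gam Z F.

Let tF n : tame P (F n). Proof. exact: hermite_sum_tame. Qed.

Lemma mixing_horner (G : T -> R) (q : {poly R}) : L2 P G ->
  Ex P (fun w => q.[F n w] * G w) @[n --> \oo] --> Ex gam (fun x : RR => q.[x]) * Ex P G.
Proof.
move=> hG; have iX i : intg gam (fun x : RR => x ^+ i) by exact: tame_intg (tameX _ (normal_tame s_gt0)).
rewrite (_ : Ex gam _ = \sum_(i < size q) q`_i * Ex gam (fun x : RR => x ^+ i)); last first.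
  by rewrite -Ex_normal_poly//; congr Ex; apply/funext => x; rewrite horner_poly horner_coef.
rewrite mulr_suml.
rewrite (_ : (fun n => _) = fun n => \sum_(i < size q) q`_i * Ex P (fun w => F n w ^+ i * G w)).
  apply: cvg_big => [|i _]; first exact: add_continuous.
  rewrite -mulrA; apply: cvgM; first exact: cvg_cst.
  exact: mixing_L2.
apply/funext => n; have iF i : intg P (fun w => F n w ^+ i * G w).
  by apply: L2_prod => //; exact/tame_L2/tameX.
under eq_fun do rewrite horner_coef mulr_suml; rewrite Ex_sum.
  by apply: eq_bigr => i _; rewrite -ExZ//; congr Ex; apply/funext => w; rewrite mulrA.
by move=> i; under eq_fun do rewrite -mulrA; exact: intgZ.
Qed.

(** The polynomial q is close to psi only under the limit law. Since (psi - q)^2 is continuous with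
    polynomial growth, [growth_cvg] carries the closeness over to F n, and [mixing_horner] treats
    q. *)
Lemma mixing_continuous (psi : R -> R) (M : R) (G : T -> R) : continuous psi ->
  (forall x, `|psi x| <= M) -> L2 P G ->
  Ex P (fun w => psi (F n w) * G w) @[n --> \oo] --> Ex gam psi * Ex P G.
Proof.
move=> cpsi hM hG; apply/cvgrPdist_le => eps e0.
have M0 : 0 < M + 1 by rewrite ltr_wpDl// (le_trans (normr_ge0 _) (hM 0)).
pose B := Ex P (fun w => G w ^+ 2).
have B0 : 0 <= B by apply: Ex_ge0 => x; exact: sqr_ge0.
have GB : Ex P G ^+ 2 <= B.
  have := Ex_cauchy_schwarz hG (L2_cst P 1); rewrite -/B.
  by under [X in Ex P X]eq_fun do rewrite mulr1; rewrite expr1n Ex_cst mulr1.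
pose dl := eps / (8 * (B + 1)).
have B1 : 0 < 8 * (B + 1) by rewrite mulr_gt0// ltr_wpDl.
have dl0 : 0 < dl by rewrite divr_gt0.
have dlB : dl * B <= eps / 8.
  rewrite /dl mulrAC ler_pdivrMr//; nra.
(* In Young's inequality dl makes the term in G^2 small; eta has to compensate the factor 1 / dl on
   the approximation error. *)
pose eta := dl * (eps / 16).
have eta0 : 0 < eta by rewrite mulr_gt0 ?divr_gt0.
have [Lpsi happrox] : polynomial_approx s psi.
  apply: (polynomial_approx_continuous s_gt0 cpsi M0) => x.
  by apply: le_trans (hM x) _; rewrite lerDl.
have [q hq] := happrox _ eta0.
have tq := horner_tame s_gt0 q.
pose dif x := psi x - q.[x].
have cdif : continuous (fun x => dif x ^+ 2).
  have cd : continuous dif; last first.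
    by move=> x; under eq_fun do rewrite expr2; apply: (@continuousM R R dif dif); exact: cd.
  move=> x; by apply: continuousB; [exact: cpsi|exact: continuous_horner].
have [cc [mm hcc]] := horner_growth (q * q).
have dif_growth x : `|dif x ^+ 2| <= (2 * (M + 1) ^+ 2 + 2 * `|cc|) * (1 + x ^+ (2 * mm)).
  have xm : 0 <= x ^+ (2 * mm) by rewrite exprM exprn_ge0// sqr_ge0.
  rewrite ger0_norm ?sqr_ge0// /dif.
  have a1 : psi x ^+ 2 <= (M + 1) ^+ 2.
    by rewrite -(real_normK (num_real (psi x))) lerXn2r ?nnegrE ?(ltW M0)// (le_trans (hM x))// lerDl.
  have a2 : q.[x] ^+ 2 <= `|cc| * (1 + x ^+ (2 * mm)).
    rewrite expr2 -hornerM; apply: le_trans (ler_norm _) (le_trans (hcc x) _).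
    by rewrite ler_wpM2r ?ler_norm// addr_ge0.
  have a3 : 0 <= (M + 1) ^+ 2 * x ^+ (2 * mm) by rewrite mulr_ge0// sqr_ge0.
  have := sqr_ge0 (psi x + q.[x]); nra.
have k1 := growth_cvg (normal_tame s_gt0) tF F_cvg (hermite_sum_moments_bounded W_iso s_gt0 h1 F_cvg) cdif dif_growth.
move: k1 => /cvgrPdist_le/(_ _ eta0) k1.
have e2 : 0 < eps / 4 by rewrite divr_gt0.
have /cvgrPdist_le/(_ _ e2) k2 := @mixing_horner G q hG.
have mpsi : measurable_fun setT (psi : RR -> R) by exact: continuous_measurable_fun.
near=> n.
have l1 : `|Ex gam ((fun x => dif x ^+ 2) \o Z) - Ex P ((fun x => dif x ^+ 2) \o F n)| <= eta by near: n.
have l2 : `|Ex gam (fun x : RR => q.[x]) * Ex P G - Ex P (fun w => q.[F n w] * G w)| <= eps / 4 by near: n.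
have LpF : L2 P (fun w => psi (F n w)).
  apply: (@L2_bounded _ _ _ _ _ M) => // ; apply: measurableT_comp => //.
  by case: (tF n).
have LqF : L2 P (fun w => q.[F n w]) by exact/tame_L2/tame_horner.
have k3 := Ex_mul_young (L2B LpF LqF) hG dl0.
have k4 := Ex_mul_young (L2B Lpsi (tame_L2 tq)) (L2_cst gam (Ex P G)) dl0.
rewrite Ex_cst in k4.
have E3 : Ex P (fun w => (psi (F n w) - q.[F n w]) * G w) =
    Ex P (fun w => psi (F n w) * G w) - Ex P (fun w => q.[F n w] * G w).
  rewrite -ExB; try exact: L2_prod.
  by congr Ex; apply/funext => w; rewrite mulrBl.
have E4 : Ex gam (fun x : RR => (psi x - q.[x]) * Ex P G) = Ex gam psi * Ex P G - Ex gam (fun x : RR => q.[x]) * Ex P G.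
  rewrite -mulrBl -ExB; [|exact: L2_intg|exact: tame_intg].
  by under eq_fun do rewrite mulrC; rewrite ExZ 1?mulrC//; apply: intgB; [exact: L2_intg|exact: tame_intg].
rewrite E3 in k3; rewrite E4 in k4.
have k5 : Ex P (fun w => (psi (F n w) - q.[F n w]) ^+ 2) <= eta + eta.
  move: l1; rewrite ler_norml => /andP[l1 _].
  by have := lerD l1 hq; rewrite /dif /comp; set x := Ex P _; set y := Ex gam _; clearbody x y; lra.
have i1 : dl^-1 * Ex P (fun w => (psi (F n w) - q.[F n w]) ^+ 2) <= eps / 8.
  by rewrite mulrC ler_pdivrMr//; apply: le_trans k5 _; rewrite /eta; lra.
have i2 : dl^-1 * Ex gam (fun x : RR => (psi x - q.[x]) ^+ 2) <= eps / 16.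
  by rewrite mulrC ler_pdivrMr//; apply: le_trans hq _; rewrite /eta; lra.
have i3 : dl * Ex P G ^+ 2 <= eps / 8 by apply: le_trans _ dlB; rewrite ler_wpM2l// ltW.
move: (le_trans k3 (lerD dlB i1)) (le_trans k4 (lerD i3 i2)) l2.
set x1 := Ex P (fun w => psi (F n w) * G w); set x2 := Ex P (fun w => q.[F n w] * G w).
set x3 := Ex gam psi * Ex P G; set x4 := _ * Ex P G; clearbody x1 x2 x3 x4.
rewrite !ler_norml => /andP[? ?] /andP[? ?] /andP[? ?].
by apply/andP; split; lra.
Unshelve. all: by end_near. Qed.
End bounded_mixing.

(** * Symmetric tensors and multiple integrals *)

Section tensor_powers.
Context (R : realType) (H : hilbertType R) (n : nat) (T : tensor_power H n).
Implicit Types (t u : T) (h : 'I_n -> H).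

(** A nonzero difference z, orthogonal to all elementary tensors, would have some s of their span at
    distance less than |z|; Pythagoras forbids it. *)
Lemma tensor_ext t u : (forall h, inner (tensor T h) t = inner (tensor T h) u) -> t = u.
Proof.
move=> tu; apply/eqP; rewrite -subr_eq0; apply/negPn/negP => z0.
set z := t - u in z0.
have oz : open (ball z `|z|) by apply: ball_open; rewrite normr_gt0.
have [|s [zs [m [c [h sE]]]]] := tensor_dense _ oz.
  by exists z; apply: ballxx; rewrite normr_gt0.
have szE : inner s z = 0.
  rewrite sE inner_suml big1// => i _.
  by rewrite innerZl innerBr tu subrr mulr0.
move: zs; rewrite -ball_normE /= => zs; clearbody z.
have : `|z - s| ^+ 2 < `|z| ^+ 2 by rewrite ltr_pXn2r// nnegrE.
rewrite -!inner_norm innerBl !innerBr szE [inner z s]innerC szE subr0 sub0r opprK.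
by rewrite ltNge lerDl inner_norm sqr_ge0.
Qed.

(** Tested against an elementary tensor, the left side is a permanent of inner products and the
    right side is Ryser's formula for it. *)
Lemma tensor_polarization h :
  \sum_(s : 'S_n) tensor T (h \o s) =
  \sum_(e : {ffun 'I_n -> bool}) (\prod_j (if e j then 1 else -1)) *:
    tensor_exp T (\sum_j (if e j then h j else 0)).
Proof.
apply: tensor_ext => g; rewrite !inner_sumr.
have := ryser_permanent (fun i j => inner (g i) (h j)).
under [X in _ -> X = _]eq_bigr do rewrite inner_tensor /=.
move=> <-; apply: eq_bigr => e _.
rewrite innerZr inner_tensor; congr (_ * _); apply: eq_bigr => i _.
rewrite inner_sumr; apply: eq_bigr => j _; case: (e j) => //.
by rewrite innerC inner0l.
Qed.

Lemma tensor_expZ (a : R) (x : H) : tensor_exp T (a *: x) = a ^+ n *: tensor_exp T x.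
Proof.
apply: tensor_ext => g; rewrite innerZr !inner_tensor.
under eq_bigr do rewrite innerZr.
by rewrite big_split /= prodr_const card_ord.
Qed.

(** Unit vectors only, since [multiple_integral] prescribes its values on their powers. *)
Definition unit_power_span t := exists m (c : 'I_m -> R) (x : 'I_m -> H),
  (forall i, `|x i| = 1) /\ t = \sum_i c i *: tensor_exp T (x i).

Lemma unit_power_span0 : unit_power_span 0.
Proof. by exists 0%N, (fun=> 0), (fun=> 0); split=> [[]//|]; rewrite big_ord0. Qed.

Lemma unit_power_spanD t u : unit_power_span t -> unit_power_span u -> unit_power_span (t + u).
Proof.
move=> [m [c [x [x1 ->]]]] [m' [c' [x' [x1' ->]]]].
exists (m + m')%N, (fun i => match fintype.split i with inl j => c j | inr j => c' j end),
  (fun i => match fintype.split i with inl j => x j | inr j => x' j end); split=> [i|].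
  by case: (fintype.split i).
rewrite big_split_ord /=; congr (_ + _); apply: eq_bigr => i _.
  by rewrite (unsplitK (inl i)).
by rewrite (unsplitK (inr i)).
Qed.

Lemma unit_power_spanZ (a : R) t : unit_power_span t -> unit_power_span (a *: t).
Proof.
move=> [m [c [x [x1 ->]]]]; exists m, (fun i => a * c i), x; split=> //.
by rewrite scaler_sumr; apply: eq_bigr => i _; rewrite scalerA.
Qed.

Lemma unit_power_span_sum (I : Type) (r : seq I) (F : I -> T) :
  (forall i, unit_power_span (F i)) -> unit_power_span (\sum_(i <- r) F i).
Proof. by move=> hF; elim/big_ind: _ => //; [exact: unit_power_span0|exact: unit_power_spanD]. Qed.

Lemma unit_power_span_exp (x : H) : (0 < n)%N -> unit_power_span (tensor_exp T x).
Proof.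
(* The zero vector cannot be normalized; as n > 0 its power is 0, the empty combination. *)
move=> n0; have [->|x0] := eqVneq x 0.
  by rewrite -(scale0r 0) tensor_expZ expr0n -[n == 0%N]negbK -lt0n n0 scale0r; exact: unit_power_span0.
have nx : `|x| != 0 by rewrite normr_eq0.
exists 1%N, (fun=> `|x| ^+ n), (fun=> `|x|^-1 *: x); split=> [_|].
  by rewrite normrZ normfV normr_id mulVf.
by rewrite big_ord1 -tensor_expZ scalerA divff// scale1r.
Qed.

Definition symmetrize t : T := (n`!%:R)^-1 *: \sum_(s : 'S_n) tensor_perm s t.

Lemma symmetrize_continuous : continuous symmetrize.
Proof.
move=> t; apply: cvgZ; first exact: cvg_cst.
apply: cvg_big => [|s _]; first exact: add_continuous.
exact: tensor_perm_continuous.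
Qed.

Lemma symmetrize_id t : t \in symmetric_tensor T -> symmetrize t = t.
Proof.
rewrite inE => ht; rewrite /symmetrize (eq_bigr (fun=> t)) => [|s _]; last exact: ht.
rewrite sumr_const card_Sn -[X in _ *: X]scaler_nat scalerA mulVf ?scale1r// pnatr_eq0 -lt0n fact_gt0.
Qed.

Lemma tensor_perm_sum (s : 'S_n) m (c : 'I_m -> R) (F : 'I_m -> T) :
  tensor_perm s (\sum_i c i *: F i) = \sum_i c i *: tensor_perm s (F i).
Proof.
elim: m c F => [|m IH] c F.
  rewrite !big_ord0; have := @tensor_perm_linear _ _ _ T s 1 0 0.
  by rewrite !scale1r addr0 => /eqP; rewrite -subr_eq0 opprD addrA subrr sub0r oppr_eq0 => /eqP.
by rewrite !big_ord_recl tensor_perm_linear IH.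
Qed.

Lemma symmetrize_unit_power_span m (c : 'I_m -> R) (h : 'I_m -> 'I_n -> H) : (0 < n)%N ->
  unit_power_span (symmetrize (\sum_i c i *: tensor T (h i))).
Proof.
move=> n0; apply: unit_power_spanZ.
under eq_bigr do rewrite tensor_perm_sum.
rewrite exchange_big /=; apply: unit_power_span_sum => i.
rewrite -scaler_sumr; apply: unit_power_spanZ.
under eq_bigr do rewrite tensor_permE.
rewrite tensor_polarization; apply: unit_power_span_sum => e.
by apply: unit_power_spanZ; exact: unit_power_span_exp.
Qed.

(** Symmetrization is continuous and fixes t, so the preimage of a ball around t is open and meets
    the span of elementary tensors; polarization turns the symmetrized point into powers of unit
    vectors. *)
Lemma symmetric_tensor_approx t e : (0 < n)%N -> t \in symmetric_tensor T -> 0 < e ->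
  exists2 u, unit_power_span u & `|t - u| < e.
Proof.
move=> n0 st e0.
have oO : open (symmetrize @^-1` ball t e).
  by apply: open_comp; [move=> u _; exact: symmetrize_continuous|exact: ball_open].
have [|s [ts [m [c [h sE]]]]] := tensor_dense _ oO.
  by exists t; rewrite /= symmetrize_id//; exact: ballxx.
exists (symmetrize s); first by rewrite sE; exact: symmetrize_unit_power_span.
by move: ts; rewrite /= -ball_normE.
Qed.

Lemma tensor_exp_symmetric x : tensor_exp T x \in symmetric_tensor T.
Proof. by rewrite inE => s; rewrite tensor_permE. Qed.

Lemma symmetric_tensor_lincomb (a : R) t u : t \in symmetric_tensor T -> u \in symmetric_tensor T ->
  a *: t + u \in symmetric_tensor T.
Proof. by rewrite !inE => ht hu s; rewrite tensor_perm_linear ht hu. Qed.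

Lemma symmetric_tensor0 : 0 \in symmetric_tensor T.
Proof.
by rewrite inE => s; have := @tensor_perm_sum s 0 (fun=> 0) (fun=> 0); rewrite !big_ord0.
Qed.

Lemma unit_powers_symmetric m (c : 'I_m -> R) (x : 'I_m -> H) :
  \sum_i c i *: tensor_exp T (x i) \in symmetric_tensor T.
Proof.
elim: m c x => [|m IH] c x; first by rewrite big_ord0; exact: symmetric_tensor0.
by rewrite big_ord_recl; apply: symmetric_tensor_lincomb => //; exact: tensor_exp_symmetric.
Qed.
End tensor_powers.

(** A finite expectation of a nonnegative function already contains its integrability; square
    integrability is extracted this way from the isometry and from L2 limits. *)
Lemma expectation_ge0_intg (R : realType) (d : measure_display) (T : measurableType d)
    (P : probability T R) (f : T -> R) (c : R) : measurable_fun setT f ->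
  (forall x, 0 <= f x) -> ('E_P[f] = c%:E)%E -> intg P f /\ Ex P f = c.
Proof.
move=> mf f0 Ef; have ifn : intg P f.
  apply/integrableP; split; first exact/measurable_EFinP.
  rewrite (eq_integral (EFin \o f)) => [|x _]; last by rewrite /= ger0_norm.
  by rewrite -(expectationE P f) Ef ltry.
by split=> //; move: Ef; rewrite expectation_Ex// => -[].
Qed.

Section multiple_integrals.
Context (R : realType) (d : measure_display) (Omega : measurableType d).
Variable P : probability Omega R.
Context (H : hilbertType R) (T : forall n, tensor_power H n).
Variables (W : H -> {RV P >-> R}) (I : forall n, T n -> {RV P >-> R}).
Hypotheses (W_iso : isonormal W) (I_integral : multiple_integral W I).
Variables (p : nat) (p_gt0 : (0 < p)%N).
Implicit Types (t u : T p).

Lemma multiple_integral_norm t : t \in symmetric_tensor (T p) ->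
  L2 P (I t) /\ Ex P (fun w => I t w ^+ 2) = p`!%:R * `|t| ^+ 2.
Proof.
move=> st; case: I_integral => _ /(_ p t t st st) hE _ _.
have [||i2 e2] := @expectation_ge0_intg R d Omega P (fun w => I t w ^+ 2) (p`!%:R * inner t t) _ _ hE.
- exact: measurable_funX.
- by move=> w; exact: sqr_ge0.
by rewrite -inner_norm; split=> //; split.
Qed.

Lemma multiple_integralB t u : t \in symmetric_tensor (T p) -> u \in symmetric_tensor (T p) ->
  (I (t - u) : Omega -> R) = (fun w => I t w - I u w) %[ae P].
Proof.
move=> st su; case: I_integral => /(_ p (-1) u t su st) h _ _ _.
apply: filterS h => w /= h /h; rewrite scaleN1r addrC => ->; by rewrite mulN1r addrC.
Qed.

Lemma multiple_integral0 : (I (0 : T p) : Omega -> R) = (fun=> 0) %[ae P].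
Proof.
have := multiple_integralB (@symmetric_tensor0 _ _ _ (T p)) (@symmetric_tensor0 _ _ _ (T p)).
by rewrite subrr; apply: filterS => w h /h ->; rewrite subrr.
Qed.

Lemma multiple_integral_hermite_sum m (c : 'I_m -> R) (x : 'I_m -> H) :
  (forall i, `|x i| = 1) ->
  (I (\sum_i c i *: tensor_exp (T p) (x i)) : Omega -> R) = hermite_sum W p c x %[ae P].
Proof.
elim: m c x => [|m IH] c x x1.
  rewrite big_ord0; apply: filterS multiple_integral0 => w h /h ->.
  by rewrite /hermite_sum big_ord0.
rewrite big_ord_recl.
have h1 := IH (fun i => c (lift ord0 i)) (fun i => x (lift ord0 i)) (fun i => x1 _).
case: I_integral => /(_ p (c ord0) _ _ (tensor_exp_symmetric (T p) (x ord0))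
  (unit_powers_symmetric (T p) (fun i => c (lift ord0 i)) (fun i => x (lift ord0 i)))) h2 _ _ h3.
apply: filterS3 h1 h2 (h3 p _ (x1 ord0)) => w a1 a2 a3 Iw.
rewrite a2// a3// [X in _ + X]a1//.
by rewrite /hermite_sum big_ord_recl.
Qed.

Lemma multiple_integral_approx t e : t \in symmetric_tensor (T p) -> 0 < e ->
  exists m (c : 'I_m -> R) (x : 'I_m -> H), (forall i, `|x i| = 1) /\
    Ex P (fun w => (I t w - hermite_sum W p c x w) ^+ 2) <= e.
Proof.
move=> st e0.
(* The isometry multiplies squared norms by p!. *)
have e'0 : 0 < Num.sqrt (e / p`!%:R) by rewrite sqrtr_gt0 divr_gt0// ltr0n fact_gt0.
have [u [m [c [x [x1 uE]]]] tu] := symmetric_tensor_approx p_gt0 st e'0.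
exists m, c, x; split=> //.
have su : u \in symmetric_tensor (T p) by rewrite uE; exact: unit_powers_symmetric.
have stu : t - u \in symmetric_tensor (T p).
  by rewrite addrC -scaleN1r; exact: symmetric_tensor_lincomb.
have [[mtu _] E] := multiple_integral_norm stu.
have mh : measurable_fun setT (hermite_sum W p c x) by case: (hermite_sum_tame W_iso p c x).
have <- : Ex P (fun w => I (t - u) w ^+ 2) = Ex P (fun w => (I t w - hermite_sum W p c x w) ^+ 2).
  apply: Ex_ae; [exact: measurable_funX|by apply: measurable_funX; exact: measurable_funB|].
  have h1 := multiple_integralB st su; have := multiple_integral_hermite_sum c x1.
  rewrite -uE => h2; apply: filterS2 h1 h2 => w a1 a2 Iw.
  by rewrite a1// a2.
rewrite E mulrC -ler_pdivlMr ?ltr0n ?fact_gt0//.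
rewrite -(@sqr_sqrtr _ (e / p`!%:R)) ?divr_ge0 ?ltW//.
by rewrite ltr_pXn2r// nnegrE// ltW.
Qed.
End multiple_integrals.

(** * Joint convergence *)

Section grid.
Context (R : realType) (d : nat).
Implicit Types (K eta x y t : R) (phi : R * 'rV[R]_d -> R).

(** Intervals of length eta counted from -K. Clamping sends values beyond the cube to extreme cells,
    so the cells partition the whole line. *)
Definition cell K eta (i : nat) y : R := (Num.truncn ((clamp K y + K) / eta) == i)%:R.

Lemma cell_ge0 K eta i y : 0 <= cell K eta i y.
Proof. exact: ler0n. Qed.

Lemma cellE K eta i y : 0 <= K -> 0 < eta ->
  cell K eta i y = \1_(`[i%:R * eta, i.+1%:R * eta[%classic) (clamp K y + K).
Proof.
move=> K0 eta0; rewrite /cell indicE; congr (_%:R); congr nat_of_bool.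
have t0 : 0 <= (clamp K y + K) / eta.
  by rewrite divr_ge0 ?(ltW eta0)// -lerBlDr sub0r; have := clamp_norm y K0; rewrite ler_norml => /andP[].
rewrite mem_setE in_itv /= -ler_pdivlMr// -ltr_pdivrMr//.
apply/eqP/idP => [<-|/truncn_def//]; exact: truncn_itv.
Qed.

Lemma measurable_cell K eta i : 0 <= K -> 0 < eta -> measurable_fun setT (cell K eta i).
Proof.
move=> K0 eta0; rewrite (_ : cell K eta i = \1_(`[i%:R * eta, i.+1%:R * eta[%classic) \o (fun y => clamp K y + K)).
  apply: measurableT_comp; first exact: measurable_indic.
  apply: measurable_funD => //; apply: continuous_measurable_fun; exact: clamp_continuous.
by apply/funext => y; rewrite /= cellE.
Qed.

Lemma cell_sum K eta m y : 0 <= K -> 0 < eta -> 2 * K < m%:R * eta ->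
  \sum_(i < m) cell K eta i y = 1.
Proof.
move=> K0 eta0 hm; have := clamp_norm y K0; rewrite ler_norml => /andP[y0 y1].
have t0 : 0 <= (clamp K y + K) / eta by rewrite divr_ge0 ?(ltW eta0)// -lerBlDr sub0r.
have tm : (Num.truncn ((clamp K y + K) / eta) < m)%N.
  rewrite -(ltr_nat R); apply: le_lt_trans (proj1 (andP (truncn_itv t0))) _.
  by rewrite ltr_pdivrMr//; apply: le_lt_trans hm; lra.
rewrite (bigD1 (Ordinal tm)) //= /cell eqxx big1 ?addr0// => i ne.
by rewrite eq_sym -val_eqE /= in ne; rewrite (negbTE ne).
Qed.

Lemma cell_close K eta i y : 0 < eta -> `|y| <= K -> cell K eta i y != 0 ->
  `|y - (i%:R * eta - K)| <= eta.
Proof.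
move=> eta0 yK; rewrite /cell pnatr_eq0 eqb0 negbK (clamp_id yK) => /eqP <-.
move: yK; rewrite ler_norml => /andP[y0 y1].
have t0 : 0 <= (y + K) / eta by rewrite divr_ge0 ?(ltW eta0)// -lerBlDr sub0r.
have /andP[] := truncn_itv t0; rewrite ler_pdivlMr// ltr_pdivrMr// -natr1.
by set a := _%:R; clearbody a => h1 h2; rewrite ler_norml; apply/andP; split; lra.
Qed.

Variables (K eta : R) (m : nat).
Hypotheses (K0 : 0 <= K) (eta0 : 0 < eta) (Km : 2 * K < m%:R * eta).

Definition weight (k : {ffun 'I_d -> 'I_m}) (y : 'I_d -> R) : R := \prod_j cell K eta (k j) (y j).
Definition node (k : {ffun 'I_d -> 'I_m}) : 'rV[R]_d := \row_j ((k j)%:R * eta - K).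
Definition grid phi x (y : 'I_d -> R) : R := \sum_k phi (x, node k) * weight k y.

Lemma weight_ge0 k (y : 'I_d -> R) : 0 <= weight k y.
Proof. by apply: prodr_ge0 => j _; exact: cell_ge0. Qed.

Lemma weight_sum (y : 'I_d -> R) : \sum_k weight k y = 1.
Proof.
rewrite /weight -(bigA_distr_bigA (fun j (i : 'I_m) => cell K eta i (y j))).
by rewrite big1// => j _; exact: cell_sum.
Qed.

(** The weights are nonnegative with sum 1, so the grid value is a convex combination of values at
    nodes of nonzero weight. *)
Lemma grid_dist phi x (y : 'I_d -> R) v e :
  (forall k, weight k y != 0 -> `|phi (x, node k) - v| <= e) -> `|grid phi x y - v| <= e.
Proof.
move=> h; rewrite -[v]mulr1 -(weight_sum y) mulr_sumr /grid -sumrB.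
rewrite -[leRHS]mulr1 -(weight_sum y) mulr_sumr.
apply: le_trans (ler_norm_sum _ _ _) _; apply: ler_sum => k _.
rewrite -mulrBl normrM (ger0_norm (weight_ge0 k y)).
have [->|kn] := eqVneq (weight k y) 0; first by rewrite !mulr0.
by rewrite ler_wpM2r ?weight_ge0// h.
Qed.

Lemma node_close k (y : 'I_d -> R) j : (forall i, `|y i| <= K) -> weight k y != 0 ->
  `|y j - node k 0 j| <= eta.
Proof.
move=> yK /prodf_neq0 /(_ j isT) h; rewrite mxE; exact: cell_close.
Qed.
End grid.

Section joint_observables.
Context (R : realType) (d : nat) (phi : R * 'rV[R]_d -> R).
Hypothesis phi_continuous : continuous phi.

Lemma section_continuous (r : 'rV[R]_d) : continuous (fun x => phi (x, r)).
Proof.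
move=> x; apply: (@continuous_comp _ _ _ (fun x => (x, r)) phi); last exact: phi_continuous.
move=> A [[B C] /= [hB hC] hBC]; apply: filterS hB => y By; apply: hBC; split=> //=.
exact: nbhs_singleton.
Qed.

Lemma ball_pair (x x' dl : R) (r r' : 'rV[R]_d) : 0 < dl -> `|x - x'| < dl ->
  (forall j, `|r 0 j - r' 0 j| < dl) -> ball (x, r) dl (x', r').
Proof.
move=> dl0 hx hr; split; first by rewrite -ball_normE.
split=> //= i j; have -> : i = 0 := ord1 i; rewrite -ball_normE; exact: hr.
Qed.

Context (dT : measure_display) (T : measurableType dT).
Implicit Types (x : T -> R) (y : 'I_d -> T -> R).

Lemma measurable_weight K eta m (k : {ffun 'I_d -> 'I_m}) y : 0 <= K -> 0 < eta ->
  (forall j, measurable_fun setT (y j)) ->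
  measurable_fun setT (fun w => weight K eta k (fun j => y j w)).
Proof.
move=> K0 eta0 my; apply: measurable_prod => j _.
by apply: (measurableT_comp (f := cell K eta (k j))); [exact: measurable_cell|exact: my].
Qed.

Lemma measurable_grid K eta m x y : 0 <= K -> 0 < eta ->
  measurable_fun setT x -> (forall j, measurable_fun setT (y j)) ->
  measurable_fun setT (fun w => grid K eta m phi (x w) (fun j => y j w)).
Proof.
move=> K0 eta0 mx my; apply: measurable_sum => k; apply: measurable_funM.
  apply: (measurableT_comp (f := fun z : R => phi (z, node K eta k))) mx.
  by apply: continuous_measurable_fun; exact: section_continuous.
exact: measurable_weight.
Qed.

(** The function is the pointwise limit of the measurable grids with K = n + 1 and mesh 1 / (n +
    1). *)
Lemma measurable_joint x y : measurable_fun setT x -> (forall j, measurable_fun setT (y j)) ->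
  measurable_fun setT (fun w => phi (x w, rvec y w)).
Proof.
move=> mx my.
pose m n := (Num.truncn (2 * n.+1%:R / (n.+1%:R^-1 : R))).+1.
have n0 n : 0 < n.+1%:R :> R by rewrite ltr0n.
have hm n : 2 * n.+1%:R < (m n)%:R * (n.+1%:R^-1 : R).
  by rewrite -ltr_pdivrMr ?invr_gt0// truncnS_gt.
apply: (@measurable_fun_cvg _ _ _ _ (fun n w => grid n.+1%:R n.+1%:R^-1 (m n) phi (x w) (fun j => y j w))).
  by move=> n; apply: measurable_grid => //; rewrite ?invr_gt0.
move=> w _; apply/cvgrPdist_le => e e0.
have /cvgrPdist_le/(_ _ e0)/nbhs_ballP[dl /= dl0 hdl] := @phi_continuous (x w, rvec y w).
exists (Num.truncn (\sum_j `|y j w| + dl^-1)).+1 => // n /= hn.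
have nS : \sum_j `|y j w| + dl^-1 < n.+1%:R.
  by apply: lt_trans (truncnS_gt _) _; rewrite ltr_nat.
have S0 : 0 <= \sum_j `|y j w| by apply: sumr_ge0.
have nd : n.+1%:R^-1 < dl.
  by rewrite invf_plt ?posrE//; apply: le_lt_trans nS; rewrite lerDr.
have yn j : `|y j w| <= n.+1%:R.
  rewrite ltW//; apply: le_lt_trans nS; rewrite (bigD1 j) //= -addrA lerDl addr_ge0 ?invr_ge0 ?(ltW dl0)//.
  exact: sumr_ge0.
rewrite distrC; apply: grid_dist => // k wk.
rewrite distrC; apply: hdl; apply: ball_pair => //; first by rewrite subrr normr0.
move=> j; rewrite [rvec _ _ _ _]mxE; apply: le_lt_trans nd.
exact: node_close wk.
Qed.
End joint_observables.

Section grid_estimate.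
Context (R : realType) (d : nat) (phi : R * 'rV[R]_d -> R) (M : R).
Hypotheses (phi_continuous : continuous phi) (phi_bounded : forall a, `|phi a| <= M).

(** A value below 1 confines f and y0 to the cube of radius K and makes x, y dl-close to them; from
    1 on, [2 * M * deviation] exceeds the trivial bound 2 M. Being quadratic, it needs only second
    moments. *)
Definition deviation (K dl x f : R) (y y0 : 'I_d -> R) : R :=
  K ^- 2 * (f ^+ 2 + \sum_j y0 j ^+ 2) + dl ^- 2 * ((x - f) ^+ 2 + \sum_j (y j - y0 j) ^+ 2).

Lemma grid_norm K eta m x (y : 'I_d -> R) : 0 <= K -> 0 < eta -> 2 * K < m%:R * eta ->
  `|grid K eta m phi x y| <= M.
Proof.
move=> K0 eta0 Km; rewrite -[grid _ _ _ _ _ _]subr0; apply: grid_dist => // k _.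
by rewrite subr0.
Qed.

Lemma grid_estimate K e : 0 < K -> 0 < e -> exists eta m dl,
  [/\ 0 < eta, 2 * K < m%:R * eta, 0 < dl &
   forall x f (y y0 : 'I_d -> R),
     `|phi (x, \row_j y j) - grid K eta m phi f y0| <= 2 * e + 2 * M * deviation K dl x f y y0].
Proof.
move=> K0 e0.
have cA : compact ([set x : R | `|x| <= K] `*` [set r : 'rV[R]_d | forall j, `|r 0 j| <= K]).
  have cK : compact [set x : R | `|x| <= K].
    rewrite (_ : [set x | _] = `[- K, K]%classic); first exact: segment_compact.
    by apply/seteqP; split=> x /=; rewrite in_itv /= ler_norml.
  by apply: compact_setX => //; exact: (@rV_compact R d (fun=> [set x : R | `|x| <= K])).
have [dl dl0 hdl] := heine phi_continuous cA e0.
(* Half of dl, because nodes are known to be within eta in the wide sense and must be strictly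
   within dl. *)
pose eta := dl / 2; have eta0 : 0 < eta by rewrite divr_gt0.
pose m := (Num.truncn (2 * K / eta)).+1.
have Km : 2 * K < m%:R * eta by rewrite -ltr_pdivrMr// truncnS_gt.
have M0 : 0 <= M := le_trans (normr_ge0 _) (phi_bounded (0, 0)).
exists eta, m, dl; split=> // x f y y0.
have S0 (z : 'I_d -> R) : 0 <= \sum_j z j ^+ 2 by apply: sumr_ge0 => j _; exact: sqr_ge0.
have le_S (z : 'I_d -> R) j : z j ^+ 2 <= \sum_j z j ^+ 2.
  by rewrite (bigD1 j) //= lerDl; apply: sumr_ge0 => i _; exact: sqr_ge0.
have K2 : 0 <= K ^- 2 by rewrite invr_ge0 sqr_ge0.
have dl2 : 0 <= dl ^- 2 by rewrite invr_ge0 sqr_ge0.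
have D1 : 0 <= K ^- 2 * (f ^+ 2 + \sum_j y0 j ^+ 2) by rewrite mulr_ge0// addr_ge0 ?sqr_ge0.
have D2 : 0 <= dl ^- 2 * ((x - f) ^+ 2 + \sum_j (y j - y0 j) ^+ 2).
  by rewrite mulr_ge0// addr_ge0 ?sqr_ge0// (S0 (fun j => y j - y0 j)).
have [D_ge1|D_lt1] := leP 1 (deviation K dl x f y y0).
  apply: (@le_trans _ _ (2 * M)).
    apply: le_trans (ler_normB _ _) _.
    by have := phi_bounded (x, \row_j y j); have := grid_norm f y0 (ltW K0) eta0 Km; lra.
  have h := ler_wpM2l (mulr_ge0 (ler0n R 2) M0) D_ge1.
  by move: h; rewrite mulr1; set a := 2 * M * _; clearbody a; lra.
have small (c a b : R) : 0 < c -> a ^+ 2 <= b -> c ^- 2 * b < 1 -> `|a| < c.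
  move=> c0 ab; rewrite mulrC ltr_pdivrMr ?exprn_gt0// mul1r => bc.
  by rewrite -(@ltr_pXn2r _ 2)// ?nnegrE ?(ltW c0)// real_normK ?num_real// (le_lt_trans ab).
have [c1 c2] : K ^- 2 * (f ^+ 2 + \sum_j y0 j ^+ 2) < 1 /\
    dl ^- 2 * ((x - f) ^+ 2 + \sum_j (y j - y0 j) ^+ 2) < 1.
  by move: D_lt1 D1 D2; rewrite /deviation; set a := K ^- 2 * _; set b := dl ^- 2 * _; clearbody a b; lra.
have fK : `|f| <= K by apply/ltW/(small _ _ _ K0 _ c1); rewrite lerDl.
have y0K j : `|y0 j| <= K.
  by apply/ltW/(small _ _ _ K0 _ c1); apply: le_trans (le_S _ j) _; rewrite lerDr sqr_ge0.
have xf : `|f - x| < dl.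
  by rewrite distrC; apply: (small _ _ _ dl0 _ c2); rewrite lerDl (S0 (fun j => y j - y0 j)).
have yy j : `|y0 j - y j| < dl.
  rewrite distrC; apply: (small _ _ _ dl0 _ c2).
  by apply: le_trans (le_S (fun j => y j - y0 j) j) _; rewrite lerDr sqr_ge0.
have Af : ([set x : R | `|x| <= K] `*` [set r : 'rV[R]_d | forall j, `|r 0 j| <= K]) (f, \row_j y0 j).
  by split=> //= j; rewrite mxE.
have h1 : `|phi (f, \row_j y0 j) - phi (x, \row_j y j)| <= e.
  by apply: hdl => //; apply: ball_pair => // j; rewrite !mxE.
have h2 : `|grid K eta m phi f y0 - phi (f, \row_j y0 j)| <= e.
  apply: grid_dist => //; first exact: ltW.
  move=> k wk; rewrite distrC; apply: hdl => //; apply: ball_pair => //; first by rewrite subrr normr0.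
  move=> j; rewrite [_ 0 j]mxE; apply: (@le_lt_trans _ _ eta).
    exact: node_close wk.
  by rewrite /eta ltr_pdivrMr// ltr_pMr// ltr1n.
have Dv : 0 <= 2 * M * deviation K dl x f y y0 by rewrite !mulr_ge0// addr_ge0.
move: Dv h1 h2; set a := 2 * M * _; clearbody a; rewrite !ler_norml => a0 /andP[? ?] /andP[? ?].
by apply/andP; split; lra.
Qed.

Context (dT : measure_display) (T : measurableType dT) (P : probability T R).
Implicit Types (x f : T -> R) (y : 'I_d -> T -> R).

Lemma intg_joint x y : measurable_fun setT x -> (forall j, measurable_fun setT (y j)) ->
  intg P (fun w => phi (x w, rvec y w)).
Proof. by move=> mx my; apply: (@intg_bounded _ _ _ P _ M) => //; exact: measurable_joint. Qed.

Lemma L2_weight K eta m (k : {ffun 'I_d -> 'I_m}) y : 0 <= K -> 0 < eta ->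
  2 * K < m%:R * eta -> (forall j, measurable_fun setT (y j)) ->
  L2 P (fun w => weight K eta k (fun j => y j w)).
Proof.
move=> K0 eta0 Km my; apply: (@L2_bounded _ _ _ P _ 1); first exact: measurable_weight.
move=> w; rewrite ger0_norm ?weight_ge0// -(weight_sum K0 eta0 Km (fun j => y j w)) (bigD1 k) //= lerDl.
by apply: sumr_ge0 => i _; exact: weight_ge0.
Qed.

Lemma Ex_grid_close K e eta m dl x f y (y0 : 'I_d -> T -> R) :
  (forall a b (r r0 : 'I_d -> R),
     `|phi (a, \row_j r j) - grid K eta m phi b r0| <= 2 * e + 2 * M * deviation K dl a b r r0) ->
  0 < K -> 0 < eta -> 2 * K < m%:R * eta ->
  measurable_fun setT x -> L2 P f -> L2 P (fun w => x w - f w) ->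
  (forall j, measurable_fun setT (y j)) -> (forall j, L2 P (y0 j)) ->
  (forall j, L2 P (fun w => y j w - y0 j w)) ->
  `|Ex P (fun w => phi (x w, rvec y w)) - Ex P (fun w => grid K eta m phi (f w) (fun j => y0 j w))| <=
  2 * e + 2 * M * (K ^- 2 * (Ex P (fun w => f w ^+ 2) + \sum_j Ex P (fun w => y0 j w ^+ 2)) +
    dl ^- 2 * (Ex P (fun w => (x w - f w) ^+ 2) + \sum_j Ex P (fun w => (y j w - y0 j w) ^+ 2))).
Proof.
move=> h K0 eta0 Km mx [mf if2] [_ ixf] my Ly0 Lyy.
have i1 : intg P (fun w => \sum_j y0 j w ^+ 2) by apply: intg_sum => j; case: (Ly0 j).
have i2 : intg P (fun w => \sum_j (y j w - y0 j w) ^+ 2) by apply: intg_sum => j; case: (Lyy j).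
have -> : K ^- 2 * (Ex P (fun w => f w ^+ 2) + \sum_j Ex P (fun w => y0 j w ^+ 2)) +
    dl ^- 2 * (Ex P (fun w => (x w - f w) ^+ 2) + \sum_j Ex P (fun w => (y j w - y0 j w) ^+ 2)) =
    Ex P (fun w => deviation K dl (x w) (f w) (fun j => y j w) (fun j => y0 j w)).
  rewrite -!Ex_sum; try (by move=> j; case: (Lyy j)); try by move=> j; case: (Ly0 j).
  by rewrite -!ExD// -!ExZ ?ExD//; try exact: intgD; apply: intgZ; exact: intgD.
apply: Ex_close.
- exact: intg_joint.
- apply: (@intg_bounded _ _ _ P _ M) => [|w]; last by apply: grid_norm => //; exact: ltW.
  by apply: measurable_grid => // [|j]; [exact: ltW|case: (Ly0 j)].
- by apply: intgD; apply: intgZ; exact: intgD.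
- by move=> w; exact: h.
Qed.
End grid_estimate.

(** * Expectations on a product space *)

Section product_expectation.
Context (R : realType) (d1 d2 : measure_display).
Context (T1 : measurableType d1) (T2 : measurableType d2).
Variables (P1 : probability T1 R) (P2 : probability T2 R).
Local Notation P12 := ((P1 \x P2)%E : probability (T1 * T2)%type R).

Lemma product_expectation (f : T1 -> R) (g : T2 -> R) : intg P1 f -> intg P2 g ->
  intg P12 (fun z => f z.1 * g z.2) /\ Ex P12 (fun z => f z.1 * g z.2) = Ex P1 f * Ex P2 g.
Proof.
move=> hf hg; have mfg : measurable_fun setT (fun z : T1 * T2 => f z.1 * g z.2).
  apply: measurable_funM.
    exact: (measurableT_comp (intg_measurable hf) measurable_fst).
  exact: (measurableT_comp (intg_measurable hg) measurable_snd).
have hi : intg P12 (fun z => f z.1 * g z.2).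
  apply/(integrable12ltyP P1 P2); first exact/measurable_EFinP.
  rewrite (eq_integral (fun x => (`|f x| * Ex P2 (fun y => `|g y|))%:E)) => [|x _].
    by rewrite intg_EFin ?ltry//; under eq_fun do rewrite mulrC; exact/intgZ/intg_norm.
  rewrite /= (eq_integral (fun y => (`|f x| * `|g y|)%:E)) => [|y _]; last by rewrite normrM.
  by rewrite intg_EFin; [rewrite ExZ//; exact: intg_norm|apply: intgZ; exact: intg_norm].
split=> //; have := integral12_prod_meas1 hi; rewrite (intg_EFin hi) => h; apply: EFin_inj.
rewrite -h (eq_integral (fun x => (f x * Ex P2 g)%:E)) => [|x _].
  have mfc : intg P1 (fun x => f x * Ex P2 g) by under eq_fun do rewrite mulrC; exact: intgZ.
  rewrite (intg_EFin mfc); congr (_%:E).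
  by under eq_fun do rewrite mulrC; rewrite ExZ// mulrC.
by rewrite /fubini_F /= intg_EFin; [rewrite ExZ|exact: intgZ].
Qed.

Lemma product_expectation_fst (f : T1 -> R) : intg P1 f ->
  intg P12 (fun z => f z.1) /\ Ex P12 (fun z => f z.1) = Ex P1 f.
Proof.
move=> hf; have := product_expectation hf (intg_cst P2 1); rewrite Ex_cst mulr1.
by under eq_fun do rewrite mulr1.
Qed.

Lemma product_expectation_snd (g : T2 -> R) : intg P2 g ->
  intg P12 (fun z => g z.2) /\ Ex P12 (fun z => g z.2) = Ex P2 g.
Proof.
move=> hg; have := product_expectation (intg_cst P1 1) hg; rewrite Ex_cst mul1r.
by under eq_fun do rewrite mul1r.
Qed.

Lemma product_setTX (A : set T2) : P12 (setT `*` A) = P2 A.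
Proof.
rewrite /= /product_measure1 (eq_integral (fun=> P2 A)) => [|x _].
  by rewrite integral_cst//= -[RHS]mule1; congr (_ * _)%E; exact: probability_setT.
congr (P2 _); apply/seteqP; split=> y; rewrite /xsection /= inE.
  by case.
by move=> Ay; split.
Qed.
End product_expectation.

Section joint_convergence.
Context (R : realType) (dT dG : measure_display).
Context (T : measurableType dT) (G : measurableType dG).
Variables (P : probability T R) (gam : probability G R) (Z : G -> R).
Hypothesis L2_Z : L2 gam Z.
Context (d : nat).
Variables (x f : nat -> T -> R) (y : nat -> 'I_d -> T -> R) (yoo : 'I_d -> T -> R).
Hypotheses (mx : forall n, measurable_fun setT (x n)) (L2_f : forall n, L2 P (f n)).
Hypotheses (L2_xf : forall n, L2 P (fun w => x n w - f n w))
  (xf_cvg : Ex P (fun w => (x n w - f n w) ^+ 2) @[n --> \oo] --> (0 : R))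
  (f_bounded : exists B, \forall n \near \oo, Ex P (fun w => f n w ^+ 2) <= B).
Hypotheses (my : forall n j, measurable_fun setT (y n j)) (L2_yoo : forall j, L2 P (yoo j))
  (L2_yy : \forall n \near \oo, forall j, L2 P (fun w => y n j w - yoo j w))
  (yy_cvg : \sum_j Ex P (fun w => (y n j w - yoo j w) ^+ 2) @[n --> \oo] --> (0 : R)).
Hypothesis mixing : forall (psi : R -> R) (M : R) (g : T -> R), continuous psi ->
  (forall a, `|psi a| <= M) -> L2 P g ->
  Ex P (fun w => psi (f n w) * g w) @[n --> \oo] --> Ex gam (psi \o Z) * Ex P g.

Local Notation P' := ((gam \x P)%E : probability (G * T)%type R).

Lemma grid_cvg (phi : R * 'rV[R]_d -> R) (M K eta : R) m : continuous phi ->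
  (forall a, `|phi a| <= M) -> 0 <= K -> 0 < eta -> 2 * K < m%:R * eta ->
  Ex P (fun w => grid K eta m phi (f n w) (fun j => yoo j w)) @[n --> \oo] -->
  Ex P' (fun z => grid K eta m phi (Z z.1) (fun j => yoo j z.2)).
Proof.
move=> cphi hM K0 eta0 Km.
have myoo j : measurable_fun setT (yoo j) by case: (L2_yoo j).
have Lw (k : {ffun 'I_d -> 'I_m}) : L2 P (fun w => weight K eta k (fun j => yoo j w)) by exact: L2_weight.
have csec k := @section_continuous _ _ _ cphi k.
have mZ : measurable_fun setT Z by case: L2_Z.
have iZ k : intg gam (fun z => phi (Z z, k)).
  by apply: (@intg_continuous_bounded _ _ _ gam Z (fun a => phi (a, k)) M) => // a; exact: csec.
have L2f n k : L2 P (fun w => phi (f n w, k)).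
  apply: (@L2_bounded _ _ _ P _ M) => //; have [mf _] := L2_f n.
  by apply: (measurableT_comp (f := fun a => phi (a, k))) => //; exact: continuous_measurable_fun.
rewrite (_ : Ex P' _ = \sum_(k : {ffun 'I_d -> 'I_m}) Ex gam (fun z => phi (Z z, node K eta k)) *
    Ex P (fun w => weight K eta k (fun j => yoo j w))); last first.
  have h (k : {ffun 'I_d -> 'I_m}) := product_expectation (iZ (node K eta k)) (L2_intg (Lw k)).
  rewrite /grid Ex_sum => [|k]; last by case: (h k).
  by apply: eq_bigr => k _; case: (h k).
rewrite (_ : (fun n => _) = fun n => \sum_(k : {ffun 'I_d -> 'I_m}) Ex P (fun w => phi (f n w, node K eta k) *
    weight K eta k (fun j => yoo j w))); last first.
  by apply/funext => n; rewrite /grid Ex_sum// => k; exact: L2_prod.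
apply: cvg_big => [|k _]; first exact: add_continuous.
exact: (@mixing (fun a => phi (a, node K eta k)) M _ (csec (node K eta k)) (fun a => hM _) (Lw k)).
Qed.

Lemma joint_cvg (phi : R * 'rV[R]_d -> R) (M : R) : continuous phi ->
  (forall a, `|phi a| <= M) ->
  Ex P (fun w => phi (x n w, rvec (y n) w)) @[n --> \oo] -->
  Ex P' (fun z => phi (Z z.1, rvec yoo z.2)).
Proof.
move=> cphi hM; apply/cvgrPdist_le => eps e0.
have M0 : 0 <= M := le_trans (normr_ge0 _) (hM (0, 0)).
have [B hB] := f_bounded.
have [mZ iZ2] := L2_Z.
pose Sy := \sum_j Ex P (fun w => yoo j w ^+ 2).
have Sy0 : 0 <= Sy by apply: sumr_ge0 => j _; apply: Ex_ge0 => w; exact: sqr_ge0.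
pose Sz := Ex gam (fun z => Z z ^+ 2).
have Sz0 : 0 <= Sz by apply: Ex_ge0 => w; exact: sqr_ge0.
pose S := `|B| + Sy + Sz.
have S0 : 0 <= S by rewrite !addr_ge0.
(* As K >= 1, K^-2 <= K^-1; then K eps / 8 >= 2 M S bounds the truncation cost by eps / 8. *)
pose K := 1 + 16 * M * S / eps.
have K1 : 1 <= K by rewrite lerDl divr_ge0 ?mulr_ge0// ltW.
have K0 : 0 < K by exact: lt_le_trans K1.
have KS : 2 * M * (K ^- 2 * S) <= eps / 8.
  have KK : K ^- 2 <= K^-1 by rewrite lef_pV2 ?posrE ?exprn_gt0// ler_eXnr.
  apply: (@le_trans _ _ (2 * M * (K^-1 * S))).
    by rewrite ler_wpM2l ?mulr_ge0// ler_wpM2r.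
  rewrite mulrCA ler_pdivrMl//.
  have -> : K * (eps / 8) = eps / 8 + 2 * M * S by rewrite /K; field; rewrite gt_eqF.
  by rewrite lerDr divr_ge0// ltW.
have e16 : 0 < eps / 16 by rewrite divr_gt0.
have e8 : 0 < eps / 8 by rewrite divr_gt0.
have [eta [m [dl [eta0 Km dl0 hgrid]]]] := grid_estimate cphi hM K0 e16.
pose c := 2 * M * dl ^- 2 + 1.
have c0 : 0 < c by rewrite ltr_wpDl// mulr_ge0 ?mulr_ge0// invr_ge0 sqr_ge0.
have /cvgrPdist_le/(_ _ e8) k1 := grid_cvg cphi hM (ltW K0) eta0 Km.
have /cvgrPdist_le/(_ _ (divr_gt0 (divr_gt0 e8 c0) (ltr0Sn R 1))) k2 := xf_cvg.
have /cvgrPdist_le/(_ _ (divr_gt0 (divr_gt0 e8 c0) (ltr0Sn R 1))) k3 := yy_cvg.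
have L2y' j : L2 P' (fun z => yoo j z.2).
  have [myj iyj] := L2_yoo j; have [h _] := product_expectation_snd gam iyj.
  by split=> //; exact: (measurableT_comp myj measurable_snd).
have L2z' : L2 P' (fun z => Z z.1).
  have [h _] := product_expectation_fst P iZ2.
  by split=> //; exact: (measurableT_comp mZ measurable_fst).
(* The limit pair is compared with itself, so only the truncation half of [deviation] remains. *)
have k4 : `|Ex P' (fun z => phi (Z z.1, rvec yoo z.2)) -
    Ex P' (fun z => grid K eta m phi (Z z.1) (fun j => yoo j z.2))| <= eps / 8 + eps / 8.
  have z0 (h : G * T -> R) : L2 P' (fun z => h z - h z) /\ Ex P' (fun z => (h z - h z) ^+ 2) = 0.
    split; first by under eq_fun do rewrite subrr; exact: L2_cst.
    by under eq_fun do rewrite subrr expr0n /=; rewrite Ex_cst.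
  have := @Ex_grid_close R d phi M cphi hM _ _ P' K (eps / 16) eta m dl (fun z => Z z.1) (fun z => Z z.1)
    (fun j z => yoo j z.2) (fun j z => yoo j z.2) hgrid K0 eta0 Km (proj1 L2z') L2z' (proj1 (z0 _))
    (fun j => proj1 (L2y' j)) L2y' (fun j => proj1 (z0 _)).
  move=> /le_trans; apply; apply: lerD; first by lra.
  apply: le_trans KS; rewrite ler_wpM2l ?mulr_ge0//.
  rewrite (proj2 (z0 _)) [X in 0 + X]big1 => [|j _]; last exact: (proj2 (z0 _)).
  rewrite addr0 mulr0 addr0 ler_wpM2l ?invr_ge0 ?sqr_ge0//.
  rewrite (proj2 (product_expectation_fst P iZ2)) -/Sz.
  rewrite (eq_bigr (fun j => Ex P (fun w => yoo j w ^+ 2))) => [|j _].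
    by rewrite -/Sy /S addrC lerD2r lerDr.
  by have [_ iyj] := L2_yoo j; have [_] := product_expectation_snd gam iyj.
near=> n.
have l0 : forall j, L2 P (fun w => y n j w - yoo j w) by near: n.
have l1 : `|Ex P' (fun z => grid K eta m phi (Z z.1) (fun j => yoo j z.2)) -
  Ex P (fun w => grid K eta m phi (f n w) (fun j => yoo j w))| <= eps / 8 by near: n.
have l2 : `|0 - Ex P (fun w => (x n w - f n w) ^+ 2)| <= eps / 8 / c / 2 by near: n.
have l3 : `|0 - \sum_j Ex P (fun w => (y n j w - yoo j w) ^+ 2)| <= eps / 8 / c / 2 by near: n.
have l4 : Ex P (fun w => f n w ^+ 2) <= B by near: n.
have := @Ex_grid_close R d phi M cphi hM _ _ P K (eps / 16) eta m dl (x n) (f n) (y n) yoo hgrid K0 eta0 Km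
  (mx n) (L2_f n) (L2_xf n) (my n) L2_yoo l0.
rewrite -/Sy.
have i1 : 2 * M * (K ^- 2 * (Ex P (fun w => f n w ^+ 2) + Sy)) <= eps / 8.
  apply: le_trans KS; rewrite !ler_wpM2l ?mulr_ge0 ?invr_ge0 ?sqr_ge0//.
  by have := ler_norm B; rewrite /S; lra.
move: l2 l3; rewrite !sub0r !normrN => l2 l3.
have i2 : 2 * M * (dl ^- 2 * (Ex P (fun w => (x n w - f n w) ^+ 2) +
    \sum_j Ex P (fun w => (y n j w - yoo j w) ^+ 2))) <= eps / 8.
  have l5 := lerD (le_trans (ler_norm _) l2) (le_trans (ler_norm _) l3); rewrite -splitr in l5.
  apply: (@le_trans _ _ (2 * M * dl ^- 2 * (eps / 8 / c))).
    by rewrite mulrA ler_wpM2l// !mulr_ge0// invr_ge0 sqr_ge0.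
  rewrite mulrCA ger_pMr// ler_pdivrMr// mul1r /c lerDl.
  exact: ler01.
rewrite mulrDr => h; have {}h := le_trans h (lerD (lexx _) (lerD i1 i2)).
move: k4 l1 h; clear.
set a1 := Ex P' _; set a2 := Ex P' _; set a3 := Ex P _; set a4 := Ex P _; clearbody a1 a2 a3 a4.
rewrite !ler_norml => /andP[? ?] /andP[? ?] /andP[? ?].
by apply/andP; split; lra.
Unshelve. all: by end_near. Qed.
End joint_convergence.

(** * Almost sure equality and L2 limits *)

Section almost_everywhere.
Context (R : realType) (d : measure_display) (T : measurableType d).
Variable P : probability T R.

Definition rv_of (f : T -> R) (mf : measurable_fun setT f) : {RV P >-> R} :=
  HB.pack f (@isMeasurableFun.Build _ _ _ _ f mf).

Lemma intg_ae (f g : T -> R) : measurable_fun setT f -> intg P g -> f = g %[ae P] -> intg P f.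
Proof.
move=> mf ig fg; apply/integrableP; split; first exact/measurable_EFinP.
move/integrableP: (ig) => [_]; congr (_ < _)%E.
apply: ae_eq_integral => //.
- by apply: measurableT_comp => //; exact/measurable_EFinP/(intg_measurable ig).
- by apply: measurableT_comp => //; exact/measurable_EFinP.
- by apply: filterS fg => w h /h /= ->.
Qed.

Lemma L2_ae (f g : T -> R) : measurable_fun setT f -> L2 P g -> f = g %[ae P] -> L2 P f.
Proof.
move=> mf [_ ig] fg; split=> //; apply: (intg_ae _ ig); first exact: measurable_funX.
by apply: filterS fg => w h /h /= ->.
Qed.

Lemma L2_Lfun (f : T -> R) : f \in Lfun P 2%:E -> L2 P f.
Proof.
move=> fL; split; last exact: Lfun2_integrable_sqr fL.
by move: fL; rewrite inE => /andP[]; rewrite inE.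
Qed.

Lemma Ex_mul_cvg0 (f g : nat -> T -> R) (B : R) :
  (\forall n \near \oo, L2 P (f n)) -> (\forall n \near \oo, L2 P (g n)) ->
  Ex P (fun w => f n w ^+ 2) @[n --> \oo] --> (0 : R) ->
  (\forall n \near \oo, Ex P (fun w => g n w ^+ 2) <= B) ->
  Ex P (fun w => f n w * g n w) @[n --> \oo] --> (0 : R).
Proof.
move=> Lf Lg f0 gB; apply/cvgrPdist_le => e e0.
have B0 : 0 < `|B| + 1 by rewrite ltr_wpDl.
pose dl := e / 2 / (`|B| + 1); have dl0 : 0 < dl by rewrite !divr_gt0.
have k0 : 0 < dl * (e / 2) by rewrite mulr_gt0// divr_gt0.
have /cvgrPdist_le/(_ _ k0) f0' := f0.
near=> n; rewrite sub0r normrN.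
have l1 : L2 P (f n) by near: n.
have l2 : L2 P (g n) by near: n.
have l3 : `|0 - Ex P (fun w => f n w ^+ 2)| <= dl * (e / 2) by near: n.
have l4 : Ex P (fun w => g n w ^+ 2) <= B by near: n.
apply: le_trans (Ex_mul_young l1 l2 dl0) _; rewrite [leRHS]splitr; apply: lerD.
  rewrite /dl mulrAC ler_pdivrMr// ler_wpM2l ?divr_ge0 ?(ltW e0)//.
  by apply: le_trans l4 _; have := ler_norm B; lra.
rewrite mulrC ler_pdivrMr// mulrC; apply: le_trans _ l3.
by rewrite sub0r normrN ler_norm.
Unshelve. all: by end_near. Qed.

(** Convergence of extended reals to 0 makes the expectations finite only eventually; hence square
    integrability for large n. *)
Lemma L2_cvgv_L2 k (Y : nat -> 'I_k -> {RV P >-> R}) (Y' : 'I_k -> {RV P >-> R}) :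
  L2_cvgv P (fun n => rvec (Y n)) (rvec Y') ->
  (\forall n \near \oo, forall j, L2 P (fun w => Y n j w - Y' j w)) /\
  \sum_j Ex P (fun w => (Y n j w - Y' j w) ^+ 2) @[n --> \oo] --> (0 : R).
Proof.
pose S n w := \sum_j (Y n j w - Y' j w) ^+ 2.
have SE n : (fun w => dotv (rvec (Y n) w - rvec Y' w) (rvec (Y n) w - rvec Y' w)) = S n.
  by apply/funext => w; apply: eq_bigr => j _; rewrite !mxE expr2.
rewrite /L2_cvgv; under eq_fun do rewrite SE; move=> /fine_cvgP[hfin hS].
have mY n j : measurable_fun setT (fun w => Y n j w - Y' j w) by exact: measurable_funB.
have S0 n w : 0 <= S n w by apply: sumr_ge0 => j _; exact: sqr_ge0.
have mS n : measurable_fun setT (S n) by apply: measurable_sum => j; exact: measurable_funX.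
have L n : ('E_P[S n])%E \is a fin_num -> forall j, L2 P (fun w => Y n j w - Y' j w).
  move=> Sfin j; split=> //.
  have [iS _] := expectation_ge0_intg (mS n) (S0 n) (esym (fineK Sfin)).
  apply: (le_intg _ iS) => [|w]; first exact: measurable_funX.
  rewrite !ger0_norm ?sqr_ge0// /S (bigD1 j) //= lerDl.
  by apply: sumr_ge0 => i _; exact: sqr_ge0.
split; first by apply: filterS hfin => n; exact: L.
apply: cvg_trans hS; apply: near_eq_cvg; apply: filterS hfin => n Sfin /=.
have [_ ES] := expectation_ge0_intg (mS n) (S0 n) (esym (fineK Sfin)).
by rewrite -ES Ex_sum// => j; case: (L n Sfin j).
Qed.
End almost_everywhere.

Lemma multiple_integral_sequence_approx (R : realType) (dO : measure_display)
    (Omega : measurableType dO) (P : probability Omega R) (H : hilbertType R)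
    (T : forall n, tensor_power H n) (W : H -> {RV P >-> R}) (W_isonormal : isonormal W)
    (I : forall n, T n -> {RV P >-> R}) (I_integral : multiple_integral W I)
    (p : nat) (p_gt0 : (0 < p)%N) (f : nat -> T p)
    (f_sym : forall n, f n \in symmetric_tensor (T p))
    (X : nat -> {RV P >-> R}) (X_def : forall n, (X n : Omega -> R) = (I p (f n) : Omega -> R) %[ae P]) :
  exists (m : nat -> nat) (c : forall n, 'I_(m n) -> R) (h : forall n, 'I_(m n) -> H),
    [/\ forall n i, `|h n i| = 1,
        forall n, L2 P (fun w => X n w - hermite_sum W p (c n) (h n) w) &
        Ex P (fun w => (X n w - hermite_sum W p (c n) (h n) w) ^+ 2) @[n --> \oo] --> (0 : R)].
Proof.
(* The number of Hermite terms varies with n, so coefficients and vectors are packed in a dependent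
   pair before [choice]. *)
have approx n : exists a : {m : nat & (('I_m -> R) * ('I_m -> H))%type},
    (forall i, `|(projT2 a).2 i| = 1) /\
    Ex P (fun w => (I p (f n) w - hermite_sum W p (projT2 a).1 (projT2 a).2 w) ^+ 2) <= n.+1%:R^-1.
  have n0 : 0 < n.+1%:R^-1 :> R by rewrite invr_gt0.
  have [m [c [h hE]]] := multiple_integral_approx W_isonormal I_integral p_gt0 (f_sym n) n0.
  by exists (existT _ m (c, h)).
have [a ha] := choice approx.
exists (fun n => projT1 (a n)), (fun n => (projT2 (a n)).1), (fun n => (projT2 (a n)).2).
set F := fun n => hermite_sum W p (projT2 (a n)).1 (projT2 (a n)).2.
have tF n : tame P (F n) by exact: hermite_sum_tame.
have mF n : measurable_fun setT (F n) by case: (tF n).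
have mXF n : measurable_fun setT (fun w => X n w - F n w) by exact: measurable_funB.
have ae_XF n : (fun w => X n w - F n w) = (fun w => I p (f n) w - F n w) %[ae P].
  by apply: filterS (X_def n) => w h /h ->.
have LI n := proj1 (multiple_integral_norm I_integral (f_sym n)).
have LXF n : L2 P (fun w => X n w - F n w).
  by apply: (L2_ae (mXF n) _ (ae_XF n)); apply: L2B; [exact: LI|exact/tame_L2].
split=> [n|//|]; first by case: (ha n).
apply: (@squeeze_cvgr _ _ _ _ (fun=> 0) (fun n => n.+1%:R^-1)).
- apply: nearW => n; rewrite Ex_ge0/= => [|w]; last exact: sqr_ge0.
  have [_] := ha n; congr (_ <= _); apply: Ex_ae.
  + by apply: measurable_funX; apply: measurable_funB => //; exact: mF.
  + by apply: measurable_funX; exact: mXF.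
  + by apply: filterS (X_def n) => w h /h ->.
- exact: cvg_cst.
- exact: cvg_harmonic.
Qed.

Lemma product_charfun (R : realType) (dO : measure_display) (Omega : measurableType dO)
    (P : probability Omega R) (sigma : R) (V : Omega -> R) (u : R) :
  0 < sigma -> measurable_fun setT V ->
  (cexpectation ((normal_prob 0 sigma : probability (measurableTypeR R) R) \x P)%E
    (fun z => expi (u * z.1 + V z.2)) =
  cexpectation P (fun w => expi (V w)) * (expR (- (sigma ^+ 2 * u ^+ 2 / 2)))%:C)%C.
Proof.
move=> sigma_gt0 mV; pose gam : probability (measurableTypeR R) R := normal_prob 0 sigma.
have cE (d' : measure_display) (T' : measurableType d') (Q : probability T' R) (g : T' -> R) :
  fine ('E_Q[g])%E = Ex Q g by rewrite expectationE.
rewrite /cexpectation !cE /=.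
have icos : intg gam (fun x : measurableTypeR R => cos (u * x)).
  apply: (@intg_bounded _ _ _ gam _ 1) => [|x]; last by rewrite ler_norml cos_geN1 cos_le1.
  by apply: measurableT_comp; [exact: continuous_measurable_fun (@continuous_cos R)|exact: measurable_funM].
have isin : intg gam (fun x : measurableTypeR R => sin (u * x)).
  apply: (@intg_bounded _ _ _ gam _ 1) => [|x]; last by rewrite ler_norml sin_geN1 sin_le1.
  exact: measurable_sin_mul.
have icosV : intg P (fun w => cos (V w)).
  apply: (@intg_bounded _ _ _ P _ 1) => [|x]; last by rewrite ler_norml cos_geN1 cos_le1.
  exact: (measurableT_comp (continuous_measurable_fun (@continuous_cos R)) mV).
have isinV : intg P (fun w => sin (V w)).
  apply: (@intg_bounded _ _ _ P _ 1) => [|x]; last by rewrite ler_norml sin_geN1 sin_le1.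
  exact: (measurableT_comp (continuous_measurable_fun (@continuous_sin R)) mV).
have [i1 e1] := product_expectation icos icosV.
have [i2 e2] := product_expectation isin isinV.
have [i3 e3] := product_expectation isin icosV.
have [i4 e4] := product_expectation icos isinV.
under [X in Ex _ X]eq_fun do rewrite cosD.
under [X in (_ +i* Ex _ X)%C]eq_fun do rewrite sinD.
rewrite ExB// ExD// e1 e2 e3 e4 Ex_normal_sin// Ex_normal_cos// !mul0r subr0 add0r.
by apply/eqP; rewrite eq_complex /= !mulr0 subr0 add0r; apply/andP; split; apply/eqP; rewrite mulrC.
Qed.

(** Split x y = (x - f) y + (y - z) f + f z: in the first two terms an L2-null factor meets an
    L2-bounded one. *)
Lemma Ex_mul_vanishing (R : realType) (d : measure_display) (T : measurableType d)
    (P : probability T R) (x f y : nat -> T -> R) (z : T -> R) (B : R) :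
  (forall n, L2 P (f n)) -> (forall n, L2 P (fun w => x n w - f n w)) ->
  Ex P (fun w => (x n w - f n w) ^+ 2) @[n --> \oo] --> (0 : R) ->
  (\forall n \near \oo, Ex P (fun w => f n w ^+ 2) <= B) ->
  L2 P z -> (\forall n \near \oo, L2 P (fun w => y n w - z w)) ->
  Ex P (fun w => (y n w - z w) ^+ 2) @[n --> \oo] --> (0 : R) ->
  Ex P (fun w => f n w * z w) @[n --> \oo] --> (0 : R) ->
  Ex P (fun w => x n w * y n w) @[n --> \oo] --> (0 : R).
Proof.
move=> Lf Lxf xf0 fB Lz Lyz yz0 fz0.
have Ly : \forall n \near \oo, L2 P (y n).
  apply: filterS Lyz => n h; have := L2D h Lz.
  by congr L2; apply/funext => w; rewrite subrK.
have yB : \forall n \near \oo, Ex P (fun w => y n w ^+ 2) <= 2 + 2 * Ex P (fun w => z w ^+ 2).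
  have /cvgrPdist_le/(_ _ ltr01) yz1 := yz0.
  near=> n.
  have l1 : `|0 - Ex P (fun w => (y n w - z w) ^+ 2)| <= 1 by near: n.
  have [_ i1] : L2 P (fun w => y n w - z w) by near: n.
  have [_ i2] : L2 P (y n) by near: n.
  have [_ i3] := Lz.
  apply: (@le_trans _ _ (2 * Ex P (fun w => (y n w - z w) ^+ 2) + 2 * Ex P (fun w => z w ^+ 2))).
    rewrite -!ExZ// -ExD; try exact: intgZ.
    apply: Ex_le => //; first by apply: intgD; exact: intgZ.
    by move=> w; have := sqr_ge0 (y n w - z w - z w); nra.
  rewrite lerD2r -[leRHS]mulr1 ler_wpM2l//; apply: le_trans _ l1.
  by rewrite sub0r normrN ler_norm.
have Lxf' : \forall n \near \oo, L2 P (fun w => x n w - f n w) by exact: nearW.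
have Lf' : \forall n \near \oo, L2 P (f n) by exact: nearW.
have a1 := Ex_mul_cvg0 Lxf' Ly xf0 yB.
have a2 := Ex_mul_cvg0 Lyz Lf' yz0 fB.
have {a1 a2} lim : Ex P (fun w => (x n w - f n w) * y n w) + Ex P (fun w => (y n w - z w) * f n w) +
    Ex P (fun w => f n w * z w) @[n --> \oo] --> (0 : R).
  by rewrite -[X in _ --> X]addr0 -[X in _ --> X + _]addr0; apply: cvgD fz0; exact: cvgD.
apply: cvg_trans lim; apply: near_eq_cvg.
near=> n.
have l1 : L2 P (fun w => y n w - z w) by near: n.
have l2 : L2 P (y n) by near: n.
have i1 := L2_prod (Lxf n) l2; have i2 := L2_prod l1 (Lf n); have i3 := L2_prod (Lf n) Lz.
rewrite /= -!ExD//; last exact: intgD.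
by congr Ex; apply/funext => w; ring.
Unshelve. all: by end_near. Qed.

Local Open Scope complex_scope.

Theorem theorem3 (R : realType)
    (dO : measure_display) (Omega : measurableType dO) (P : probability Omega R)
    (H : hilbertType R) (H_separable : separable H)
    (T : forall n : nat, tensor_power H n)
    (W : H -> {RV P >-> R}) (W_isonormal : isonormal W)
    (I : forall n : nat, T n -> {RV P >-> R})
    (I_integral : multiple_integral W I)
    (p : nat) (p_ge2 : (2 <= p)%N) (sigma : R) (sigma_gt0 : 0 < sigma)
    (f : nat -> T p)
    (f_sym : forall N, (1 <= N)%N -> f N \in symmetric_tensor (T p))
    (X : nat -> {RV P >-> R})
    (X_def : forall N, (1 <= N)%N ->
      (X N : Omega -> R) = (I p (f N) : Omega -> R) %[ae P])
    (X_cvg : cvg_in_law P (normal_prob 0 sigma)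
      (fun N => X N : Omega -> R) (fun x : R => x))
    (d : nat)
    (g : nat -> 'I_d -> forall k : nat, T k)
    (g_sym : forall N j k, (1 <= N)%N -> (1 <= k)%N ->
      g N j k \in symmetric_tensor (T k))
    (Y : nat -> 'I_d -> {RV P >-> R})
    (Y_def : forall N j, (1 <= N)%N ->
      L2_cvg P (fun n w => \sum_(1 <= k < n.+1) I k (g N j k) w) (Y N j))
    (Yoo : 'I_d -> {RV P >-> R})
    (Yoo_L2 : forall j, (Yoo j : Omega -> R) \in Lfun P 2%:E)
    (Y_cvg : L2_cvgv P (fun N => rvec (Y N)) (rvec Yoo))
    (rho : 'rV[R]_d)
    (XY_cvg : forall j,
      ('E_P[fun w => (X N w * Y N j w)%R])%E @[N --> \oo] --> (rho 0 j)%:E)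
    (tail_cvg : forall j,
      ereal_sup [set (\sum_(M.+1 <= k <oo) (k`!%:R * `|g N j k| ^+ 2)%:E)%E
                | N in [set N : nat | (1 <= N)%N]]
        @[M --> \oo] --> 0%E) :
  exists (dO' : measure_display) (Omega' : measurableType dO')
      (P' : probability Omega' R)
      (Z : {RV P' >-> R}) (Y' : 'I_d -> {RV P' >-> R}),
    [/\ has_law P' Z (normal_prob 0 sigma),
        same_law P P' (rvec Yoo) (rvec Y'),
        forall (u : R) (v : 'rV[R]_d),
          charfun_pair P' Z (rvec Y') u v =
          cexpectation P (fun w => expi (dotv v (rvec Yoo w))) *
          (expR (- (sigma ^+ 2 * u ^+ 2 / 2) - u * dotv rho v))%:C
      & cvg_in_law P P' (fun N w => (X N w, rvec (Y N) w))
          (fun w' => (Z w', rvec Y' w'))].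
Proof.
have p_gt0 : (0 < p)%N by exact: ltnW.
pose gam : probability (measurableTypeR R) R := normal_prob 0 sigma.
have tZ : tame gam (fun x : measurableTypeR R => x : R) := normal_tame sigma_gt0.
(* The hypotheses on f and X start at index 1, so all sequences are shifted by one. *)
have [m [c [h [h1 L2_XF XF_cvg]]]] := multiple_integral_sequence_approx W_isonormal I_integral p_gt0
  (fun n => f_sym n.+1 isT) (fun n => X_def n.+1 isT).
pose F n := hermite_sum W p (c n) (h n).
have tF n : tame P (F n) by exact: hermite_sum_tame.
have L2_F n : L2 P (F n) := tame_L2 (tF n).
have F_cvg : clamp_cvg P gam (fun x => x : R) F.
  apply: (@cvg_in_law_clamp _ _ _ P _ _ gam _ tZ (fun n => X n.+1)) => //.
    by move=> phi cphi bphi; have := X_cvg phi cphi bphi; rewrite -cvg_shiftS.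
  by move=> n; case: (tF n).
have [B F_bounded] := hermite_sum_moments_bounded W_isonormal sigma_gt0 h1 F_cvg 1.
rewrite muln1 in F_bounded.
have L2_Yoo j : L2 P (Yoo j) by exact: L2_Lfun.
have [L2_YY YY_cvg] : (\forall n \near \oo, forall j, L2 P (fun w => Y n.+1 j w - Yoo j w)) /\
    \sum_j Ex P (fun w => (Y n.+1 j w - Yoo j w) ^+ 2) @[n --> \oo] --> (0 : R).
  by apply: L2_cvgv_L2; move: Y_cvg; rewrite /L2_cvgv -cvg_shiftS.
(* Mixing with exponent 1 gives E[F_n Yoo_j] -> E[Z] E[Yoo_j] = 0; replacing F_n by X and Yoo by Y
   does not change the limit. *)
have rho0 j : rho 0 j = 0.
  have XY := XY_cvg j; rewrite -cvg_shiftS in XY; move/fine_cvgP: XY => [_ XY].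
  have yz_cvg : Ex P (fun w => (Y n.+1 j w - Yoo j w) ^+ 2) @[n --> \oo] --> (0 : R).
    apply: (squeeze_cvgr _ (cvg_cst 0) YY_cvg); apply: nearW => n.
    rewrite Ex_ge0 => [|w]; last exact: sqr_ge0.
    rewrite (bigD1 j) //= lerDl; apply: sumr_ge0 => i _; apply: Ex_ge0 => w; exact: sqr_ge0.
  have Fz_cvg : Ex P (fun w => F n w * Yoo j w) @[n --> \oo] --> (0 : R).
    have := mixing_L2 W_isonormal sigma_gt0 p_ge2 h1 F_cvg (a := 1%N) (L2_Yoo j).
    by rewrite (normal_odd_moment sigma_gt0 (k := 1))// mul0r.
  have L2_Yj : \forall n \near \oo, L2 P (fun w => Y n.+1 j w - Yoo j w).
    by apply: filterS L2_YY => n; exact.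
  have XY0 := Ex_mul_vanishing L2_F L2_XF XF_cvg F_bounded (L2_Yoo j) L2_Yj yz_cvg Fz_cvg.
  have e : (fine \o (fun n => 'E_P[fun w => (X n.+1 w * Y n.+1 j w)%R])%E) =
      fun n => Ex P (fun w => X n.+1 w * Y n.+1 j w).
    by apply/funext => n; rewrite /= expectationE.
  by rewrite e in XY; rewrite -(cvg_lim (@Rhausdorff R) XY) (cvg_lim (@Rhausdorff R) XY0).
have mY n j : measurable_fun setT (Y n.+1 j) by exact: measurable_funPT.
have mX n : measurable_fun setT (X n.+1) by exact: measurable_funPT.
have mixing (psi : R -> R) (M : R) (G : Omega -> R) : continuous psi ->
  (forall a, `|psi a| <= M) -> L2 P G ->
  Ex P (fun w => psi (F n w) * G w) @[n --> \oo] --> Ex gam (psi \o (fun x => x : R)) * Ex P G.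
  exact: mixing_continuous.
have mZ : measurable_fun setT (fun z : measurableTypeR R * Omega => z.1 : R) by exact: measurable_fst.
have mY' j : measurable_fun setT (fun z : measurableTypeR R * Omega => Yoo j z.2).
  exact: measurableT_comp.
pose P' : probability (measurableTypeR R * Omega)%type R := (gam \x P)%E.
(* On the product space the first coordinate is Z and Yoo is read on the second, which makes them
   independent. *)
exists _, (measurableTypeR R * Omega)%type, P', (rv_of P' mZ), (fun j => rv_of P' (mY' j)); split.
- move=> A mA; rewrite (_ : _ @^-1` A = A `*` setT); last first.
    by apply/seteqP; split=> z //= [].
  transitivity (gam A * P setT)%E; first exact: product_measure1E.
  by rewrite probability_setT mule1.
- move=> A _; rewrite -(product_setTX gam P); congr (P' _).
  by apply/seteqP; split=> z //= [].
- move=> u v; have -> : dotv rho v = 0 by apply: big1 => j _; rewrite rho0 mul0r.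
  rewrite mulr0 subr0 -product_charfun//.
  rewrite (_ : (fun w => dotv v _) = fun w => \sum_j v 0 j * Yoo j w).
    by apply: measurable_sum => j; exact: measurable_funM.
  by apply/funext => w; apply: eq_bigr => j _; rewrite mxE.
move=> phi cphi [M [_ hM]].
(* [bounded_fun] provides a bound only for values strictly above M. *)
have {}hM a : `|phi a| <= M + 1 by apply: hM; rewrite ?ltrDl.
rewrite -cvg_shiftS.
have -> : ('E_P'[phi \o (fun z => (rv_of P' mZ z, rvec (fun j => rv_of P' (mY' j)) z))] =
    (Ex P' (fun z => phi (z.1, rvec (fun j => Yoo j : Omega -> R) z.2)))%:E)%E.
  by rewrite expectation_Ex//; apply: (intg_joint cphi hM).
have -> : (fun n => ('E_P[phi \o (fun w => (X n.+1 w, rvec (Y n.+1) w))])%E) =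
    EFin \o (fun n => Ex P (fun w => phi (X n.+1 w, rvec (Y n.+1) w))).
  by apply/funext => n; rewrite expectation_Ex//; apply: (intg_joint cphi hM).
apply: cvg_EFin; first exact: nearW.
apply: (@joint_cvg _ _ _ _ _ P gam (fun x => x : R) (tame_L2 tZ) d (fun n => X n.+1) F
  (fun n j => Y n.+1 j) (fun j => Yoo j) mX L2_F L2_XF XF_cvg _ mY L2_Yoo L2_YY YY_cvg mixing phi _ cphi hM).
by exists B.
Qed.
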